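(* Let $n\ge2$. There exist functions $F\colon\mathbb R^{2\times n}\to\mathbb R$ of the form $$F(A)=\frac{\nu}{2}|A|^2+G(A,\delta(A))\qquad (A=(a_{ij})\in\mathbb R^{2\times n}),$$ where $\nu>0$, $G\colon\mathbb R^{2\times n}\times\mathbb R\to\mathbb R$ is smooth and convex and $\delta(A)=a_{11}a_{22}-a_{12}a_{21}$, such that $\sigma=DF$ satisfies Condition $O_5$ (with $m=2$) and such that for every $k=1,2,\dots$ there is $C_k>0$ with $|D^kF(A)|\le C_k(|A|+1)$ for all $A\in\mathbb R^{2\times n}$.
   Context: $|A|$ is the Frobenius norm; $DF$ is the gradient of $F$, viewed as a map $\mathbb R^{2\times n}\to\mathbb R^{2\times n}$. Wave cone: $\Gamma=\{(p\otimes a,B): p\in\mathbb R^m,\ a\in\mathbb R^n\setminus\{0\},\ B\in\mathbb R^{m\times n},\ Ba=0\}$, $p\otimes a=pa^T$. Write $\rho=(\rho^1,\rho^2)\in\mathbb R^{m\times n}\times\mathbb R^{m\times n}$; $\mathbb B_r,\bar{\mathbb B}_r$ are open/closed balls of radius $r$ about $0$ in this product space. Condition $O_N$ (here $m=2$, $N=5$): $\sigma\colon\mathbb R^{m\times n}\to\mathbb R^{m\times n}$ is continuous with graph $\mathcal K$, and there exist $r_0>0$, $0<\delta_1<\delta_2<1$ and continuous maps $(\kappa_i,\gamma_i)\colon\bar{\mathbb B}_{r_0}\to[1/\delta_2,1/\delta_1]\times\Gamma$ ($1\le i\le N$) with $\sum_i\gamma_i(\rho)=0$ on $\bar{\mathbb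 B}_{r_0}$ such that, with $\pi_1(\rho)=\rho$, $\pi_i(\rho)=\rho+\gamma_1(\rho)+\dots+\gamma_{i-1}(\rho)$, $\xi_i(\rho)=\pi_i(\rho)+\kappa_i(\rho)\gamma_i(\rho)$: (P1)(i) $\xi_i(\rho)\in\mathcal K$ for all $\rho\in\bar{\mathbb B}_{r_0}$; (ii) for $i\ne j$, $\xi_i^1(\bar{\mathbb B}_{r_0})\cap\xi_j^1(\bar{\mathbb B}_{r_0})=\emptyset$ and $\pi_i^1(\bar{\mathbb B}_{r_0})\cap\pi_j^1(\bar{\mathbb B}_{r_0})=\emptyset$; (P2) with $S_i^r(\lambda)=\{\lambda\xi_i(\rho)+(1-\lambda)\pi_i(\rho):\rho\in\mathbb B_r\}$, there is $\delta_0\in(\delta_2,1)$ such that for each $0<r\le r_0$ and $\lambda\in\{0\}\cup[\delta_0,1)$ the sets $S_1^r(\lambda),\dots,S_N^r(\lambda)$ are open and pairwise disjoint. *)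

(* Defs.v *)
From HB Require Import structures.
From mathcomp Require Import all_boot all_order all_algebra.
From mathcomp Require Import all_classical all_reals all_analysis.
Set Implicit Arguments. Unset Strict Implicit. Unset Printing Implicit Defensive.
Import Order.TTheory GRing.Theory Num.Theory.
Local Open Scope ring_scope.

Section Defs.
Variable R : realType.

Definition dder (V : lmodType R) (f : V -> R) (v x : V) : R :=
  derive1 (fun t : R => f (x + t *: v)) 0.

Definition dderivable (V : lmodType R) (f : V -> R) (v x : V) : Prop :=
  derivable (fun t : R => f (x + t *: v)) 0 1.

Fixpoint iter_dder (V : lmodType R) (f : V -> R) (vs : seq V) : V -> R :=
  match vs with
  | [::] => f
  | v :: vs' => dder (iter_dder f vs') v
  end.

Definition smooth_wrt (V : lmodType R) (dist : V -> V -> R) (f : V -> R) : Prop :=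
  forall vs : seq V,
    (forall x v, dderivable (iter_dder f vs) v x) /\
    (forall x (e : R), 0 < e -> exists2 d : R, 0 < d &
        forall y, dist x y < d -> `|iter_dder f vs y - iter_dder f vs x| < e).

Variable n : nat.
Notation Mat := 'M[R]_(2, n).

Definition frob (A : Mat) : R := Num.sqrt (\sum_(i < 2) \sum_(j < n) A i j ^+ 2).

Definition entry (A : Mat) (i0 j0 : nat) : R :=
  \sum_(i < 2) \sum_(j < n) (if (i == i0 :> nat) && (j == j0 :> nat) then A i j else 0).

Definition det2 (A : Mat) : R :=
  entry A 0 0 * entry A 1 1 - entry A 0 1 * entry A 1 0.

Definition distMR (x y : Mat * R^o) : R :=
  Num.sqrt (frob (y.1 - x.1) ^+ 2 + (y.2 - x.2) ^+ 2).

Definition distM (x y : Mat) : R := frob (y - x).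

Definition convexMR (G : Mat * R^o -> R) : Prop :=
  forall (x y : Mat * R^o) (l : R), 0 <= l <= 1 ->
    G (l *: x + (1 - l) *: y) <= l * G x + (1 - l) * G y.

Definition grad (F : Mat -> R) (A : Mat) : Mat :=
  \matrix_(i < 2, j < n) dder F (delta_mx i j) A.

Definition dernorm (F : Mat -> R) (k : nat) (A : Mat) : R :=
  Num.sqrt (\sum_(t : k.-tuple ('I_2 * 'I_n))
              (iter_dder F (map (fun ij : 'I_2 * 'I_n => delta_mx ij.1 ij.2 : Mat) t) A) ^+ 2).

Notation P := (Mat * Mat)%type.

Definition pnorm (r : P) : R := Num.sqrt (frob r.1 ^+ 2 + frob r.2 ^+ 2).

Definition oball (r : R) : set P := fun rho => pnorm rho < r.
Definition cball (r : R) : set P := fun rho => pnorm rho <= r.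

Definition openP (S : set P) : Prop :=
  forall x, S x -> exists2 e : R, 0 < e & forall y, pnorm (y - x) < e -> S y.

Definition cont_onR (S : set P) (f : P -> R) : Prop :=
  forall x, S x -> forall e : R, 0 < e -> exists2 d : R, 0 < d &
    forall y, S y -> pnorm (y - x) < d -> `|f y - f x| < e.

Definition cont_onP (S : set P) (f : P -> P) : Prop :=
  forall x, S x -> forall e : R, 0 < e -> exists2 d : R, 0 < d &
    forall y, S y -> pnorm (y - x) < d -> pnorm (f y - f x) < e.

Definition continuousM (s : Mat -> Mat) : Prop :=
  forall x (e : R), 0 < e -> exists2 d : R, 0 < d &
    forall y, frob (y - x) < d -> frob (s y - s x) < e.

Definition wave_cone (g : P) : Prop :=
  exists (p : 'cV[R]_2) (a : 'cV[R]_n) (B : Mat),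
    a != 0 /\ B *m a = 0 /\ g = (p *m a^T, B).

Definition graph (sigma : Mat -> Mat) (x : P) : Prop := x.2 = sigma x.1.

Definition condO (N : nat) (sigma : Mat -> Mat) : Prop :=
  continuousM sigma /\
  exists (r0 d1 d2 : R) (kappa : 'I_N -> P -> R) (gamma : 'I_N -> P -> P),
    [/\ 0 < r0, 0 < d1, d1 < d2 & d2 < 1] /\
    (forall i, cont_onR (cball r0) (kappa i) /\ cont_onP (cball r0) (gamma i)) /\
    (forall i rho, cball r0 rho ->
        d2^-1 <= kappa i rho <= d1^-1 /\ wave_cone (gamma i rho)) /\
    (forall rho, cball r0 rho -> \sum_(i < N) gamma i rho = 0) /\
    let pi := fun (i : 'I_N) (rho : P) =>
                rho + \sum_(j < N | (j < i)%N) gamma j rho in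
    let xi := fun (i : 'I_N) (rho : P) => pi i rho + kappa i rho *: gamma i rho in
    (forall i rho, cball r0 rho -> graph sigma (xi i rho)) /\
    (forall i j : 'I_N, i != j ->
       (forall rho rho', cball r0 rho -> cball r0 rho' ->
           (xi i rho).1 <> (xi j rho').1) /\
       (forall rho rho', cball r0 rho -> cball r0 rho' ->
           (pi i rho).1 <> (pi j rho').1)) /\
    exists d0 : R, d2 < d0 /\ d0 < 1 /\
      forall (r l : R), 0 < r -> r <= r0 -> (l = 0 \/ (d0 <= l /\ l < 1)) ->
        let S := fun i : 'I_N =>
          (fun y : P => exists2 rho, oball r rho &
                       y = l *: xi i rho + (1 - l) *: pi i rho) : set P in
        (forall i, openP (S i)) /\
        (forall i j : 'I_N, i != j -> setI (S i) (S j) = set0).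

End Defs.

(* Main.v *)
Require Import Defs.
From Stdlib Require Import ZArith.
From HB Require Import structures.
From mathcomp Require Import all_boot all_order all_algebra.
From mathcomp Require Import all_classical all_reals all_analysis.
From mathcomp Require Import ssrZ zify ring lra.
Set Implicit Arguments. Unset Strict Implicit. Unset Printing Implicit Defensive.
Import Order.TTheory GRing.Theory Num.Theory.
Import numFieldNormedType.Exports.
Local Open Scope ring_scope.

(* An explicit integral closed loop of five wave-cone steps with kappa = 2 has
   nodes X_k = (Abar_k, Bbar_k).  Near Abar_k the gradient of F is the affine
   map sigma_k(A) = Bbar_k + h_k (A - Abar_k) + c_k cof(A - Abar_k), so that F is
   there h_k/2 |A - Abar_k|^2 + c_k det(A - Abar_k) plus an affine function.
   Along a direction (p (x) a, B) with B a = 0 the equation for the node over a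
   given base point pi_k is solved explicitly, given a and kappa; closing the
   loop is then an equation E(rho, Z) = 0 for the perturbation Z of the a's and
   kappas of the last four steps, solved by the implicit function theorem.  Its
   nondegeneracy, and the injectivity at the centre of rho |-> pi_k(rho) and of
   the transverse sheet coordinates of S_k(lambda), lambda near 1, are ranks of
   integer matrices (the first two columns) and a small linear system (each
   further column).

   The potential is a smooth maximum of an outer function
   4 |A|^2 + 61 sqrt(1 + |A|^2 + delta^2) - K and the five quadratics Qf k, which
   are polynomials in A affine in delta; it is convex after subtracting |A|^2/2,
   equals Qf k + const near Abar_k, and equals the outer function for large A. *)

(** * Strict differentiability and the implicit function theorem *)

(** Every |c_k| exceeds h_k, so the five quadratics are not convex in A; but det(A - Abar_k) is
    affine in (A, delta), so they are convex in that pair and a convex smooth maximum can glue them.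
    The determinant is also harmless along a step: cof(v a^T) a = 0, so (sigma_k(A + v a^T) - B) a =
    0 reduces to h_k |a|^2 v = (B - sigma_k(A)) a, and the node is a rational function of a and the
    base point (A, B). With the first entry of a normalised to 1, each of the four free steps has n
    - 1 direction entries and one kappa: Z has 4n entries, as many as E has equations, so
    injectivity in Z is enough. The obstacle in (P2) is uniformity as lambda -> 1: xi_k lies in the
    graph, which has half the dimension, so S_k(lambda) collapses. As sigma_k is affine, the
    coordinates (y^1, (y^2 - sigma_k(y^1)) / (1 - lambda)) turn S_k(lambda) into the image of a map
    that differs by 1 - lambda times a Lipschitz map from rho |-> (xi_k^1, B - sigma_k(A)), (A, B) =
    pi_k(rho). One open mapping estimate then serves all lambda near 1. *)

Section StrictDifferentiability.
Context {R : realType}.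

Lemma half_contraction_fixpoint (V : completeNormedModType R) (N : V -> V)
    (x0 : V) (s : R) : 0 <= s ->
  (forall x y, `|x - x0| <= s -> `|y - x0| <= s ->
     `|N x - N y| <= 2^-1 * `|x - y|) ->
  `|N x0 - x0| <= s / 2 -> exists2 x, `|x - x0| <= s & N x = x.
Proof.
move=> s0 ctr N0.
pose U : set V := [set x | `|x - x0| <= s]%classic.
have x0U : U x0 by rewrite /U /= subrr normr0.
have NU : set_fun U U N.
  move=> x Ux; rewrite /U /=.
  have -> : N x - x0 = (N x - N x0) + (N x0 - x0) by rewrite addrA subrK.
  apply: le_trans (ler_normD _ _) _.
  have := ctr _ _ Ux x0U; move: Ux N0; rewrite /U /=; lra.
have h0 : (0 : R) <= 2^-1 by [].
pose f : {fun U >-> U} := HB.pack_for {fun U >-> U} N (isFun.Build _ _ U U N NU).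
have [||| p Up pE] := @banach_fixed_point R V U f.
- exists (NngNum h0); split; first by rewrite /=; lra.
  by move=> [x y] [Ux Uy] /=; exact: ctr.
- have -> : U = (closed_ball_ (fun x : V => `|x|) x0 s).
    by apply/seteqP; split => x; rewrite /U /closed_ball_ /= distrC.
  exact: closed_closed_ball_.
- by exists x0.
- by exists p.
Qed.

Definition bounded_lin (U W : normedModType R) (L : U -> W) :=
  linear L /\ exists2 C : R, 0 < C & forall x, `|L x| <= C * `|x|.

(** Strict differentiability at the origin. The remainder is Lipschitz with a small constant near 0,
    which is exactly what a contraction argument consumes, so derivatives have to be computed at the
    centre of the loop only. *)
Definition sdiff (U W : normedModType R) (f L : U -> W) :=
  bounded_lin L /\
  forall e : R, 0 < e -> exists2 d : R, 0 < d & forall x y, `|x| < d -> `|y| < d ->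
    `|f x - f y - L (x - y)| <= e * `|x - y|.

Lemma blinB {U W : normedModType R} {L : U -> W} : bounded_lin L ->
  {morph L : x y / x - y}.
Proof.
by move=> [lL _] x y; rewrite addrC -scaleN1r lL scaleN1r addrC.
Qed.

Lemma blin0 {U W : normedModType R} {L : U -> W} : bounded_lin L -> L 0 = 0.
Proof. by move=> bL; have := blinB bL 0 0; rewrite !subrr. Qed.

Lemma blinN {U W : normedModType R} {L : U -> W} : bounded_lin L ->
  {morph L : x / - x}.
Proof. by move=> bL x; rewrite -sub0r (blinB bL) (blin0 bL) sub0r. Qed.

Lemma blinD {U W : normedModType R} {L : U -> W} : bounded_lin L ->
  {morph L : x y / x + y}.
Proof. by move=> bL x y; rewrite -[y in LHS]opprK (blinB bL) (blinN bL) opprK. Qed.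

Lemma sdiff_lip (U W : normedModType R) (f L : U -> W) : sdiff f L ->
  exists C d, [/\ 0 < C, 0 < d & forall x y, `|x| < d -> `|y| < d ->
    `|f x - f y| <= C * `|x - y|].
Proof.
move=> [[_ [C C0 CL]] /(_ 1 ltr01)[d d0 H]].
exists (C + 1), d; split => // [|x y xd yd]; first by rewrite addr_gt0.
have -> : f x - f y = (f x - f y - L (x - y)) + L (x - y) by rewrite subrK.
apply: le_trans (ler_normD _ _) _; rewrite mulrDl addrC.
by apply: lerD; [exact: CL|exact: H].
Qed.

Lemma sdiff_comp (U W X : normedModType R) (f : W -> X) (g : U -> W) Lf Lg :
  g 0 = 0 -> sdiff f Lf -> sdiff g Lg -> sdiff (f \o g) (Lf \o Lg).
Proof.
move=> g0 sf sg.
have [Cg [dg [Cg0 dg0 Hg]]] := sdiff_lip sg.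
have bf := sf.1.
move: sf sg => [[lf [Cf Cf0 CLf]] Hf] [[lg [Cg' Cg'0 CLg]] Hg'].
split.
  split; first by move=> a u v /=; rewrite lg lf.
  exists (Cf * Cg'); first exact: mulr_gt0.
  by move=> x /=; apply: le_trans (CLf _) _; rewrite -mulrA; apply: ler_wpM2l => //; exact: ltW.
move=> e e0.
have [d1 d10 H1] := Hf (e / (2 * Cg)) ltac:(by rewrite divr_gt0// mulr_gt0).
have [d2 d20 H2] := Hg' (e / (2 * Cf)) ltac:(by rewrite divr_gt0// mulr_gt0).
exists (Num.min (Num.min d2 dg) (d1 / Cg)).
  by rewrite !lt_min d20 dg0 divr_gt0.
move=> x y; rewrite !lt_min => /andP[/andP[x2 xg] x1] /andP[/andP[y2 yg] y1] /=.
have gs z : `|z| < dg -> `|z| < d1 / Cg -> `|g z| < d1.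
  move=> zg z1; have := Hg z 0 zg; rewrite normr0 g0 !subr0 => /(_ dg0) /le_lt_trans.
  by apply; rewrite mulrC -ltr_pdivlMr.
have -> : f (g x) - f (g y) - Lf (Lg (x - y)) =
  (f (g x) - f (g y) - Lf (g x - g y)) + Lf (g x - g y - Lg (x - y)).
  by rewrite (blinB bf (g x - g y)) addrA subrK.
apply: le_trans (ler_normD _ _) _.
apply: le_trans (lerD (H1 _ _ (gs _ xg x1) (gs _ yg y1)) (CLf _)) _.
have h1 : e / (2 * Cg) * `|g x - g y| <= e / 2 * `|x - y|.
  apply: le_trans (ler_wpM2l _ (Hg _ _ xg yg)) _.
    by rewrite divr_ge0 ?ltW// mulr_gt0.
  by rewrite le_eqVlt; apply/orP; left; apply/eqP; field; rewrite gt_eqF.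
have h2 : Cf * `|g x - g y - Lg (x - y)| <= e / 2 * `|x - y|.
  apply: le_trans (ler_wpM2l (ltW Cf0) (H2 _ _ x2 y2)) _.
  by rewrite le_eqVlt; apply/orP; left; apply/eqP; field; rewrite gt_eqF.
by have := lerD h1 h2; rewrite -mulrDl -splitr.
Qed.

Lemma sdiff_ext (U W : normedModType R) (f g L M : U -> W) :
  f =1 g -> L =1 M -> sdiff f L -> sdiff g M.
Proof. by move=> /funext -> /funext ->. Qed.

Lemma sdiff_blin (U W : normedModType R) (L : U -> W) :
  bounded_lin L -> sdiff L L.
Proof.
move=> bL; split=> // e e0; exists 1 => // x y _ _.
by rewrite (blinB bL) subrr normr0 mulr_ge0 // ltW.
Qed.

Lemma sdiff_cst (U W : normedModType R) (c : W) :
  sdiff (fun _ : U => c) (fun=> 0).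
Proof.
split; first split.
- by move=> a u v; rewrite scaler0 addr0.
- by exists 1 => // x; rewrite normr0 mul1r.
- move=> e e0; exists 1 => // x y _ _.
  by rewrite !subrr normr0 mulr_ge0// ltW.
Qed.

Lemma sdiffD (U W : normedModType R) (f g L M : U -> W) :
  sdiff f L -> sdiff g M -> sdiff (fun x => f x + g x) (fun x => L x + M x).
Proof.
move=> [[lf [Cf Cf0 CLf]] Hf] [[lg [Cg Cg0 CLg]] Hg].
split.
  split.
    by move=> a u v /=; rewrite lf lg scalerDr addrACA.
  exists (Cf + Cg); first exact: addr_gt0.
  by move=> x; rewrite mulrDl (le_trans (ler_normD _ _))// lerD.
move=> e e0; have e2 : 0 < e / 2 by rewrite divr_gt0.
have [d1 d10 H1] := Hf _ e2; have [d2 d20 H2] := Hg _ e2.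
exists (Num.min d1 d2); first by rewrite lt_min d10.
move=> x y; rewrite !lt_min => /andP[x1 x2] /andP[y1 y2].
have -> : f x + g x - (f y + g y) - (L (x - y) + M (x - y)) =
  (f x - f y - L (x - y)) + (g x - g y - M (x - y)).
  by rewrite !opprD (addrACA (f x)) [LHS]addrACA.
apply: le_trans (ler_normD _ _) _.
by have := lerD (H1 _ _ x1 y1) (H2 _ _ x2 y2); rewrite -mulrDl -splitr.
Qed.

Lemma sdiffZ (U W : normedModType R) (c : R) (f L : U -> W) :
  sdiff f L -> sdiff (fun x => c *: f x) (fun x => c *: L x).
Proof.
have b : bounded_lin (fun x : W => c *: x).
  split; first by move=> a u v; rewrite scalerDr !scalerA mulrC.
  exists (`|c| + 1); first by rewrite ltr_wpDl.
  by move=> x; rewrite normrZ ler_wpM2r// lerDl.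
move=> [[lf [Cf Cf0 CLf]] Hf].
case: b => lb [C C0 CL].
split.
  split; first by move=> a u v; rewrite lf lb.
  exists (C * Cf); first exact: mulr_gt0.
  by move=> x; apply: le_trans (CL _) _; rewrite -mulrA; apply: ler_wpM2l => //; exact: ltW.
move=> e e0; have [d d0 H] := Hf (e / C) (divr_gt0 e0 C0).
exists d => // x y xd yd; rewrite -!scalerBr.
apply: le_trans (CL _) _; apply: le_trans (ler_wpM2l (ltW C0) (H _ _ xd yd)) _.
by rewrite mulrA mulrCA mulfV ?gt_eqF// mulr1.
Qed.

Lemma sdiffM (U : normedModType R) (f g L M : U -> R^o) (a b : R) :
  f 0 = a -> g 0 = b -> sdiff f L -> sdiff g M ->
  sdiff (fun x => f x * g x : R^o) (fun x => a * M x + b * L x : R^o).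
Proof.
move=> <- <- sf sg.
have [Cg [dg [Cg0 dg0 Hg]]] := sdiff_lip sg.
have [Cf [df [Cf0 df0 Hf]]] := sdiff_lip sf.
split.
  exact: (sdiffD (sdiffZ (f 0) sg) (sdiffZ (g 0) sf)).1.
move: sf sg => [_ Hf'] [_ Hg'] e e0.
pose K := `|f 0| + `|g 0| + Cf + Cg + 1.
have K0 : 0 < K by rewrite ltr_wpDl// !addr_ge0 // ltW.
have [d1 d10 H1] := Hf' (e / (4 * K)) ltac:(by rewrite divr_gt0// mulr_gt0).
have [d2 d20 H2] := Hg' (e / (4 * K)) ltac:(by rewrite divr_gt0// mulr_gt0).
exists (Num.min (Num.min (Num.min d1 d2) (Num.min df dg)) (e / (4 * K * K))).
  by rewrite !lt_min d10 d20 df0 dg0 divr_gt0// !mulr_gt0.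
move=> x y; rewrite !lt_min => /andP[/andP[/andP[x1 x2] /andP[x3 x4]] x5].
move=> /andP[/andP[/andP[y1 y2] /andP[y3 y4]] y5].
(* In each of the last two products one factor vanishes at the origin and the other is an increment,
   so both are bounded by a small multiple of [|x - y|]. *)
have -> : f x * g x - f y * g y - (f 0 * M (x - y) + g 0 * L (x - y)) =
  f 0 * (g x - g y - M (x - y)) + g 0 * (f x - f y - L (x - y))
  + (f x - f 0) * (g x - g y) + (g y - g 0) * (f x - f y) by ring.
have F0 := Hf x 0 x3 ltac:(by rewrite normr0).
have G0 := Hg y 0 y4 ltac:(by rewrite normr0).
rewrite !subr0 in F0 G0.
have N := normr_ge0 (x - y).
apply: le_trans (ler_normD _ _) _.
apply: le_trans (lerD (ler_normD _ _) (lexx _)) _.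
apply: le_trans (lerD (lerD (ler_normD _ _) (lexx _)) (lexx _)) _.
rewrite !normrM.
have t1 : `|f 0| * `|g x - g y - M (x - y)| <= e / 4 * `|x - y|.
  apply: (@le_trans _ _ (K * (e / (4 * K) * `|x - y|))).
    apply: ler_pM => //; last exact: H2.
    by rewrite /K; have := normr_ge0 (g 0); lra.
  by rewrite le_eqVlt; apply/orP; left; apply/eqP; field; rewrite gt_eqF.
have t2 : `|g 0| * `|f x - f y - L (x - y)| <= e / 4 * `|x - y|.
  apply: (@le_trans _ _ (K * (e / (4 * K) * `|x - y|))).
    apply: ler_pM => //; last exact: H1.
    by rewrite /K; have := normr_ge0 (f 0); lra.
  by rewrite le_eqVlt; apply/orP; left; apply/eqP; field; rewrite gt_eqF.
have KCf : Cf <= K by rewrite /K; have := normr_ge0 (f 0); have := normr_ge0 (g 0); lra.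
have KCg : Cg <= K by rewrite /K; have := normr_ge0 (f 0); have := normr_ge0 (g 0); lra.
have quad (P Q z : R) : 0 <= P -> P <= K * z -> 0 <= z -> z < e / (4 * K * K) -> 0 <= Q ->
    Q <= K * `|x - y| -> P * Q <= e / 4 * `|x - y|.
  move=> P0 Pz z0 ze Q0 Qb.
  apply: (@le_trans _ _ ((K * (e / (4 * K * K))) * (K * `|x - y|))).
    apply: ler_pM => //; apply: le_trans Pz _.
    by rewrite ler_wpM2l// ltW.
  by rewrite le_eqVlt; apply/orP; left; apply/eqP; field; rewrite gt_eqF.
have t3 : `|f x - f 0| * `|g x - g y| <= e / 4 * `|x - y|.
  apply: (quad _ _ `|x|) => //.
    by apply: le_trans F0 _; rewrite ler_wpM2r.
  by apply: le_trans (Hg _ _ x4 y4) _; rewrite ler_wpM2r.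
have t4 : `|g y - g 0| * `|f x - f y| <= e / 4 * `|x - y|.
  apply: (quad _ _ `|y|) => //.
    by apply: le_trans G0 _; rewrite ler_wpM2r.
  by apply: le_trans (Hf _ _ x3 y3) _; rewrite ler_wpM2r.
lra.
Qed.

Lemma sdiffV (U : normedModType R) (f L : U -> R^o) (a : R) :
  f 0 = a -> a != 0 -> sdiff f L ->
  sdiff (fun x => (f x)^-1 : R^o) (fun x => - (a ^- 2) * L x : R^o).
Proof.
move=> fa a0 sf.
have [Cf [df [Cf0 df0 Hf]]] := sdiff_lip sf.
split; first exact: (sdiffZ (- a ^- 2) sf).1.
case: sf => _ Hf' e e0.
have A0 : 0 < `|a| by rewrite normr_gt0.
have [d1 d10 H1] := Hf' (e * `|a| ^+ 2 / 2) ltac:(by rewrite divr_gt0// mulr_gt0// exprn_gt0).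
(* 10 is 5/2 times 4: the numerator below is at most (3/2 + 1) |a| Cf (|x| + |y|), and each of the
   two reciprocals is at most 2/|a|. *)
pose K := 10 * Cf * Cf / `|a| ^+ 3.
have K0 : 0 < K by rewrite divr_gt0 ?exprn_gt0// !mulr_gt0.
exists (Num.min (Num.min d1 df) (Num.min (`|a| / (2 * Cf)) (e / (4 * K)))).
  by rewrite !lt_min d10 df0 !divr_gt0// mulr_gt0.
move=> x y; rewrite !lt_min => /andP[/andP[x1 x2] /andP[x3 x4]].
move=> /andP[/andP[y1 y2] /andP[y3 y4]].
have near z : `|z| < df -> `|f z - a| <= Cf * `|z|.
  by move=> zd; have := Hf z 0 zd; rewrite normr0 subr0 fa; apply.
have lowb z : `|z| < df -> `|z| < `|a| / (2 * Cf) -> `|a| / 2 <= `|f z|.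
  move=> zd z2; have := near _ zd.
  have : Cf * `|z| <= `|a| / 2.
    apply: le_trans (ler_wpM2l (ltW Cf0) (ltW z2)) _.
    by rewrite le_eqVlt; apply/orP; left; apply/eqP; field; rewrite gt_eqF.
  have := ler_normD (a - f z) (f z); rewrite subrK distrC; lra.
have fx := lowb _ x2 x3; have fy := lowb _ y2 y3.
have nz (z : R^o) : `|a| / 2 <= `|z| -> z != 0.
  by move=> h; apply/eqP => z0; move: h; rewrite z0 normr0; lra.
have fx0 := nz _ fx; have fy0 := nz _ fy.
set D := f x - f y.
have -> : (f x)^-1 - (f y)^-1 - - a ^- 2 * L (x - y) =
   - a ^- 2 * (D - L (x - y)) + D * (a ^- 2 - (f x)^-1 * (f y)^-1).
  by rewrite /D; field; rewrite fx0 fy0.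
have bnd : `|a ^- 2 - (f x)^-1 * (f y)^-1| <= K / Cf * (`|x| + `|y|).
  have -> : a ^- 2 - (f x)^-1 * (f y)^-1 =
     ((f x - a) * f y + a * (f y - a)) * (a ^- 2 * (f x)^-1 * (f y)^-1).
    by field; rewrite fx0 fy0.
  have ix : `|(f x)^-1| <= 2 / `|a|.
    by rewrite normfV -[2 / _]invf_div lef_pV2 ?posrE ?normr_gt0// divr_gt0.
  have iy : `|(f y)^-1| <= 2 / `|a|.
    by rewrite normfV -[2 / _]invf_div lef_pV2 ?posrE ?normr_gt0// divr_gt0.
  have fyu : `|f y| <= 3 / 2 * `|a|.
    have := ler_normD (f y - a) a; rewrite subrK.
    have := near _ y2; have : Cf * `|y| <= `|a| / 2.
      apply: le_trans (ler_wpM2l (ltW Cf0) (ltW y3)) _.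
      by rewrite le_eqVlt; apply/orP; left; apply/eqP; field; rewrite gt_eqF.
    lra.
  apply: (@le_trans _ _ ((5 / 2 * `|a| * Cf * (`|x| + `|y|)) * (`|a| ^- 2 * (2 / `|a|) * (2 / `|a|)))).
    rewrite !normrM; apply: ler_pM; rewrite ?mulr_ge0//; last first.
      have -> : `|a ^- 2| = `|a| ^- 2 by rewrite normfV normrX.
      by do 2?[apply: ler_pM => //]; rewrite ?mulr_ge0 ?invr_ge0 ?exprn_ge0.
    apply: le_trans (ler_normD _ _) _; rewrite !normrM.
    have p1 : `|f x - a| * `|f y| <= (Cf * `|x|) * (3 / 2 * `|a|).
      by apply: ler_pM => //; exact: near.
    have p2 : `|a| * `|f y - a| <= `|a| * (Cf * `|y|).
      by apply: ler_wpM2l => //; exact: near.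
    have p3 : 0 <= `|a| * Cf * `|x| by rewrite !mulr_ge0// ltW.
    have p4 : 0 <= `|a| * Cf * `|y| by rewrite !mulr_ge0// ltW.
    nra.
  by rewrite le_eqVlt; apply/orP; left; apply/eqP; rewrite /K; field; rewrite !gt_eqF.
apply: le_trans (ler_normD _ _) _; rewrite !normrM normrN normfV normrX.
have t1 : `|a| ^- 2 * `|D - L (x - y)| <= e / 2 * `|x - y|.
  apply: le_trans (ler_wpM2l _ (H1 _ _ x1 y1)) _; first by rewrite invr_ge0 exprn_ge0.
  by rewrite le_eqVlt; apply/orP; left; apply/eqP; field; rewrite gt_eqF.
have t2 : `|D| * `|a ^- 2 - (f x)^-1 * (f y)^-1| <= e / 2 * `|x - y|.
  apply: le_trans (ler_pM _ _ (Hf _ _ x2 y2) bnd) _ => //.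
  apply: (@le_trans _ _ (Cf * `|x - y| * (K / Cf * (e / (4 * K) + e / (4 * K))))).
    apply: ler_wpM2l; first by rewrite mulr_ge0// ltW.
    by apply: ler_wpM2l; [rewrite divr_ge0// ltW|rewrite lerD// ltW].
  by rewrite le_eqVlt; apply/orP; left; apply/eqP; field; rewrite !gt_eqF.
by have := lerD t1 t2; rewrite -mulrDl -splitr.
Qed.
End StrictDifferentiability.

(** * Local openness and the implicit function theorem *)

Section InverseFunction.
Context {R : realType}.

Lemma sub_subCA (V : zmodType) (a b p q : V) :
  a - p - (b - q) = - (p - q - (a - b)).
Proof. by rewrite !opprB addrACA [RHS]addrACA [- p - b]addrC. Qed.

(** The simplified Newton map x - T (f x - y) contracts by one half. Only the estimate on f - L
    enters, so one radius [d] serves a whole family of maps f. *)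
Lemma perturbed_linear_open (V : completeNormedModType R) (f L T : V -> V)
    (C d e : R) :
  {morph T : x y / x - y} -> (forall v, `|T v| <= C * `|v|) -> 0 < C ->
  (forall z, T (L z) = z) -> (forall v, T v = 0 -> v = 0) ->
  (forall x y, `|x| < d -> `|y| < d ->
     `|f x - f y - L (x - y)| <= e * `|x - y|) ->
  C * e <= 2^-1 ->
  forall x0 (s : R), `|x0| < d -> 0 < s -> exists2 t : R, 0 < t &
    forall y, `|y - f x0| < t ->
      exists x, [/\ `|x - x0| <= s, `|x| < d & f x = y].
Proof.
move=> TB TC C0 TL Tinj fL Ce x0 s x0d s0.
pose s' := Num.min s ((d - `|x0|) / 2).
have s'0 : 0 < s' by rewrite lt_min s0 divr_gt0 ?subr_gt0.
have inB x : `|x - x0| <= s' -> `|x| < d.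
  move=> h; have : `|x - x0| <= (d - `|x0|) / 2.
    by apply: le_trans h _; rewrite ge_min lexx orbT.
  by have := ler_normD (x - x0) x0; rewrite subrK; lra.
exists (s' / (2 * C)); first by rewrite divr_gt0// mulr_gt0.
move=> y yf.
pose N x := x - T (f x - y).
have [x x1 Nx] : exists2 x, `|x - x0| <= s' & N x = x.
  apply: half_contraction_fixpoint; first exact: ltW.
    move=> a b a0 b0.
    have -> : N a - N b = - T (f a - f b - L (a - b)).
      rewrite /N (TB (f a - f b)) TL sub_subCA -TB.
      by rewrite [- (f b - y)]opprB addrA subrK.
    rewrite normrN; apply: le_trans (TC _) _.
    apply: le_trans (ler_wpM2l (ltW C0) (fL _ _ (inB _ a0) (inB _ b0))) _.
    by rewrite mulrA ler_wpM2r.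
  rewrite /N addrAC subrr add0r normrN; apply: le_trans (TC _) _.
  rewrite distrC; apply: le_trans (ler_wpM2l (ltW C0) (ltW yf)) _.
  by rewrite le_eqVlt; apply/orP; left; apply/eqP; field; rewrite gt_eqF.
exists x; split.
- by apply: le_trans x1 _; rewrite ge_min lexx.
- exact: inB.
- move: Nx => /(congr1 (fun z => x - z)); rewrite /N subKr subrr => /Tinj.
  by move/eqP; rewrite subr_eq0 => /eqP.
Qed.

Lemma implicit_function (U : normedModType R) (V : completeNormedModType R)
    (E L : (U * V)%type -> V) (T : V -> V) :
  E 0 = 0 -> sdiff E L -> bounded_lin T ->
  (forall z, T (L (0, z)) = z) -> (forall v, T v = 0 -> v = 0) ->
  exists (r : R) (g : U -> V), [/\ 0 < r, g 0 = 0,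
    sdiff g (fun u => - T (L (u, 0))) &
    forall u, `|u| < r -> E (u, g u) = 0].
Proof.
move=> E0 sE bT TL Tinj.
have [[lL [CL CL0 HL]] HE] := sE; have bL := sE.1.
have [lT [C C0 TC]] := bT.
have pairN (w : (U * V)%type) : `|w| = Num.max `|w.1| `|w.2| by [].
have e0 : 0 < (4 * C)^-1 by rewrite invr_gt0 mulr_gt0.
have [d d0 Hd] := HE _ e0.
have [K [d' [K0 d'0 HK]]] := sdiff_lip sE.
pose s := Num.min d d' / 2.
have s0 : 0 < s by rewrite divr_gt0// lt_min d0.
have sd : s < d.
  rewrite ltr_pdivrMr//; apply: le_lt_trans (_ : d < _); last lra.
  by rewrite ge_min lexx.
have sd' : s < d'.
  rewrite ltr_pdivrMr//; apply: le_lt_trans (_ : d' < _); last lra.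
  by rewrite ge_min lexx orbT.
pose r := Num.min s (s / (2 * C * K)).
have r0 : 0 < r by rewrite lt_min s0 divr_gt0// !mulr_gt0.
have fixpt u : `|u| < r -> exists2 z, `|z| <= s & E (u, z) = 0.
  rewrite lt_min => /andP[us ur].
  pose N z := z - T (E (u, z)).
  have NB a b : `|a| <= s -> `|b| <= s -> `|N a - N b| <= 2^-1 * `|a - b|.
    move=> a1 b1.
    have -> : N a - N b = - T (E (u, a) - E (u, b) - L (0, a - b)).
      by rewrite /N !(blinB bT) TL sub_subCA.
    rewrite normrN; apply: le_trans (TC _) _.
    have := Hd (u, a) (u, b).
    rewrite !pairN /= !gt_max (lt_trans us sd) (le_lt_trans a1 sd) (le_lt_trans b1 sd).
    move=> /(_ isT isT).
    have -> : (u, a) - (u, b) = (0, a - b) by rewrite -[0 in RHS](subrr u).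
    rewrite subrr => h; apply: le_trans (ler_wpM2l (ltW C0) h) _.
    rewrite normr0 (max_idPr _)//.
    by rewrite mulrA ler_wpM2r// invfM mulrCA mulfV ?gt_eqF//; lra.
  have [||z z1 Nz] := @half_contraction_fixpoint _ V N 0 s (ltW s0).
  - by move=> a b; rewrite !subr0; exact: NB.
  - rewrite subr0 /N sub0r normrN; apply: le_trans (TC _) _.
    have := HK (u, 0) 0; rewrite E0 !subr0 normr0 => /(_ _ d'0).
    rewrite pairN /= normr0 (max_idPl _)// (lt_trans us sd') => /(_ isT) h.
    apply: le_trans (ler_wpM2l (ltW C0) h) _.
    apply: le_trans (ler_wpM2l (ltW C0) (ler_wpM2l (ltW K0) (ltW ur))) _.
    by rewrite le_eqVlt; apply/orP; left; apply/eqP; field; rewrite !gt_eqF.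
  - exists z; first by rewrite -[z]subr0.
    move: Nz => /(congr1 (fun y => z - y)); rewrite /N subKr subrr.
    exact: Tinj.
have [g gP] : exists g : U -> V, forall u, `|u| < r -> `|g u| <= s /\ E (u, g u) = 0.
  have : forall u, exists z, `|u| < r -> `|z| <= s /\ E (u, z) = 0.
    move=> u; case: (ltP `|u| r) => ur; last by exists 0.
    by have [z z1 z2] := fixpt u ur; exists z.
  by move=> /choice[g gP]; exists g.
(* Used twice: with the fixed e = 1/(4C) it bounds the increment of g, since the term in [g u - g v]
   on the right can be absorbed, and with small e it then gives the strict derivative. *)
have key e u v : 0 <= e ->
    `|E (u, g u) - E (v, g v) - L ((u, g u) - (v, g v))| <= e * `|(u, g u) - (v, g v)| ->
    `|u| < r -> `|v| < r ->
  `|g u - g v + T (L (u - v, 0))| <= C * e * (`|u - v| + `|g u - g v|).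
  move=> ee h ur vr.
  have -> : g u - g v + T (L (u - v, 0)) =
     - T (E (u, g u) - E (v, g v) - L ((u, g u) - (v, g v))).
    rewrite (gP _ ur).2 (gP _ vr).2 subrr sub0r (blinN bT) opprK.
    have -> : (u, g u) - (v, g v) = (0, g u - g v) + (u - v, 0).
      by congr (_, _); rewrite ?add0r ?addr0.
    by rewrite (blinD bL) (blinD bT) TL.
  rewrite normrN; apply: le_trans (TC _) _.
  rewrite -mulrA; apply: ler_wpM2l; [exact: ltW|apply: le_trans h _].
  rewrite ler_wpM2l//.
  have -> : (u, g u) - (v, g v) = (u - v, g u - g v) by [].
  by rewrite pairN /= ge_max lerDl lerDr !normr_ge0.
have M0 : 0 < C * CL by rewrite mulr_gt0.
have TLb u : `|T (L (u, 0))| <= C * CL * `|u|.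
  apply: le_trans (TC _) _; rewrite -mulrA; apply: ler_wpM2l; first exact: ltW.
  by apply: le_trans (HL _) _; rewrite pairN /= normr0 (max_idPl _).
have gin u : `|u| < r -> `|(u, g u)| < d.
  move=> ur; rewrite pairN /= gt_max (lt_trans _ sd) ?(le_lt_trans (gP _ ur).1 sd)//.
  by apply: lt_le_trans ur _; rewrite ge_min lexx.
pose K1 := 2 * (1 + C * CL).
have K10 : 0 < K1 by rewrite /K1; lra.
have glip u v : `|u| < r -> `|v| < r -> `|g u - g v| <= K1 * `|u - v|.
  move=> ur vr.
  have := key _ _ _ (ltW e0) (Hd _ _ (gin _ ur) (gin _ vr)) ur vr.
  have -> : C * (4 * C)^-1 = 4^-1 by field; rewrite gt_eqF.
  have := TLb (u - v).
  have := ler_normD (g u - g v + T (L (u - v, 0))) (- T (L (u - v, 0))).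
  rewrite addrK normrN /K1; have := normr_ge0 (u - v).
  have := normr_ge0 (g u - g v); nra.
(* Over u = 0 the point 0 is the only solution in the ball: the remainder estimate between
   [(0, g 0)] and 0 gives |g 0| <= |g 0| / 4. *)
have g00 : g 0 = 0.
  have [z0|] := eqVneq (g 0) 0 => //; rewrite -normr_gt0 => gp.
  have r00 : `|0 : U| < r by rewrite normr0.
  have := Hd (0, g 0) 0; rewrite (gin _ r00) normr0 => /(_ isT d0).
  rewrite (gP _ r00).2 E0 !subr0 sub0r normrN pairN /= normr0 (max_idPr _)//.
  move=> h; have := TC (L (0, g 0)); rewrite TL => h2.
  have := le_trans h2 (ler_wpM2l (ltW C0) h).
  have -> : C * ((4 * C)^-1 * `|g 0|) = 4^-1 * `|g 0| by field; rewrite gt_eqF.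
  by rewrite leNgt => /negP[]; lra.
clearbody r.
exists r, g; split => //; last by move=> u /gP[].
split.
  split.
    move=> a u v; rewrite scalerN -opprD -lT -lL; congr (- T (L _)).
    by apply/eqP; rewrite xpair_eqE /= scaler0 addr0 !eqxx.
  exists (C * CL) => // u; rewrite normrN; exact: TLb.
move=> e ep.
have e1 : 0 < e / (C * (1 + K1)) by rewrite divr_gt0// mulr_gt0// addr_gt0.
have [d2 d20 H2] := HE _ e1.
have d3 : 0 < d2 / K1 by exact: divr_gt0.
exists (Num.min r (Num.min d2 (d2 / K1))); first by rewrite !lt_min r0 d20 d3.
move=> u v; rewrite !lt_min => /andP[ur /andP[u2 u3]] /andP[vr /andP[v2 v3]].
have gin2 w : `|w| < r -> `|w| < d2 -> `|w| < d2 / K1 -> `|(w, g w)| < d2.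
  move=> wr w2 w3; rewrite pairN /= gt_max w2 /=.
  have := glip w 0 wr; rewrite normr0 g00 !subr0 => /(_ r0) /le_lt_trans; apply.
  by rewrite mulrC -ltr_pdivlMr.
have := key _ _ _ (ltW e1) (H2 _ _ (gin2 _ ur u2 u3) (gin2 _ vr v2 v3)) ur vr.
rewrite opprK => /le_trans; apply.
have -> : C * (e / (C * (1 + K1))) = e / (1 + K1).
  by field; rewrite !gt_eqF// addr_gt0.
have := glip _ _ ur vr => h.
apply: (@le_trans _ _ (e / (1 + K1) * ((1 + K1) * `|u - v|))).
  apply: ler_wpM2l; first by rewrite divr_ge0 ?ltW// addr_gt0.
  by rewrite [leRHS]mulrDl mul1r lerD.
by rewrite mulrA divfK// gt_eqF// addr_gt0.
Qed.

End InverseFunction.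

(** * Injectivity of the linearised loop *)

Section IntegerRows.
Context {R : realFieldType}.

(** Ranks are computed on binary integers by [vm_compute]; this map carries the result to the
    reals. *)
Definition zr (z : Z) : R := (int_of_Z z)%:~R.

Lemma zrD a b : zr (Z.add a b) = zr a + zr b.
Proof. by rewrite /zr -intrD; congr (_ %:~R); lia. Qed.
Lemma zrM a b : zr (Z.mul a b) = zr a * zr b.
Proof. by rewrite /zr -intrM; congr (_ %:~R); lia. Qed.
Lemma zrN a : zr (Z.opp a) = - zr a.
Proof. by rewrite /zr -mulrNz; congr (_ %:~R); lia. Qed.
Lemma zrB a b : zr (Z.sub a b) = zr a - zr b.
Proof. by rewrite -Z.add_opp_r zrD zrN. Qed.
Lemma zr_eq0 a : (zr a == 0) = Z.eqb a Z0.
Proof. by rewrite /zr intr_eq0; lia. Qed.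

(** Missing entries on either side count as 0, so lists of different lengths can be mixed freely. *)
Fixpoint row_eval (x : seq R) (l : seq Z) : R :=
  match x, l with
  | a :: x', z :: l' => zr z * a + row_eval x' l'
  | _, _ => 0
  end.

Fixpoint row_add (l m : seq Z) : seq Z :=
  match l, m with
  | a :: l', b :: m' => Z.add a b :: row_add l' m'
  | [::], _ => m
  | _, [::] => l
  end.

Definition row_scale (c : Z) (l : seq Z) : seq Z := map (Z.mul c) l.

Lemma row_evalD x l m : row_eval x (row_add l m) = row_eval x l + row_eval x m.
Proof.
elim: x l m => [|a x IH] [|b l] [|c m] //=; rewrite ?add0r ?addr0 //.
by rewrite IH zrD; ring.
Qed.

Lemma row_evalZ x c l : row_eval x (row_scale c l) = zr c * row_eval x l.
Proof.
elim: x l => [|a x IH] [|b l] //=; rewrite ?mulr0 //.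
by rewrite IH zrM; ring.
Qed.

Definition row_head (l : seq Z) := head Z0 l.

(** The test stands in for a proof that the gcd divides every entry; if it failed, the row would be
    kept as it is. *)
Definition row_reduce (l : seq Z) : seq Z :=
  let g := foldr Z.gcd Z0 l in
  let l' := map (fun z => Z.div z g) l in
  if row_scale g l' == l then l' else l.

Fixpoint split_pivot (rs : seq (seq Z)) : option (seq Z * seq (seq Z)) :=
  match rs with
  | [::] => None
  | r :: rs' => if Z.eqb (row_head r) Z0 then
                  if split_pivot rs' is Some (p, q) then Some (p, r :: q) else None
                else Some (r, rs')
  end.

(* Fraction-free Gaussian elimination, dividing out the content of each row. *)
Fixpoint full_rank (n : nat) (rs : seq (seq Z)) : bool :=
  if n is n'.+1 then
    if split_pivot rs is Some (p, q) then
      full_rank n' [seq row_reduce (row_add (row_scale (row_head p) (behead r))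
                           (row_scale (Z.opp (row_head r)) (behead p))) | r <- q]
    else false
  else true.

Lemma row_reduce_eval x l : row_eval x l = 0 -> row_eval x (row_reduce l) = 0.
Proof.
rewrite /row_reduce; case: ifP => // /eqP {1}<-.
set g := foldr _ _ _; set m := map _ l.
rewrite row_evalZ => /eqP; rewrite mulf_eq0 => /orP[g0|/eqP //].
rewrite zr_eq0 in g0; have {g0} gE : g = Z0 by lia.
rewrite /m gE.
elim: x l {g m gE} => [|a x IH] [|b l] //=.
rewrite IH addr0 (_ : Z.div b 0 = Z0) ?/zr ?mul0r//; by case: b.
Qed.

Lemma row_eval_split x a l :
  row_eval (a :: x) l = zr (row_head l) * a + row_eval x (behead l).
Proof. by case: l => [|b l] //=; rewrite /zr mul0r add0r; case: x. Qed.

Lemma split_pivotP rs p q : split_pivot rs = Some (p, q) ->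
  zr (row_head p) != 0 /\ forall r, r \in p :: q -> r \in rs.
Proof.
elim: rs p q => //= r rs IH p q; case: ifP => [h|h].
  case: split_pivot IH => // -[p' q'] /(_ _ _ erefl)[hp sub] [<- <-].
  split => // s; rewrite !inE => /or3P[/eqP->|/eqP->|sq].
  - by rewrite (sub p') ?orbT// inE eqxx.
  - by rewrite eqxx.
  - by rewrite (sub s) ?orbT// inE sq orbT.
by move=> [<- <-]; split=> //; rewrite zr_eq0 h.
Qed.

(** A vector killed by all rows is killed by the combinations formed in the elimination. By
    induction its tail vanishes, and the pivot row then forces its head to vanish. *)
Lemma full_rankP n rs (x : seq R) : full_rank n rs -> size x = n ->
  (forall r, r \in rs -> row_eval x r = 0) -> forall a, a \in x -> a = 0.
Proof.
elim: n rs x => [|n IH] rs [|a x] //= + [sx] H.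
case E: (split_pivot rs) => [[p q]|] // fr.
have [hp sub] := split_pivotP E.
have Hp : row_eval (a :: x) p = 0 := H _ (sub p ltac:(by rewrite inE eqxx)).
rewrite row_eval_split in Hp.
have x0 : forall b, b \in x -> b = 0.
  apply: IH fr sx _ => _ /mapP[r rq ->]; apply: row_reduce_eval.
  have Hr : row_eval (a :: x) r = 0 := H _ (sub r ltac:(by rewrite inE rq orbT)).
  rewrite row_eval_split in Hr.
  rewrite row_evalD !row_evalZ zrN.
  have -> : row_eval x (behead r) = - (zr (row_head r) * a) by lra.
  have -> : row_eval x (behead p) = - (zr (row_head p) * a) by lra.
  by ring.
have E0 : forall l : seq Z, row_eval x l = 0.
  elim: x {IH sx H Hp} x0 => [|b x IH] x0 [|c l] //=.
  rewrite IH => [|d dx]; last by apply: x0; rewrite inE dx orbT.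
  by rewrite (x0 b) ?mulr0 ?add0r// inE eqxx.
move=> b; rewrite inE => /orP[/eqP->|/x0//].
move: Hp; rewrite E0 addr0 => /eqP; rewrite mulf_eq0 (negPf hp) /= => /eqP //.
Qed.

End IntegerRows.

(** The first two columns of a pair (A, B), where the cofactor acts. The entries are of arbitrary
    type so that the tangent formulas below can run both on real numbers and on integer rows. *)
Record core_state (M : Type) := CoreState {
  cA00 : M; cA01 : M; cA10 : M; cA11 : M;
  cB00 : M; cB01 : M; cB10 : M; cB11 : M }.

Record step_data := StepData {
  sd_t : Z; sd_p0 : Z; sd_p1 : Z; sd_q0 : Z; sd_q1 : Z; sd_h : Z; sd_c : Z }.

Section TangentStep.
Variables (M : Type) (add : M -> M -> M) (scl : Z -> M -> M) (d : step_data).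
Local Notation t := (sd_t d).
Local Notation h := (sd_h d).
Local Notation c := (sd_c d).
Local Notation "a '<+>' b" := (add a b) (at level 50, left associativity).
Local Notation "a '<.>' b" := (scl a b) (at level 40).
Local Open Scope Z_scope.

(** This is h |a|^2 for a = (1, t), the denominator of the amplitude v of a step; at the centre v =
    2 p because kappa = 2. *)
Definition sd_m : Z := h * (1 + t * t).
Definition sd_v0 : Z := 2 * sd_p0 d.
Definition sd_v1 : Z := 2 * sd_p1 d.
(* Second column of [w = H (v a^T) - VB]. *)
Definition sd_w01 : Z := h * (sd_v0 * t) - c * sd_v1 - 2 * sd_q0 d.
Definition sd_w11 : Z := h * (sd_v1 * t) + c * sd_v0 - 2 * sd_q1 d.

Definition tan_w (x : core_state M) : core_state M :=
  let: CoreState A00 A01 A10 A11 B00 B01 B10 B11 := x in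
  CoreState A00 A01 A10 A11
    (B00 <+> ((- h) <.> A00 <+> (- c) <.> A11)) (B01 <+> ((- h) <.> A01 <+> c <.> A10))
    (B10 <+> ((- h) <.> A10 <+> c <.> A01)) (B11 <+> ((- h) <.> A11 <+> (- c) <.> A00)).

(** Linearised node, multiplied by [sd_m] to stay integral, together with the linearised transverse
    part w = B - sigma(A), not multiplied. [Y] perturbs t, and [D0], [D1] are [sd_m] times the
    change of v. *)
Definition tan_X (x : core_state M) (Y : M) : core_state M :=
  let: CoreState A00 A01 A10 A11 W00 W01 W10 W11 := tan_w x in
  let D0 := W00 <+> (t <.> W01 <+> (sd_w01 - 2 * h * sd_v0 * t) <.> Y) in
  let D1 := W10 <+> (t <.> W11 <+> (sd_w11 - 2 * h * sd_v1 * t) <.> Y) in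
  CoreState (sd_m <.> A00 <+> D0) (sd_m <.> A01 <+> (t <.> D0 <+> (sd_m * sd_v0) <.> Y))
    (sd_m <.> A10 <+> D1) (sd_m <.> A11 <+> (t <.> D1 <+> (sd_m * sd_v1) <.> Y))
    W00 W01 W10 W11.

(** Linearised next state times 2 [sd_m]: the factor 2 clears tau = 1/kappa = 1/2, whose
    perturbation is [T]. *)
Definition tan_next (x : core_state M) (T Y : M) : core_state M :=
  let: CoreState A00 A01 A10 A11 B00 B01 B10 B11 := x in
  let: CoreState X00 X01 X10 X11 _ _ _ _ := tan_X x Y in
  CoreState
    (sd_m <.> A00 <+> (X00 <+> (2 * sd_m * sd_v0) <.> T))
    (sd_m <.> A01 <+> (X01 <+> (2 * sd_m * (sd_v0 * t)) <.> T))
    (sd_m <.> A10 <+> (X10 <+> (2 * sd_m * sd_v1) <.> T))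
    (sd_m <.> A11 <+> (X11 <+> (2 * sd_m * (sd_v1 * t)) <.> T))
    (sd_m <.> B00 <+> (h <.> X00 <+> (c <.> X11 <+> (2 * sd_m * (2 * sd_q0 d * - t)) <.> T)))
    (sd_m <.> B01 <+> (h <.> X01 <+> ((- c) <.> X10 <+> (2 * sd_m * (2 * sd_q0 d)) <.> T)))
    (sd_m <.> B10 <+> (h <.> X10 <+> ((- c) <.> X01 <+> (2 * sd_m * (2 * sd_q1 d * - t)) <.> T)))
    (sd_m <.> B11 <+> (h <.> X11 <+> (c <.> X00 <+> (2 * sd_m * (2 * sd_q1 d)) <.> T))).

End TangentStep.

Definition core_map (M N : Type) (f : M -> N) (x : core_state M) : core_state N :=
  let: CoreState A00 A01 A10 A11 B00 B01 B10 B11 := x in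
  CoreState (f A00) (f A01) (f A10) (f A11) (f B00) (f B01) (f B10) (f B11).

Definition core_list (M : Type) (x : core_state M) : seq M :=
  let: CoreState A00 A01 A10 A11 B00 B01 B10 B11 := x in
  [:: A00; A01; A10; A11; B00; B01; B10; B11].

(* The centre loop, found by a computer search: step [k] is
   [((p0,p1) (x) (1,t), (q0,q1) (x) (-t,1))]; [h] and [c] give the Hessian
   [h |D|^2 / 2 + c det D] of the potential near the [k]-th node. *)
Definition steps : seq step_data :=
 [:: StepData (-2) (-1) (-2) 44 (-40) 3 29;
     StepData (-1) 1 1 (-62) (-62) 1 (-31);
     StepData 1 1 (-1) (-27) (-62) 2 (-55);
     StepData (-1) 2 2 (-53) 80 1 36;
     StepData 0 (-3) 0 98 84 1 (-61)].

Definition step_at k := nth (StepData 0 0 0 0 0 0 0) steps k.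

(* Row [basis_row i] picks the [i]-th of the 16 unknowns: the eight entries of
   the core of [rho], then [T_k, Y_k] for [k = 1 .. 4]. *)
Definition basis_row (i : nat) : seq Z := ncons i Z0 (Z.pos 1 :: nseq (15 - i) Z0).

Definition row_T (k : nat) := if k is k'.+1 then basis_row (8 + 2 * k') else [::].
Definition row_Y (k : nat) := if k is k'.+1 then basis_row (9 + 2 * k') else [::].

(* Integer rows of the linearised states, with their common denominator. *)
Fixpoint row_state (k : nat) : core_state (seq Z) * Z :=
  if k is k'.+1 then
    let: (x, s) := row_state k' in
    (tan_next row_add row_scale (step_at k') x (row_scale s (row_T k')) (row_scale s (row_Y k')),
     Z.mul (Z.mul 2 (sd_m (step_at k'))) s)
  else (CoreState (basis_row 0) (basis_row 1) (basis_row 2) (basis_row 3)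
         (basis_row 4) (basis_row 5) (basis_row 6) (basis_row 7), Z.pos xH).

Definition row_X (k : nat) : core_state (seq Z) :=
  let: (x, s) := row_state k in
  tan_X row_add row_scale (step_at k) x (row_scale s (row_Y k)).

(** The initial state is multiplied by [s], the denominator accumulated in the final one. *)
Definition closing_rows : seq (seq Z) :=
  let: (x, s) := row_state 5 in
  [seq row_add rr.1 (row_scale (Z.opp s) rr.2) | rr <- zip (core_list x) (core_list (row_state 0).1)].

(* The state rows have small entries: pivoting on them first keeps the
   elimination short. *)
Lemma state_rank k : (k < 5)%N ->
  full_rank 16 (core_list (row_state k).1 ++ closing_rows).
Proof.
case: k => [|[|[|[|[|k]]]]] k5; last by exfalso; move: k5.
all: by vm_compute.
Qed.

Lemma point_rank k : (k < 5)%N ->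
  full_rank 16 (core_list (row_X k) ++ closing_rows).
Proof.
case: k => [|[|[|[|[|k]]]]] k5; last by exfalso; move: k5.
all: by vm_compute.
Qed.

Section Naturality.
Variables (M N : Type) (addM : M -> M -> M) (sclM : Z -> M -> M)
  (addN : N -> N -> N) (sclN : Z -> N -> N) (f : M -> N).
Hypothesis fD : forall a b, f (addM a b) = addN (f a) (f b).
Hypothesis fZ : forall z a, f (sclM z a) = sclN z (f a).

(** Naturality is applied to two linear maps: evaluation of a row at the unknowns, and
    multiplication by the accumulated denominator. *)
Lemma tan_X_natural d x Y :
  core_map f (tan_X addM sclM d x Y) = tan_X addN sclN d (core_map f x) (f Y).
Proof. by case: x => *; rewrite /tan_X /=; rewrite !(fD, fZ). Qed.

Lemma tan_next_natural d x T Y :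
  core_map f (tan_next addM sclM d x T Y) =
  tan_next addN sclN d (core_map f x) (f T) (f Y).
Proof. by case: x => *; rewrite /tan_next /=; rewrite !(fD, fZ). Qed.

End Naturality.

Lemma core_list_map (M N : Type) (f : M -> N) x :
  core_list (core_map f x) = map f (core_list x).
Proof. by case: x. Qed.

Section CoreKernel.
Context {R : realFieldType}.
Local Notation scl := (fun (z : Z) (x : R) => @zr R z * x).
Local Notation add := (fun x y : R => x + y).
Variables (st : nat -> core_state R) (T Y : nat -> R).
Hypotheses (T0 : T 0%N = 0) (Y0 : Y 0%N = 0).
Hypothesis step : forall k, (k < 5)%N ->
  core_map (fun a => @zr R (Z.mul 2 (sd_m (step_at k))) * a) (st k.+1) =
  tan_next add scl (step_at k) (st k) (T k) (Y k).
Hypothesis closed : st 5 = st 0%N.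

Let x : seq R := core_list (st 0%N) ++
  [:: T 1%N; Y 1%N; T 2; Y 2; T 3; Y 3; T 4; Y 4].

Let basisE i : (i < 16)%N -> row_eval x (basis_row i) = nth 0 x i.
Proof.
rewrite /x; case: (st 0%N) => a1 a2 a3 a4 a5 a6 a7 a8.
have z0 : @zr R Z0 = 0 by [].
have z1 : @zr R (Z.pos xH) = 1 by [].
by case: i => [|[|[|[|[|[|[|[|[|[|[|[|[|[|[|[|i]]]]]]]]]]]]]]]] //= _; rewrite !(z0, z1, mul0r, mul1r, add0r, addr0).
Qed.

Let TE k : (k < 5)%N -> row_eval x (row_T k) = T k.
Proof.
case: k => [_|k k4]; first by rewrite /row_T T0; case: (x).
rewrite /row_T basisE; last by lia.
by rewrite /x; case: (st 0%N) => a1 a2 a3 a4 a5 a6 a7 a8; case: k k4 => [|[|[|[|k]]]].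
Qed.

Let YE k : (k < 5)%N -> row_eval x (row_Y k) = Y k.
Proof.
case: k => [_|k k4]; first by rewrite /row_Y Y0; case: (x).
rewrite /row_Y basisE; last by lia.
by rewrite /x; case: (st 0%N) => a1 a2 a3 a4 a5 a6 a7 a8; case: k k4 => [|[|[|[|k]]]].
Qed.

Let stateE k : (k <= 5)%N ->
  core_map (row_eval x) (row_state k).1 =
  core_map (fun a => zr (row_state k).2 * a) (st k).
Proof.
elim: k => [_|k IH k5].
  have z1 : @zr R (Z.pos xH) = 1 by [].
  rewrite [core_map _ _]/= !basisE// /x /= z1; case: (st 0%N) => a1 a2 a3 a4 a5 a6 a7 a8.
  by rewrite /= !mul1r.
have {}IH := IH (ltnW k5); move: IH; rewrite [row_state k.+1]/=.
case: (row_state k) => y s /= IH.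
rewrite (tan_next_natural (addN := add) (sclN := scl) (row_evalD x) (row_evalZ x)).
rewrite !row_evalZ TE// YE// IH.
rewrite -(@tan_next_natural _ _ add scl add scl (fun a => zr s * a)); last first.
- by move=> z a; rewrite mulrCA.
- by move=> a b; rewrite mulrDr.
rewrite -step//; case: (st k.+1) => * /=; rewrite zrM; congr CoreState; ring.
Qed.

Let closingE r : r \in closing_rows -> row_eval x r = 0.
Proof.
move=> rc; have {rc} : row_eval x r \in map (row_eval x) closing_rows by exact: map_f.
have := stateE (leqnn 5); have := stateE (leq0n 5).
rewrite /closing_rows closed.
case: (row_state 5) => y s; rewrite [(_, _).1]/= [(_, _).2]/=.
have -> : (row_state 0).2 = Z.pos xH by [].
case: (row_state 0).1 => p1 p2 p3 p4 p5 p6 p7 p8.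
case: y => q1 q2 q3 q4 q5 q6 q7 q8; case: (st 0%N) => a1 a2 a3 a4 a5 a6 a7 a8.
move=> [E1 E2 E3 E4 E5 E6 E7 E8] [F1 F2 F3 F4 F5 F6 F7 F8].
have z1 : @zr R (Z.pos xH) = 1 by [].
rewrite /= !inE !row_evalD !row_evalZ !zrN z1 in E1 E2 E3 E4 E5 E6 E7 E8 *.
rewrite F1 F2 F3 F4 F5 F6 F7 F8 E1 E2 E3 E4 E5 E6 E7 E8.
by rewrite !mul1r !mulNr !subrr !orbb => /eqP.
Qed.

Let conclude : (forall a, a \in x -> a = 0) ->
  core_list (st 0%N) = nseq 8 0 /\ forall k, (k < 5)%N -> T k = 0 /\ Y k = 0.
Proof.
move=> x0; split.
  have {1}<- : size (core_list (st 0%N)) = 8%N by case: (st 0%N).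
  apply/all_pred1P/allP => a ax; apply/eqP/x0.
  by rewrite /x mem_cat ax.
have x1 a : a \in [:: T 1%N; Y 1%N; T 2; Y 2; T 3; Y 3; T 4; Y 4] -> a = 0.
  by move=> ax; apply: x0; rewrite /x mem_cat ax orbT.
by move=> [|[|[|[|[|k]]]]] //= _; split; rewrite ?T0 ?Y0 //; apply: x1; rewrite !inE eqxx ?orbT.
Qed.

(** Eight rows for the vanishing state and eight for the closing of the loop form a 16 by 16 system
    in the core of rho and the T_k, Y_k, which has full rank. The next lemma replaces the state by
    the node and its transverse part. *)
Lemma core_state_kernel k : (k < 5)%N -> core_list (st k) = nseq 8 0 ->
  core_list (st 0%N) = nseq 8 0 /\ forall k, (k < 5)%N -> T k = 0 /\ Y k = 0.
Proof.
move=> k5 stk; apply: conclude.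
apply: (full_rankP (state_rank k5)); first by rewrite /x size_cat; case: (st 0%N).
move=> r; rewrite mem_cat => /orP[rk|/closingE//].
have : row_eval x r \in map (row_eval x) (core_list (row_state k).1) by exact: map_f.
rewrite -core_list_map (stateE (ltnW k5)) core_list_map stk /=.
by rewrite !inE mulr0 !orbb => /eqP.
Qed.

Lemma core_point_kernel k : (k < 5)%N ->
  core_list (tan_X add scl (step_at k) (st k) (Y k)) = nseq 8 0 ->
  core_list (st 0%N) = nseq 8 0 /\ forall k, (k < 5)%N -> T k = 0 /\ Y k = 0.
Proof.
move=> k5 stk; apply: conclude.
apply: (full_rankP (point_rank k5)); first by rewrite /x size_cat; case: (st 0%N).
move=> r; rewrite mem_cat => /orP[rk|/closingE//].
have : row_eval x r \in map (row_eval x) (core_list (row_X k)) by exact: map_f.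
have := stateE (ltnW k5); rewrite -core_list_map /row_X.
case: (row_state k) => y s /= E.
rewrite (tan_X_natural (addN := add) (sclN := scl) (row_evalD x) (row_evalZ x)).
rewrite row_evalZ YE// E -(@tan_X_natural _ _ add scl add scl (fun a => zr s * a)).
- by rewrite core_list_map stk /= !inE mulr0 !orbb => /eqP.
- by move=> a b; rewrite mulrDr.
- by move=> z a; rewrite mulrCA.
Qed.

End CoreKernel.

Section NumeralValues.
Context {R : realFieldType}.

Lemma zr_pos_xO p : @zr R (Z.pos (xO p)) = 2 * zr (Z.pos p).
Proof. by rewrite -[Z.pos (xO p)]/(Z.mul 2 (Z.pos p)) zrM. Qed.
Lemma zr_pos_xI p : @zr R (Z.pos (xI p)) = 2 * zr (Z.pos p) + 1.
Proof. by rewrite -[Z.pos (xI p)]/(Z.add (Z.mul 2 (Z.pos p)) 1) zrD zrM. Qed.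
Lemma zr_1 : @zr R (Z.pos xH) = 1.
Proof. by []. Qed.
Lemma zr_neg p : @zr R (Z.neg p) = - zr (Z.pos p).
Proof. by rewrite -zrN. Qed.
Lemma zr_0 : @zr R Z0 = 0.
Proof. by []. Qed.

Definition zrE := (zr_neg, zr_pos_xO, zr_pos_xI, zr_1, zr_0).

End NumeralValues.

(** * The linearised loop in a further column *)

Section ColumnKernel.
Context {R : realFieldType}.
Variables (A0 A1 B0 B1 y : nat -> R).
Local Notation p0 k := (@zr R (sd_p0 (step_at k))).
Local Notation p1 k := (@zr R (sd_p1 (step_at k))).
Local Notation h k := (@zr R (sd_h (step_at k))).
Hypothesis y0 : y 0%N = 0.
Hypothesis stepA : forall k, (k < 5)%N ->
  A0 k.+1 = A0 k + p0 k * y k /\ A1 k.+1 = A1 k + p1 k * y k.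
Hypothesis stepB : forall k, (k < 5)%N ->
  2 * B0 k.+1 = B0 k + h k * (A0 k + 2 * p0 k * y k) /\
  2 * B1 k.+1 = B1 k + h k * (A1 k + 2 * p1 k * y k).
Hypothesis closed : [/\ A0 5 = A0 0%N, A1 5 = A1 0%N, B0 5 = B0 0%N & B1 5 = B1 0%N].

(** Beyond the second column the cofactor and the central directions vanish, so each column
    decouples: eight unknowns, namely the four initial entries and y_1, ..., y_4, with four
    equations from the vanishing state and four from closing. *)
Lemma column_state_kernel k : (k < 5)%N ->
  [/\ A0 k = 0, A1 k = 0, B0 k = 0 & B1 k = 0] ->
  [/\ A0 0%N = 0, A1 0%N = 0, B0 0%N = 0 & B1 0%N = 0] /\
  forall k, (k < 5)%N -> y k = 0.
Proof.
have [[e1 f1] [e2 f2] [e3 f3] [e4 f4] [e5 f5]] :=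
  And5 (stepA (isT : (0 < 5)%N)) (stepA (isT : (1 < 5)%N)) (stepA (isT : (2 < 5)%N))
    (stepA (isT : (3 < 5)%N)) (stepA (isT : (4 < 5)%N)).
have [[g1 k1] [g2 k2] [g3 k3] [g4 k4] [g5 k5']] :=
  And5 (stepB (isT : (0 < 5)%N)) (stepB (isT : (1 < 5)%N)) (stepB (isT : (2 < 5)%N))
    (stepB (isT : (3 < 5)%N)) (stepB (isT : (4 < 5)%N)).
case: closed => c1 c2 c3 c4.
rewrite /= ?zrE y0 in e1 f1 e2 f2 e3 f3 e4 f4 e5 f5 g1 k1 g2 k2 g3 k3 g4 k4 g5 k5'.
move=> k5 k0.
have [Y1 Y2 Y3 Y4] : [/\ y 1%N = 0, y 2 = 0, y 3 = 0 & y 4 = 0].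
  by case: k k5 k0 => [|[|[|[|[|k]]]]] // _ [a1 a2 b1 b2]; split; lra.
split; last by move=> [|[|[|[|[|j]]]]].
rewrite Y1 Y2 Y3 Y4 in e1 f1 e2 f2 e3 f3 e4 f4 e5 f5 g1 k1 g2 k2 g3 k3 g4 k4 g5 k5'.
by case: k k5 k0 => [|[|[|[|[|k]]]]] // _ [a1 a2 b1 b2]; split; lra.
Qed.

Lemma column_point_kernel k : (k < 5)%N ->
  [/\ A0 k + 2 * p0 k * y k = 0, A1 k + 2 * p1 k * y k = 0,
      B0 k = h k * A0 k & B1 k = h k * A1 k] ->
  [/\ A0 0%N = 0, A1 0%N = 0, B0 0%N = 0 & B1 0%N = 0] /\
  forall k, (k < 5)%N -> y k = 0.
Proof.
have [[e1 f1] [e2 f2] [e3 f3] [e4 f4] [e5 f5]] :=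
  And5 (stepA (isT : (0 < 5)%N)) (stepA (isT : (1 < 5)%N)) (stepA (isT : (2 < 5)%N))
    (stepA (isT : (3 < 5)%N)) (stepA (isT : (4 < 5)%N)).
have [[g1 k1] [g2 k2] [g3 k3] [g4 k4] [g5 k5']] :=
  And5 (stepB (isT : (0 < 5)%N)) (stepB (isT : (1 < 5)%N)) (stepB (isT : (2 < 5)%N))
    (stepB (isT : (3 < 5)%N)) (stepB (isT : (4 < 5)%N)).
case: closed => c1 c2 c3 c4.
rewrite /= ?zrE y0 in e1 f1 e2 f2 e3 f3 e4 f4 e5 f5 g1 k1 g2 k2 g3 k3 g4 k4 g5 k5'.
move=> k5 k0.
have [Y1 Y2 Y3 Y4] : [/\ y 1%N = 0, y 2 = 0, y 3 = 0 & y 4 = 0].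
  by case: k k5 k0 => [|[|[|[|[|k]]]]] // _ [] /=; rewrite ?zrE ?y0 => a1 a2 b1 b2; split; lra.
split; last by move=> [|[|[|[|[|j]]]]].
rewrite Y1 Y2 Y3 Y4 in e1 f1 e2 f2 e3 f3 e4 f4 e5 f5 g1 k1 g2 k2 g3 k3 g4 k4 g5 k5'.
case: k k5 k0 => [|[|[|[|[|k]]]]] // _ [] /=; rewrite ?zrE ?y0 ?Y1 ?Y2 ?Y3 ?Y4 => a1 a2 b1 b2;
  by split; lra.
Qed.

End ColumnKernel.

(** * The perturbed loop *)

HB.instance Definition _ (R : realType) (p q : nat) := Complete.on 'M[R]_(p, q).

Section Matrices.
Context {R : realType}.

Lemma mx_norm_entry (p q : nat) (M : 'M[R]_(p, q)) i j : `|M i j| <= `|M|.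
Proof.
rewrite -[`|M|]/(mx_norm M) mx_normrE.
exact: (le_bigmax 0 (fun ij : 'I_p * 'I_q => `|M ij.1 ij.2|) (i, j)).
Qed.

Lemma mx_norm_le (p q : nat) (M : 'M[R]_(p, q)) (c : R) : 0 <= c ->
  (forall i j, `|M i j| <= c) -> `|M| <= c.
Proof.
move=> c0 H; rewrite -[`|M|]/(mx_norm M) mx_normrE.
by apply/bigmax_leP; split => // -[i j] _; exact: H.
Qed.

Lemma sdiff_mx (U : normedModType R) (p q : nat) (f L : U -> 'M[R]_(p, q)) :
  (forall i j, sdiff (fun u => f u i j : R^o) (fun u => L u i j : R^o)) ->
  sdiff f L.
Proof.
move=> H.
have [C HC] : exists C : 'I_p * 'I_q -> R, forall ij, 0 < C ij /\
    forall x, `|L x ij.1 ij.2| <= C ij * `|x|.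
  suff : forall ij : 'I_p * 'I_q, exists c : R, 0 < c /\
    forall x, `|L x ij.1 ij.2| <= c * `|x| by move=> /choice[C HC]; exists C.
  by move=> [i j]; have [[_ [c c0 h]] _] := H i j; exists c.
split; first split.
- by move=> a u v; apply/matrixP => i j; have [[-> _] _] := H i j; rewrite !mxE.
- exists (1 + \sum_ij C ij).
    by rewrite ltr_pwDl// sumr_ge0// => ij _; exact: ltW (HC ij).1.
  move=> x; apply: mx_norm_le => [|i j].
    by rewrite mulr_ge0// addr_ge0// sumr_ge0// => ij _; exact: ltW (HC ij).1.
  apply: le_trans ((HC (i, j)).2 x) _; rewrite ler_wpM2r//.
  rewrite (bigD1 (i, j))//= addrCA lerDl addr_ge0//.
  by rewrite sumr_ge0// => ij _; exact: ltW (HC ij).1.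
- move=> e e0.
  have [d Hd] : exists d : 'I_p * 'I_q -> R, forall ij, 0 < d ij /\
      forall x y, `|x| < d ij -> `|y| < d ij ->
      `|f x ij.1 ij.2 - f y ij.1 ij.2 - L (x - y) ij.1 ij.2| <= e * `|x - y|.
    suff : forall ij : 'I_p * 'I_q, exists c : R, 0 < c /\
        forall x y, `|x| < c -> `|y| < c ->
        `|f x ij.1 ij.2 - f y ij.1 ij.2 - L (x - y) ij.1 ij.2| <= e * `|x - y|
      by move=> /choice[d Hd]; exists d.
    by move=> [i j]; have [_ /(_ _ e0)[c c0 h]] := H i j; exists c.
  exists (\big[Num.min/1]_ij d ij).
    by apply/bigmin_gtP; split => // ij _; exact: (Hd ij).1.
  move=> x y /bigmin_gtP[_ xd] /bigmin_gtP[_ yd].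
  apply: mx_norm_le => [|i j]; first by rewrite mulr_ge0// ltW.
  by rewrite !mxE; apply: (Hd (i, j)).2; [exact: xd|exact: yd].
Qed.

Lemma linear_mx_bounded (W : normedModType R) (p q : nat) (f : 'M[R]_(p, q) -> W) :
  linear f -> bounded_lin f.
Proof.
move=> lf; split => //.
have f0 : f 0 = 0 by have := lf (-1) 0 0; rewrite scaler0 addr0 scaleN1r addNr.
have fD u v : f (u + v) = f u + f v by rewrite -[u]scale1r lf !scale1r.
have fZ a u : f (a *: u) = a *: f u by rewrite -[a *: u]addr0 lf f0 addr0.
exists (1 + \sum_(ij : 'I_p * 'I_q) `|f (delta_mx ij.1 ij.2)|).
  by rewrite ltr_pwDl// sumr_ge0.
move=> x; rewrite [in leLHS](matrix_sum_delta x) pair_big /=.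
rewrite (big_morph f fD f0) (le_trans (ler_norm_sum _ _ _))//.
rewrite mulrDl mul1r; apply: ler_wpDl => //.
rewrite mulr_suml; apply: ler_sum => -[i j] _ /=.
by rewrite fZ normrZ mulrC ler_wpM2l// mx_norm_entry.
Qed.

(** In finite dimension an injective endomorphism is invertible and its inverse is bounded. *)
Lemma injective_linear_inverse (p q : nat) (f : 'M[R]_(p, q) -> 'M[R]_(p, q)) :
  linear f -> (forall z, f z = 0 -> z = 0) ->
  exists T : 'M[R]_(p, q) -> 'M[R]_(p, q),
    [/\ bounded_lin T, forall z, T (f z) = z & forall z, f (T z) = z].
Proof.
move=> lf f0.
pose F : {linear 'M[R]_(p, q) -> 'M[R]_(p, q)} :=
  HB.pack f (GRing.isLinear.Build R _ _ *:%R f lf).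
have FE z : f z = linfun F z by rewrite lfunE.
have k0 : lker (linfun F) == 0%VS.
  apply/lker0P => x y; rewrite -!FE => /eqP; rewrite -subr_eq0 => /eqP h.
  apply/eqP; rewrite -subr_eq0; apply/eqP/f0.
  by rewrite FE raddfB /= -!FE.
exists ((linfun F)^-1)%VF; split.
- by apply: linear_mx_bounded => a u v; rewrite linearP.
- by move=> z; rewrite FE lker0_lfunK.
- by move=> z; rewrite FE lker0_lfunVK.
Qed.

End Matrices.

Section Jets.
Context {R : realType} {U : normedModType R}.

(** Value and strict derivative at the origin travel together because the product and quotient rules
    need both. *)
Definition jet (f : U -> R) (v : R) (l : U -> R) : Prop :=
  f 0 = v /\ sdiff (f : U -> R^o) (l : U -> R^o).

Lemma jet_ext f g v w l l' : f =1 g -> v = w -> l =1 l' ->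
  jet f v l -> jet g w l'.
Proof. by move=> /funext <- <- /funext <-. Qed.

Lemma jet_cst c : jet (fun=> c) c (fun=> 0).
Proof. by split => //; exact: (@sdiff_cst R U (R^o : normedModType R) c). Qed.

Lemma jetD f g v w l l' : jet f v l -> jet g w l' ->
  jet (fun u => f u + g u) (v + w) (fun u => l u + l' u).
Proof. by move=> [<- sf] [<- sg]; split => //; exact: (@sdiffD R U (R^o : normedModType R) _ _ _ _ sf sg). Qed.

Lemma jetM f g v w l l' : jet f v l -> jet g w l' ->
  jet (fun u => f u * g u) (v * w) (fun u => v * l' u + w * l u).
Proof. by move=> [f0 sf] [g0 sg]; split; [rewrite f0 g0|exact: (@sdiffM R U _ _ _ _ _ _ f0 g0 sf sg)]. Qed.

Lemma jetV f v l : v != 0 -> jet f v l ->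
  jet (fun u => (f u)^-1) v^-1 (fun u => - v ^- 2 * l u).
Proof. by move=> v0 [f0 sf]; split; [rewrite f0|exact: (@sdiffV R U _ _ _ f0 v0 sf)]. Qed.

Lemma jetZ c f v l : jet f v l -> jet (fun u => c * f u) (c * v) (fun u => c * l u).
Proof.
by move=> /(jetM (jet_cst c)); apply: jet_ext => // u; rewrite mulr0 addr0.
Qed.

Lemma jetN f v l : jet f v l -> jet (fun u => - f u) (- v) (fun u => - l u).
Proof.
by move=> /(jetZ (-1)); apply: jet_ext => [u||u]; rewrite mulN1r.
Qed.

Lemma jetB f g v w l l' : jet f v l -> jet g w l' ->
  jet (fun u => f u - g u) (v - w) (fun u => l u - l' u).
Proof. by move=> jf /jetN; exact: jetD. Qed.

Lemma jet_sum (I : finType) (f : I -> U -> R) v l :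
  (forall i, jet (f i) (v i) (l i)) ->
  jet (fun u => \sum_i f i u) (\sum_i v i) (fun u => \sum_i l i u).
Proof.
move=> H; elim: (index_enum I) => [|i s IH].
  by apply: jet_ext (jet_cst 0) => [u||u]; rewrite ?big_nil.
by apply: jet_ext (jetD (H i) IH) => [u||u]; rewrite ?big_cons.
Qed.

End Jets.

(** * The loop as a function of the base point rho and the perturbation Z *)

Section Configuration.
Context {R : realType} (m : nat).
Local Notation n := m.+2.
Local Notation Mat := 'M[R]_(2, n).
Local Notation V := 'M[R]_(2 + 2, n).
Local Notation U := (V * V)%type.

Definition row1 : 'I_2 := lift ord0 ord0.
Definition col1 : 'I_n := lift ord0 ord0.
Definition col_far (j : 'I_m) : 'I_n := lift ord0 (lift ord0 j).

Lemma col_ind (P : 'I_n -> Prop) : P ord0 -> P col1 -> (forall j, P (col_far j)) ->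
  forall j, P j.
Proof.
move=> P0 P1 P2 j; case: (unliftP ord0 j) => [j' ->|-> //].
by case: (unliftP ord0 j') => [j'' ->|->]; [exact: P2|exact: P1].
Qed.

Lemma row_ind (P : 'I_2 -> Prop) : P ord0 -> P row1 -> forall i, P i.
Proof.
move=> P0 P1 i; case: (unliftP ord0 i) => [i' ->|-> //].
by rewrite (ord1 i'); exact: P1.
Qed.

Lemma sum_cols (F : 'I_n -> R) :
  \sum_j F j = F ord0 + F col1 + \sum_j F (col_far j).
Proof. by rewrite !big_ord_recl addrA. Qed.

Definition core (a b c d : R) : Mat :=
  \matrix_(i, j) if (j == 0 :> nat) then (if (i == 0 :> nat) then a else c)
    else if (j == 1 :> nat) then (if (i == 0 :> nat) then b else d) else 0.

(** The gradient of the determinant of the first two columns, extended by zero to the other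
    columns. *)
Definition cofm (A : Mat) : Mat :=
  core (A row1 col1) (- A row1 ord0) (- A ord0 col1) (A ord0 ord0).

Local Notation t k := (@zr R (sd_t (step_at k))).
Local Notation p0 k := (@zr R (sd_p0 (step_at k))).
Local Notation p1 k := (@zr R (sd_p1 (step_at k))).
Local Notation q0 k := (@zr R (sd_q0 (step_at k))).
Local Notation q1 k := (@zr R (sd_q1 (step_at k))).
Local Notation h k := (@zr R (sd_h (step_at k))).
Local Notation c k := (@zr R (sd_c (step_at k))).

Definition Cgam1 k := core (p0 k) (p0 k * t k) (p1 k) (p1 k * t k).
Definition Cgam2 k := core (- (q0 k * t k)) (q0 k) (- (q1 k * t k)) (q1 k).
Definition piA k := \sum_(l < k) Cgam1 l.
Definition piB k := \sum_(l < k) Cgam2 l.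
Definition Abar k := piA k + 2 *: Cgam1 k.
Definition Bbar k := piB k + 2 *: Cgam2 k.

Definition hess k (D : Mat) : Mat := h k *: D + c k *: cofm D.
Definition sigma k (A : Mat) : Mat := Bbar k + hess k (A - Abar k).

Definition acen k (j : 'I_n) : R :=
  if (j == 0 :> nat) then 1 else if (j == 1 :> nat) then t k else 0.
Definition pcen k (r : 'I_2) : R := if (r == 0 :> nat) then p0 k else p1 k.

(* Step 0 has constant direction and constant [kappa]. *)
Definition Zrow (k : nat) (Z : V) (j : 'I_n) : R :=
  if k is k'.+1 then Z (inord k') j else 0.
(** Fixing the first entry of a at 1 removes the scaling freedom of the direction and frees column 0
    of Z, which is used to perturb tau. *)
Definition da k (Z : V) (j : 'I_n) : R := if (j == 0 :> nat) then 0 else Zrow k Z j.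
Definition avec k Z j := acen k j + da k Z j.
(** This is 1/kappa. With it gamma = tau (xi - pi), so the next state is obtained without a division
    by kappa. *)
Definition tau k Z : R := 2^-1 + Zrow k Z ord0.

Definition wst k (x : Mat * Mat) : Mat := x.2 - sigma k x.1.
(** The amplitude v for which the node A + v a^T satisfies (sigma(A + v a^T) - B) a = 0: the
    cofactor of v a^T kills a, leaving h |a|^2 v = w a. *)
Definition vst k Z x r : R :=
  (\sum_j wst k x r j * avec k Z j) * (h k * \sum_j avec k Z j * avec k Z j)^-1.
Definition Xst k Z (x : Mat * Mat) : Mat :=
  \matrix_(r, j) (x.1 r j + vst k Z x r * avec k Z j).
Definition nxt k Z (x : Mat * Mat) : Mat * Mat :=
  (x.1 + tau k Z *: (Xst k Z x - x.1), x.2 + tau k Z *: (sigma k (Xst k Z x) - x.2)).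
Fixpoint state k (u : U) : Mat * Mat :=
  if k is k'.+1 then nxt k' u.2 (state k' u) else (usubmx u.1, dsubmx u.1).

Definition dw k (dx : Mat * Mat) : Mat := dx.2 - hess k dx.1.
Definition wcen k : Mat := piB k - sigma k (piA k).
Definition sdm k : R := h k * (1 + t k * t k).
(** Quotient rule for [vst] at the centre, where the quotient is 2 p and the denominator [sdm]. *)
Definition dv k Z dx r : R := (sdm k)^-1 *
  (\sum_j (wcen k r j * da k Z j + acen k j * dw k dx r j)
   - 2 * h k * (2 * pcen k r) * \sum_j acen k j * da k Z j).
Definition dX k Z (dx : Mat * Mat) : Mat :=
  \matrix_(r, j) (dx.1 r j + (2 * pcen k r * da k Z j + acen k j * dv k Z dx r)).
Definition dnxt k Z (dx : Mat * Mat) : Mat * Mat :=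
  (dx.1 + (2^-1 *: (dX k Z dx - dx.1) + Zrow k Z ord0 *: (2 *: Cgam1 k)),
   dx.2 + (2^-1 *: (hess k (dX k Z dx) - dx.2) + Zrow k Z ord0 *: (2 *: Cgam2 k))).
Fixpoint dstate k (u : U) : Mat * Mat :=
  if k is k'.+1 then dnxt k' u.2 (dstate k' u) else (usubmx u.1, dsubmx u.1).

Lemma h_gt0 k : (k < 5)%N -> 0 < h k.
Proof.
case: k => [|[|[|[|[|k]]]]] // _; rewrite /= ?zrE; lra.
Qed.

Lemma sdm_gt0 k : (k < 5)%N -> 0 < sdm k.
Proof. by move=> k5; rewrite mulr_gt0 ?h_gt0//; nra. Qed.

Definition mjet (f : U -> Mat) (F : Mat) (L : U -> Mat) :=
  forall r j, jet (fun u => f u r j) (F r j) (fun u => L u r j).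

Lemma cofm_jet f F L : mjet f F L ->
  mjet (fun u => cofm (f u)) (cofm F) (fun u => cofm (L u)).
Proof.
move=> H r j; move: r j; apply: row_ind; apply: col_ind => [||j].
- by apply: jet_ext (H row1 col1) => [u||u]; rewrite !mxE.
- by apply: jet_ext (jetN (H row1 ord0)) => [u||u]; rewrite !mxE.
- by apply: jet_ext (jet_cst 0) => [u||u]; rewrite !mxE.
- by apply: jet_ext (jetN (H ord0 col1)) => [u||u]; rewrite !mxE.
- by apply: jet_ext (H ord0 ord0) => [u||u]; rewrite !mxE.
- by apply: jet_ext (jet_cst 0) => [u||u]; rewrite !mxE.
Qed.

Lemma mjetD f g F G L M : mjet f F L -> mjet g G M ->
  mjet (fun u => f u + g u) (F + G) (fun u => L u + M u).
Proof.
by move=> H K r j; apply: jet_ext (jetD (H r j) (K r j)) => [u||u]; rewrite !mxE.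
Qed.

Lemma mjetB f g F G L M : mjet f F L -> mjet g G M ->
  mjet (fun u => f u - g u) (F - G) (fun u => L u - M u).
Proof.
by move=> H K r j; apply: jet_ext (jetB (H r j) (K r j)) => [u||u]; rewrite !mxE.
Qed.

Lemma mjetZ a f F L : mjet f F L ->
  mjet (fun u => a *: f u) (a *: F) (fun u => a *: L u).
Proof.
by move=> H r j; apply: jet_ext (jetZ a (H r j)) => [u||u]; rewrite !mxE.
Qed.

Lemma mjet_cst F : mjet (fun=> F) F (fun=> 0).
Proof. by move=> r j; apply: jet_ext (jet_cst (F r j)) => [u||u]; rewrite ?mxE. Qed.

Lemma hess_jet k f F L : mjet f F L ->
  mjet (fun u => hess k (f u)) (hess k F) (fun u => hess k (L u)).
Proof. by move=> H; apply: mjetD; [exact: mjetZ|exact/mjetZ/cofm_jet]. Qed.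

Lemma mjet_ext f g F G L M : f =1 g -> F = G -> L =1 M -> mjet f F L -> mjet g G M.
Proof. by move=> /funext <- <- /funext <-. Qed.

Lemma sigma_jet k f F L : mjet f F L ->
  mjet (fun u => sigma k (f u)) (sigma k F) (fun u => hess k (L u)).
Proof.
move=> H; have := mjetD (mjet_cst (Bbar k)) (hess_jet k (mjetB H (mjet_cst (Abar k)))).
by apply: mjet_ext => // u; rewrite subr0 add0r.
Qed.

Lemma Zrow_jet k j : jet (fun u : U => Zrow k u.2 j) 0 (fun u => Zrow k u.2 j).
Proof.
case: k => [|k]; first exact: jet_cst.
split; first by rewrite /= mxE.
apply: sdiff_blin; split; first by move=> a u v; rewrite /= !mxE.
exists 1 => // u; rewrite mul1r; apply: le_trans (mx_norm_entry _ _ _) _.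
by rewrite [leRHS]/Num.norm /= le_max lexx orbT.
Qed.

Lemma da_jet k j : jet (fun u : U => da k u.2 j) 0 (fun u => da k u.2 j).
Proof. by rewrite /da; case: (j == 0 :> nat); [exact: jet_cst|exact: Zrow_jet]. Qed.

Lemma avec_jet k j : jet (fun u : U => avec k u.2 j) (acen k j) (fun u => da k u.2 j).
Proof.
apply: jet_ext (jetD (jet_cst (acen k j)) (da_jet k j)) => // [|u].
  by rewrite addr0.
by rewrite add0r.
Qed.

Lemma core0 i j a b c' d : core a b c' d i (col_far j) = 0.
Proof. by rewrite mxE. Qed.

Lemma wcenE k : wcen k = hess k (2 *: Cgam1 k) - 2 *: Cgam2 k.
Proof.
rewrite /wcen /sigma /Bbar /Abar opprD addrA opprD addrA subrr add0r.
have -> : piA k - (piA k + 2 *: Cgam1 k) = - (2 *: Cgam1 k).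
  by rewrite opprD addrA subrr add0r.
rewrite addrC; congr (_ - _); rewrite /hess scalerN opprD opprK.
congr (_ + _); rewrite -scalerN; congr (_ *: _).
by apply/matrixP; apply: row_ind; apply: col_ind => [||j]; rewrite !mxE /= ?opprK ?oppr0.
Qed.

Lemma acen_sq k : \sum_j acen k j * acen k j = 1 + t k * t k.
Proof.
rewrite sum_cols /acen /= big1 => [|j _]; last by rewrite mulr0.
by rewrite addr0 mulr1.
Qed.

(** By [wcenE], w = hess(2 p a^T) - 2 Cgam2 at the centre. Both the cofactor of p a^T and Cgam2 kill
    a, and the remaining term is 2 h |a|^2 p. *)
Lemma wcen_acen k r : \sum_j wcen k r j * acen k j = sdm k * (2 * pcen k r).
Proof.
rewrite sum_cols wcenE /acen /= big1 => [|j _]; last by rewrite mulr0.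
move: r; apply: row_ind; rewrite /sdm /pcen /hess /cofm /core !mxE /=; ring.
Qed.

(** One step of the induction on k. The central values confirm that the explicit formulas reproduce
    the prescribed loop; the A and B parts of the next state follow the same rule, isolated in
    [jnext]. *)
Lemma step_jets k f F L g G M : (k < 5)%N -> mjet f F L -> mjet g G M ->
  F = piA k -> G = piB k ->
  let x u := (f u, g u) in let dx u := (L u, M u) in
  [/\ mjet (fun u => Xst k u.2 (x u)) (Abar k) (fun u => dX k u.2 (dx u)),
      mjet (fun u => wst k (x u)) (wcen k) (fun u => dw k (dx u)),
      mjet (fun u => (nxt k u.2 (x u)).1) (piA k.+1) (fun u => (dnxt k u.2 (dx u)).1) &
      mjet (fun u => (nxt k u.2 (x u)).2) (piB k.+1) (fun u => (dnxt k u.2 (dx u)).2)].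
Proof.
move=> k5 jf jg FE GE x dx; rewrite {F}FE {G}GE in jf jg.
have jw : mjet (fun u => wst k (x u)) (wcen k) (fun u => dw k (dx u)).
  exact: mjetB jg (sigma_jet k jf).
have m0 := sdm_gt0 k5.
have jv r : jet (fun u => vst k u.2 (x u) r) (2 * pcen k r) (fun u => dv k u.2 (dx u) r).
  have jN := jet_sum (fun j => jetM (jw r j) (avec_jet k j)).
  have jD := jetZ (h k) (jet_sum (fun j => jetM (avec_jet k j) (avec_jet k j))).
  rewrite wcen_acen in jN; rewrite acen_sq in jD.
  have := jetM jN (jetV _ jD); rewrite -/(sdm k) gt_eqF// => /(_ isT).
  apply: jet_ext => // [|u]; first by rewrite mulrAC mulfV ?gt_eqF// mul1r.
  rewrite /dv; set S1 := \sum_j _; set S2 := \sum_j _; set S3 := \sum_j _.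
  have -> : S1 = 2 * S3.
    by rewrite /S1 mulr_sumr; apply: eq_bigr => j _; ring.
  by field; rewrite gt_eqF.
have jX : mjet (fun u => Xst k u.2 (x u)) (Abar k) (fun u => dX k u.2 (dx u)).
  move=> r j; apply: jet_ext (jetD (jf r j) (jetM (jv r) (avec_jet k j))).
  - by move=> u; rewrite mxE.
  - rewrite /Abar [RHS]mxE; congr (_ + _); move: r j.
    by apply: row_ind; apply: col_ind => [||j];
      rewrite /pcen /acen !mxE /= ?mulr0 ?mulr1 ?mulrA.
  - by move=> u; rewrite /= mxE.
have jT : jet (fun u : U => tau k u.2) 2^-1 (fun u => Zrow k u.2 ord0).
  apply: jet_ext (jetD (jet_cst 2^-1) (Zrow_jet k ord0)) => // [|u].
    by rewrite addr0.
  by rewrite add0r.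
have jnext f' F' L' g' G' L'' C : mjet f' F' L' -> mjet g' G' L'' -> G' - F' = 2 *: C ->
    mjet (fun u => f' u + tau k u.2 *: (g' u - f' u)) (F' + C)
     (fun u => L' u + (2^-1 *: (L'' u - L' u) + Zrow k u.2 ord0 *: (2 *: C))).
  move=> H1 H2 E r j.
  apply: jet_ext (jetD (H1 r j) (jetM jT (mjetB H2 H1 r j))) => [u||u].
  - by rewrite !mxE.
  - rewrite E !mxE; congr (_ + _); by field.
  - by rewrite E !mxE; ring.
split => //.
- have := jnext _ _ _ _ _ _ (Cgam1 k) jf jX; rewrite /piA big_ord_recr; apply.
  by rewrite /Abar addrC addKr.
- have := jnext _ _ _ _ _ _ (Cgam2 k) jg (sigma_jet k jX).
  rewrite /piB big_ord_recr; apply.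
  rewrite /sigma subrr (_ : hess k 0 = 0) ?addr0; last first.
    rewrite /hess scaler0 add0r (_ : cofm 0 = 0) ?scaler0//.
    by apply/matrixP; apply: row_ind; apply: col_ind => [||j]; rewrite !mxE //= oppr0.
  by rewrite /Bbar addrC addKr.
Qed.

Lemma row_block_jet (f : U -> V) : bounded_lin f ->
  mjet (fun u => usubmx (f u)) 0 (fun u => usubmx (f u)) /\
  mjet (fun u => dsubmx (f u)) 0 (fun u => dsubmx (f u)).
Proof.
move=> bf.
have b i j : bounded_lin (fun u => f u i j : R^o).
  have [lf [C C0 HC]] := bf; split; first by move=> a u v; rewrite lf !mxE.
  by exists C => // u; apply: le_trans (HC u); exact: mx_norm_entry.
split => r j.
  rewrite (_ : (fun u => usubmx (f u) r j) = (fun u => f u (lshift 2 r) j)).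
    by split; [rewrite (blin0 bf) !mxE|exact/sdiff_blin/b].
  by apply/funext => u; rewrite mxE.
rewrite (_ : (fun u => dsubmx (f u) r j) = (fun u => f u (rshift 2 r) j)).
  by split; [rewrite (blin0 bf) !mxE|exact/sdiff_blin/b].
by apply/funext => u; rewrite mxE.
Qed.

Lemma state_jets k : (k <= 5)%N ->
  mjet (fun u => (state k u).1) (piA k) (fun u => (dstate k u).1) /\
  mjet (fun u => (state k u).2) (piB k) (fun u => (dstate k u).2).
Proof.
elim: k => [_|k IH k5].
  rewrite /piA /piB !big_ord0; apply: row_block_jet; split.
    by move=> a u v.
  by exists 1 => // u; rewrite mul1r [leRHS]/Num.norm /= le_max lexx.
have [j1 j2] := IH (ltnW k5).
by have [_ _ jA jB] := step_jets k5 j1 j2 erefl erefl; split.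
Qed.

End Configuration.

Local Arguments Z.mul : simpl never.

(** * The linearised loop has trivial kernel *)

Section TangentKernel.
Context {R : realType} (m : nat).
Local Notation n := m.+2.
Local Notation Mat := 'M[R]_(2, n).
Local Notation V := 'M[R]_(2 + 2, n).
Local Notation U := (V * V)%type.
Local Notation scl := (fun (z : Z) (x : R) => @zr R z * x).
Local Notation add := (fun x y : R => x + y).
Local Notation c1 := (col1 m).
Local Notation t k := (@zr R (sd_t (step_at k))).
Local Notation p0 k := (@zr R (sd_p0 (step_at k))).
Local Notation p1 k := (@zr R (sd_p1 (step_at k))).
Local Notation h k := (@zr R (sd_h (step_at k))).

Definition core_of (x : Mat * Mat) : core_state R :=
  CoreState (x.1 ord0 ord0) (x.1 ord0 c1) (x.1 row1 ord0) (x.1 row1 c1)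
    (x.2 ord0 ord0) (x.2 ord0 c1) (x.2 row1 ord0) (x.2 row1 c1).

Lemma core_dv k (Z : V) dx r : (k < 5)%N ->
  sdm k * dv k Z dx r = dw k dx r ord0 + t k * dw k dx r c1 +
    (wcen m k r c1 - 4 * h k * pcen k r * t k) * da k Z c1.
Proof.
move=> k5; rewrite /dv mulrA mulfV ?gt_eqF ?sdm_gt0// mul1r !sum_cols /acen /=.
rewrite !big1 => [|j _|j _]; last 2 first.
- by rewrite mul0r.
- by rewrite wcenE /hess !mxE /= !(mulr0, mul0r, addr0, subr0).
by rewrite (_ : da k Z ord0 = 0)//; ring.
Qed.

Lemma wcen_col1 k r : wcen m k r c1 =
  h k * (2 * pcen k r * t k) + @zr R (sd_c (step_at k)) *
    (if (r == 0 :> nat) then - (2 * p1 k) else 2 * p0 k)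
  - 2 * (if (r == 0 :> nat) then @zr R (sd_q0 (step_at k)) else zr (sd_q1 (step_at k))).
Proof.
rewrite wcenE /hess /pcen; move: r.
by apply: row_ind; rewrite /cofm /core !mxE /=; ring.
Qed.

Lemma dX_col0 k (Z : V) dx r : (k < 5)%N ->
  sdm k * dX k Z dx r ord0 = sdm k * dx.1 r ord0 + sdm k * dv k Z dx r.
Proof. by move=> _; rewrite mxE /acen /da /=; ring. Qed.

Lemma dX_col1 k (Z : V) dx r : (k < 5)%N ->
  sdm k * dX k Z dx r c1 = sdm k * dx.1 r c1 +
    (2 * pcen k r * sdm k * da k Z c1 + t k * (sdm k * dv k Z dx r)).
Proof. by move=> _; rewrite mxE /acen /=; ring. Qed.

(** Identifies the real linearisation with the integer formulas for which the ranks were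
    computed. *)
Lemma core_dX k (Z : V) dx : (k < 5)%N ->
  let X := dX k Z dx in let W := dw k dx in
  CoreState (sdm k * X ord0 ord0) (sdm k * X ord0 c1)
    (sdm k * X row1 ord0) (sdm k * X row1 c1)
    (W ord0 ord0) (W ord0 c1) (W row1 ord0) (W row1 c1) =
  tan_X add scl (step_at k) (core_of dx) (da k Z c1).
Proof.
move=> k5 /=; rewrite !dX_col0// !dX_col1// !core_dv// !wcen_col1.
rewrite /tan_X /= !(zrB, zrD, zrM, zrN) ?zrE /pcen /=.
rewrite /dw /hess /cofm /core !mxE /= /sdm.
by congr CoreState; ring.
Qed.

Lemma core_dnxt k (Z : V) dx : (k < 5)%N ->
  core_map (fun a => @zr R (Z.mul 2 (sd_m (step_at k))) * a) (core_of (dnxt k Z dx)) =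
  tan_next add scl (step_at k) (core_of dx) (Zrow k Z ord0) (da k Z c1).
Proof.
move=> k5; rewrite /tan_next -core_dX// [RHS]/= [LHS]/=.
rewrite !(zrB, zrD, zrM, zrN) ?zrE /sdm.
rewrite /dnxt; move: (dX k Z dx) (Zrow k Z ord0) => X T.
rewrite /hess /cofm /core /Cgam1 /Cgam2 !mxE /=.
by congr CoreState; field.
Qed.

(** The central direction vanishes in these columns, so the change of v has no effect at first
    order. *)
Lemma far_dX k (Z : V) dx r (j : 'I_m) : (k < 5)%N ->
  dX k Z dx r (col_far j) = dx.1 r (col_far j) + 2 * pcen k r * Zrow k Z (col_far j).
Proof. by move=> k5; rewrite mxE /acen /da /= mul0r addr0. Qed.

Lemma far_dw k dx r (j : 'I_m) : dw k dx r (col_far j) =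
  dx.2 r (col_far j) - h k * dx.1 r (col_far j).
Proof. by rewrite /dw /hess /cofm /core !mxE /= mulr0 addr0. Qed.

Lemma far_dnxt1 k (Z : V) dx r (j : 'I_m) : (k < 5)%N ->
  (dnxt k Z dx).1 r (col_far j) =
    dx.1 r (col_far j) + pcen k r * Zrow k Z (col_far j).
Proof.
move=> k5; have := far_dX Z dx r j k5; rewrite /dnxt /=; move: (dX k Z dx) => X.
by rewrite /Cgam1 /core !mxE /= => ->; field.
Qed.

Lemma far_dnxt2 k (Z : V) dx r (j : 'I_m) : (k < 5)%N ->
  2 * (dnxt k Z dx).2 r (col_far j) = dx.2 r (col_far j) +
    h k * (dx.1 r (col_far j) + 2 * pcen k r * Zrow k Z (col_far j)).
Proof.
move=> k5; have := far_dX Z dx r j k5; rewrite /dnxt /=; move: (dX k Z dx) => X.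
by rewrite /hess /cofm /Cgam2 /core !mxE /= => ->; field.
Qed.

Definition closed_tangent (u : U) := dstate 5 u = dstate 0 u.

Lemma tangent_eq0 (u : U) :
  core_list (core_of (dstate 0 u)) = nseq 8 0 ->
  (forall k, (k < 5)%N -> Zrow k u.2 ord0 = 0 /\ da k u.2 c1 = 0) ->
  (forall j, [/\ (dstate 0 u).1 ord0 (col_far j) = 0, (dstate 0 u).1 row1 (col_far j) = 0,
    (dstate 0 u).2 ord0 (col_far j) = 0 & (dstate 0 u).2 row1 (col_far j) = 0] /\
    forall k, (k < 5)%N -> Zrow k u.2 (col_far j) = 0) -> u = 0.
Proof.
move=> [a1 a2 a3 a4 a5 a6 a7 a8] HZ Hf.
have E1 : usubmx u.1 = 0.
  apply/matrixP; apply: row_ind; apply: col_ind => [||j]; rewrite [RHS]mxE //.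
    by have [[]] := Hf j.
  by have [[]] := Hf j.
have E2 : dsubmx u.1 = 0.
  apply/matrixP; apply: row_ind; apply: col_ind => [||j]; rewrite [RHS]mxE //.
    by have [[]] := Hf j.
  by have [[]] := Hf j.
case: u E1 E2 HZ Hf {a1 a2 a3 a4 a5 a6 a7 a8} => rho Z /= E1 E2 HZ Hf.
congr (_, _); first by rewrite -[rho]vsubmxK E1 E2 col_mx0.
apply/matrixP => i j; rewrite [RHS]mxE.
have i5 : (i.+1 < 5)%N by rewrite ltnS.
have iE : i = inord i by rewrite inord_val.
rewrite iE; move: j; apply: col_ind => [||j].
- by have [] := HZ _ i5.
- by have [] := HZ _ i5.
- by have [_ Hj] := Hf j; exact: (Hj _ i5).
Qed.

Let coreS (u : U) k : (k < 5)%N ->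
  core_map (fun a => @zr R (Z.mul 2 (sd_m (step_at k))) * a) (core_of (dstate k.+1 u)) =
  tan_next add scl (step_at k) (core_of (dstate k u)) (Zrow k u.2 ord0) (da k u.2 c1).
Proof. by move=> k5; rewrite [dstate k.+1 u]/= core_dnxt. Qed.

(** For k = 0 this is the nondegeneracy of the closing equation in Z; for general k it makes the
    derivative of rho |-> pi_k(rho) injective. *)
Lemma state_kernel k (u : U) : (k < 5)%N -> closed_tangent u ->
  dstate k u = 0 -> u = 0.
Proof.
move=> k5 cl s0.
have [] := @core_state_kernel R (fun k => core_of (dstate k u))
  (fun k => Zrow k u.2 ord0) (fun k => da k u.2 c1) erefl erefl (coreS u)
  (congr1 core_of cl) k k5.
  by rewrite s0 /core_of /= !mxE.
move=> c0 cZ; apply: tangent_eq0 => // j.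
apply: (@column_state_kernel R (fun k => (dstate k u).1 ord0 (col_far j))
  (fun k => (dstate k u).1 row1 (col_far j)) (fun k => (dstate k u).2 ord0 (col_far j))
  (fun k => (dstate k u).2 row1 (col_far j)) (fun k => Zrow k u.2 (col_far j)) erefl
  _ _ _ k k5).
- by move=> i i5; rewrite /= !far_dnxt1.
- by move=> i i5; rewrite /= !far_dnxt2.
- by rewrite cl.
- by rewrite s0 /= !mxE.
Qed.

(** Injectivity of the derivative of rho |-> (xi_k^1, w_k), the limit at lambda = 1 of the
    straightened sheets. *)
Lemma point_kernel k (u : U) : (k < 5)%N -> closed_tangent u ->
  dX k u.2 (dstate k u) = 0 -> dw k (dstate k u) = 0 -> u = 0.
Proof.
move=> k5 cl X0 w0.
have [] := @core_point_kernel R (fun k => core_of (dstate k u))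
  (fun k => Zrow k u.2 ord0) (fun k => da k u.2 c1) erefl erefl (coreS u)
  (congr1 core_of cl) k k5.
  by rewrite -core_dX// X0 w0 /= !mxE !mulr0.
move=> c0 cZ; apply: tangent_eq0 => // j.
have Xr r := congr1 (fun M : Mat => M r (col_far j)) X0.
have wr r := congr1 (fun M : Mat => M r (col_far j)) w0.
apply: (@column_point_kernel R (fun k => (dstate k u).1 ord0 (col_far j))
  (fun k => (dstate k u).1 row1 (col_far j)) (fun k => (dstate k u).2 ord0 (col_far j))
  (fun k => (dstate k u).2 row1 (col_far j)) (fun k => Zrow k u.2 (col_far j)) erefl
  _ _ _ k k5).
- by move=> i i5; rewrite /= !far_dnxt1.
- by move=> i i5; rewrite /= !far_dnxt2.
- by rewrite cl.
- have := Xr ord0; have := Xr row1; have := wr ord0; have := wr row1.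
  rewrite !far_dX// !far_dw !mxE /pcen /= => /eqP; rewrite subr_eq0 => /eqP e1.
  by move=> /eqP; rewrite subr_eq0 => /eqP e2 e3 e4; split.
Qed.

End TangentKernel.

(** * Norms and openness *)

Section Euclidean.
Context {R : realType}.

Lemma cauchy_schwarz (I : finType) (f g : I -> R) :
  \sum_i f i * g i <= Num.sqrt (\sum_i f i ^+ 2) * Num.sqrt (\sum_i g i ^+ 2).
Proof.
set A := \sum_i f i ^+ 2; set B := \sum_i g i ^+ 2; set C := \sum_i f i * g i.
have A0 : 0 <= A by apply: sumr_ge0 => i _; exact: sqr_ge0.
have B0 : 0 <= B by apply: sumr_ge0 => i _; exact: sqr_ge0.
have : 0 <= \sum_i (B * f i - C * g i) ^+ 2.
  by apply: sumr_ge0 => i _; exact: sqr_ge0.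
have -> : \sum_i (B * f i - C * g i) ^+ 2 = B * (A * B - C ^+ 2).
  rewrite (eq_bigr (fun i => B ^+ 2 * f i ^+ 2 - (2 * B * C) * (f i * g i) + C ^+ 2 * g i ^+ 2)).
    by rewrite big_split /= sumrB -!mulr_sumr -/A -/B -/C; ring.
  by move=> i _; ring.
move=> H; rewrite -sqrtrM//; case: (ltP B 0) => [|_]; first by lra.
have [B00|Bn] := eqVneq B 0.
  have g0 i : g i = 0.
    have : g i ^+ 2 <= B by rewrite /B (bigD1 i)//= lerDl sumr_ge0// => j _; exact: sqr_ge0.
    by rewrite B00 => h; apply/eqP; rewrite -sqrf_eq0 eq_le h sqr_ge0.
  by rewrite /C big1 => [|i _]; [exact: sqrtr_ge0|rewrite g0 mulr0].
have Bp : 0 < B by rewrite lt_neqAle eq_sym Bn.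
have CAB : C ^+ 2 <= A * B by rewrite -subr_ge0 -(pmulr_rge0 _ Bp).
apply: le_trans (ler_norm _) _; rewrite -sqrtr_sqr.
by rewrite ler_sqrt// mulr_ge0.
Qed.

Lemma minkowski (I : finType) (f g : I -> R) :
  Num.sqrt (\sum_i (f i + g i) ^+ 2) <=
  Num.sqrt (\sum_i f i ^+ 2) + Num.sqrt (\sum_i g i ^+ 2).
Proof.
have A0 : 0 <= \sum_i f i ^+ 2 by apply: sumr_ge0 => i _; exact: sqr_ge0.
have B0 : 0 <= \sum_i g i ^+ 2 by apply: sumr_ge0 => i _; exact: sqr_ge0.
rewrite -[leRHS]ger0_norm ?addr_ge0 ?sqrtr_ge0// -sqrtr_sqr ler_wsqrtr//.
rewrite sqrrD !sqr_sqrtr//.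
rewrite (eq_bigr (fun i => f i ^+ 2 + 2 * (f i * g i) + g i ^+ 2)); last first.
  by move=> i _; ring.
rewrite !big_split /= -mulr_sumr lerD2r lerD2l -[leRHS]mulr_natl.
by rewrite ler_wpM2l// cauchy_schwarz.
Qed.

Lemma minkowski2 (a b c d : R) :
  Num.sqrt ((a + c) ^+ 2 + (b + d) ^+ 2) <=
  Num.sqrt (a ^+ 2 + b ^+ 2) + Num.sqrt (c ^+ 2 + d ^+ 2).
Proof.
have := minkowski (fun i : bool => if i then a else b) (fun i => if i then c else d).
by rewrite !big_bool.
Qed.

Context {n : nat}.
Local Notation Mat := 'M[R]_(2, n).

Lemma frob_ge0 (A : Mat) : 0 <= frob A.
Proof. exact: sqrtr_ge0. Qed.

Lemma frob_sqr (A : Mat) : frob A ^+ 2 = \sum_i \sum_j A i j ^+ 2.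
Proof.
by rewrite sqr_sqrtr// sumr_ge0// => i _; rewrite sumr_ge0// => j _; exact: sqr_ge0.
Qed.

Lemma frobD (A B : Mat) : frob (A + B) <= frob A + frob B.
Proof.
rewrite /frob !pair_big /=.
rewrite (eq_bigr (fun ij => (A ij.1 ij.2 + B ij.1 ij.2) ^+ 2)).
  exact: minkowski.
by move=> ij _; rewrite mxE.
Qed.

Lemma frobN (A : Mat) : frob (- A) = frob A.
Proof.
by congr Num.sqrt; apply: eq_bigr => i _; apply: eq_bigr => j _; rewrite mxE sqrrN.
Qed.

Lemma frobZ (a : R) (A : Mat) : frob (a *: A) = `|a| * frob A.
Proof.
rewrite /frob -[`|a|]sqrtr_sqr -sqrtrM ?sqr_ge0//; congr Num.sqrt.
rewrite mulr_sumr; apply: eq_bigr => i _; rewrite mulr_sumr; apply: eq_bigr => j _.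
by rewrite mxE exprMn.
Qed.

Lemma entry_le_frob (A : Mat) i j : `|A i j| <= frob A.
Proof.
rewrite -[`|_|]sqrtr_sqr ler_wsqrtr// (bigD1 i)//= (bigD1 j)//= -addrA lerDl.
by rewrite addr_ge0 ?sumr_ge0// => k _; rewrite ?sumr_ge0// => *; exact: sqr_ge0.
Qed.

Lemma norm_le_frob (A : Mat) : `|A| <= frob A.
Proof. by apply: mx_norm_le => [|i j]; [exact: frob_ge0|exact: entry_le_frob]. Qed.

Lemma frob_le_sum (A : Mat) : frob A <= \sum_i \sum_j `|A i j|.
Proof.
have s0 : 0 <= \sum_i \sum_j `|A i j| by rewrite sumr_ge0// => i _; rewrite sumr_ge0.
rewrite -[leRHS]ger0_norm// -sqrtr_sqr ler_wsqrtr// expr2 mulr_suml.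
apply: ler_sum => i _; rewrite mulr_suml; apply: ler_sum => j _.
rewrite -real_normK ?num_real// expr2 ler_wpM2l//.
rewrite (bigD1 i)//= (bigD1 j)//= -addrA lerDl.
by rewrite addr_ge0 ?sumr_ge0// => k _; rewrite sumr_ge0.
Qed.

Lemma frob_le_norm (A : Mat) : frob A <= (2 * n)%:R * `|A|.
Proof.
apply: le_trans (frob_le_sum A) _.
apply: le_trans (ler_sum _ (fun i _ => ler_sum _ (fun j _ => mx_norm_entry A i j))) _.
by rewrite !sumr_const !card_ord -!mulrnA -[leLHS]mulr_natl mulnC.
Qed.

Local Notation P := (Mat * Mat)%type.
Local Notation V := 'M[R]_(2 + 2, n).

Lemma pnorm_ge0 (x : P) : 0 <= pnorm x.
Proof. exact: sqrtr_ge0. Qed.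

Lemma pnormD (x y : P) : pnorm (x + y) <= pnorm x + pnorm y.
Proof.
apply: le_trans (minkowski2 _ _ _ _).
by rewrite ler_wsqrtr// lerD// lerXn2r ?nnegrE ?addr_ge0 ?frob_ge0// frobD.
Qed.

(** Stacking a pair into one matrix gives a complete space under the sup norm of entries, to which
    the inverse function arguments apply; [pnorm] is an equivalent norm. *)
Definition stk (x : P) : V := col_mx x.1 x.2.
Definition unstk (v : V) : P := (usubmx v, dsubmx v).

Lemma stkK : cancel stk unstk.
Proof. by case=> a b; rewrite /unstk /stk col_mxKu col_mxKd. Qed.
Lemma unstkK : cancel unstk stk.
Proof. by move=> v; rewrite /stk /= vsubmxK. Qed.

Lemma stkD x y : stk (x + y) = stk x + stk y.
Proof. by rewrite /stk add_col_mx. Qed.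
Lemma stkB x y : stk (x - y) = stk x - stk y.
Proof. by rewrite /stk opp_col_mx add_col_mx. Qed.
Lemma stk0 : stk 0 = 0.
Proof. by rewrite /stk col_mx0. Qed.

Lemma stk_entryu x i j : stk x (lshift 2 i) j = x.1 i j.
Proof. by rewrite /stk col_mxEu. Qed.
Lemma stk_entryd x i j : stk x (rshift 2 i) j = x.2 i j.
Proof. by rewrite /stk col_mxEd. Qed.

Lemma norm_stk_le (x : P) (c : R) : 0 <= c -> `|x.1| <= c -> `|x.2| <= c -> `|stk x| <= c.
Proof.
move=> c0 h1 h2; apply: mx_norm_le => // i j; case: (split_ordP i) => k ->.
  by rewrite stk_entryu (le_trans (mx_norm_entry _ _ _)).
by rewrite stk_entryd (le_trans (mx_norm_entry _ _ _)).
Qed.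

Lemma norm1_le_stk (x : P) : `|x.1| <= `|stk x|.
Proof. by apply: mx_norm_le => // i j; rewrite -stk_entryu mx_norm_entry. Qed.
Lemma norm2_le_stk (x : P) : `|x.2| <= `|stk x|.
Proof. by apply: mx_norm_le => // i j; rewrite -stk_entryd mx_norm_entry. Qed.

Lemma frob1_le_pnorm (x : P) : frob x.1 <= pnorm x.
Proof.
by rewrite -[leLHS]ger0_norm ?frob_ge0// -sqrtr_sqr ler_wsqrtr// lerDl sqr_ge0.
Qed.
Lemma frob2_le_pnorm (x : P) : frob x.2 <= pnorm x.
Proof.
by rewrite -[leLHS]ger0_norm ?frob_ge0// -sqrtr_sqr ler_wsqrtr// lerDr sqr_ge0.
Qed.

Lemma stk_le_pnorm (x : P) : `|stk x| <= pnorm x.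
Proof.
apply: norm_stk_le; first exact: pnorm_ge0.
  exact: le_trans (norm_le_frob _) (frob1_le_pnorm x).
exact: le_trans (norm_le_frob _) (frob2_le_pnorm x).
Qed.

Lemma pnorm_le_frob (x : P) : pnorm x <= frob x.1 + frob x.2.
Proof.
rewrite -[leRHS]ger0_norm ?addr_ge0 ?frob_ge0// -sqrtr_sqr ler_wsqrtr//.
by rewrite sqrrD addrAC lerDl mulrn_wge0// mulr_ge0 ?frob_ge0.
Qed.

(** The added 1 keeps the constant positive also when n = 0. *)
Definition Kn : R := (4 * n)%:R + 1.

Lemma Kn_gt0 : 0 < Kn.
Proof. by rewrite ltr_wpDl. Qed.

Lemma pnorm_le_stk (x : P) : pnorm x <= Kn * `|stk x|.
Proof.
apply: le_trans (pnorm_le_frob x) _.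
apply: le_trans (lerD (frob_le_norm _) (frob_le_norm _)) _.
apply: (@le_trans _ _ ((2 * n)%:R * `|stk x| + (2 * n)%:R * `|stk x|)).
  by rewrite lerD// ler_wpM2l// ?norm1_le_stk ?norm2_le_stk.
rewrite -mulrDl ler_wpM2r// -natrD -mulnDl /Kn; lra.
Qed.

End Euclidean.

(** * Openness of images, uniformly under small perturbations *)

Section OpenImages.
Context {R : realType} {n : nat}.
Local Notation Mat := 'M[R]_(2, n).
Local Notation V := 'M[R]_(2 + 2, n).
Local Notation P := (Mat * Mat)%type.

(** For mu <= mu0 the term mu e is Lipschitz with constant 1/(4C). Added to the remainder 1/(4C) of
    f it gives 1/(2C), still within the contraction bound, so [d] does not depend on mu. *)
Lemma sdiff_open_family (f L e Le : V -> V) : sdiff f L -> (forall v, L v = 0 -> v = 0) ->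
  sdiff e Le ->
  exists d mu0 : R, [/\ 0 < d, 0 < mu0 & forall mu, 0 <= mu <= mu0 ->
   forall x0 (s : R), `|x0| < d -> 0 < s -> exists2 t : R, 0 < t &
    forall y, `|y - (f x0 + mu *: e x0)| < t ->
      exists x, [/\ `|x - x0| <= s, `|x| < d & f x + mu *: e x = y]].
Proof.
move=> sf Linj se.
have [T [bT TL LT]] := injective_linear_inverse sf.1.1 Linj.
have [_ [C C0 TC]] := bT.
have [Ce [de [Ce0 de0 He]]] := sdiff_lip se.
have [d d0 Hd] := sf.2 (4 * C)^-1 ltac:(by rewrite invr_gt0 mulr_gt0).
exists (Num.min d de), (4 * C * Ce)^-1; split.
- by rewrite lt_min d0.
- by rewrite invr_gt0 !mulr_gt0.
move=> mu /andP[mu0 mu1].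
refine (@perturbed_linear_open R V (fun x => f x + mu *: e x) L T C _ (2 * C)^-1 _ _ _ _ _ _ _) => //.
- exact: blinB bT.
- by move=> v Tv; rewrite -[v]LT Tv (blin0 sf.1).
- move=> x y; rewrite !lt_min => /andP[x1 x2] /andP[y1 y2].
  have -> : f x + mu *: e x - (f y + mu *: e y) - L (x - y) =
    (f x - f y - L (x - y)) + mu *: (e x - e y).
    by rewrite opprD (addrACA (f x)) -scalerBr [LHS]addrAC.
  apply: le_trans (ler_normD _ _) _; rewrite normrZ ger0_norm//.
  have h1 := Hd _ _ x1 y1.
  have h2 : mu * `|e x - e y| <= (4 * C)^-1 * `|x - y|.
    apply: (@le_trans _ _ ((4 * C * Ce)^-1 * (Ce * `|x - y|))).
      by apply: ler_pM => //; exact: He.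
    by rewrite le_eqVlt; apply/orP; left; apply/eqP; field; rewrite !gt_eqF.
  apply: le_trans (lerD h1 h2) _; rewrite -mulrDl.
  by rewrite le_eqVlt; apply/orP; left; apply/eqP; field; rewrite gt_eqF.
- by rewrite le_eqVlt; apply/orP; left; apply/eqP; field; rewrite gt_eqF.
Qed.

Lemma open_image (f : V -> V) (d r : R) :
  (forall x0 (s : R), `|x0| < d -> 0 < s -> exists2 t : R, 0 < t &
    forall y, `|y - f x0| < t -> exists x, [/\ `|x - x0| <= s, `|x| < d & f x = y]) ->
  r <= d ->
  openP (fun y : P => exists2 rho, oball r rho & stk y = f (stk rho)).
Proof.
move=> H rd y [rho rr yE].
have rhod : `|stk rho| < d.
  by apply: le_lt_trans (stk_le_pnorm _) _; exact: lt_le_trans rr rd.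
have K0 := @Kn_gt0 R n.
(* Half the distance of rho to the sphere of radius r, divided by the constant that converts the sup
   norm into [pnorm]. *)
have s0 : 0 < (r - pnorm rho) / (2 * @Kn R n).
  by apply: divr_gt0; [rewrite subr_gt0|exact: mulr_gt0].
have [t t0 Ht] := H _ _ rhod s0.
exists t => // y' yy'.
have [|x [x1 _ x2]] := Ht (stk y').
  by rewrite -yE -stkB; apply: le_lt_trans (stk_le_pnorm _) yy'.
exists (unstk x); last by rewrite unstkK.
rewrite /oball; have -> : unstk x = (unstk x - rho) + rho by rewrite subrK.
apply: le_lt_trans (pnormD _ _) _.
have : pnorm (unstk x - rho) <= (r - pnorm rho) / 2.
  apply: le_trans (pnorm_le_stk _) _; rewrite stkB unstkK.
  apply: le_trans (ler_wpM2l (ltW K0) x1) _.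
  by rewrite le_eqVlt; apply/orP; left; apply/eqP; field; rewrite gt_eqF.
by move: rr; rewrite /oball; lra.
Qed.

Lemma openP_preimage (S : set P) (phi : P -> P) (K : R) : 0 < K ->
  (forall x y, pnorm (phi x - phi y) <= K * pnorm (x - y)) ->
  openP S -> openP (fun y => S (phi y)).
Proof.
move=> K0 Hphi oS x Sx; have [e e0 He] := oS _ Sx.
exists (e / K); first by rewrite divr_gt0.
move=> y xy; apply: He; apply: le_lt_trans (Hphi _ _) _.
by rewrite mulrC -ltr_pdivlMr.
Qed.

Lemma sdiff_cont_onR (f l : V -> R) : sdiff (f : V -> R^o) (l : V -> R^o) ->
  exists2 d : R, 0 < d & forall r, r < d -> cont_onR (cball r) (fun x => f (stk x)).
Proof.
move=> sf; have [C [d [C0 d0 H]]] := sdiff_lip sf.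
exists d => // r rd x xr e e0; exists (e / C); first by rewrite divr_gt0.
move=> y yr yx.
have ball (z : P) : cball r z -> `|stk z| < d.
  by move=> zr; apply: le_lt_trans (stk_le_pnorm _) _; apply: le_lt_trans rd.
have h : `|f (stk y) - f (stk x)| <= C * `|stk y - stk x| := H _ _ (ball _ yr) (ball _ xr).
apply: le_lt_trans h _; rewrite -stkB mulrC -ltr_pdivlMr//.
exact: le_lt_trans (stk_le_pnorm _) yx.
Qed.

Lemma sdiff_cont_onP (f L : V -> V) : sdiff f L ->
  exists2 d : R, 0 < d & forall r, r < d ->
    cont_onP (cball r) (fun x => unstk (f (stk x))).
Proof.
move=> sf; have [C [d [C0 d0 H]]] := sdiff_lip sf.
have K0 := @Kn_gt0 R n.
exists d => // r rd x xr e e0; exists (e / (@Kn R n * C)); first by rewrite divr_gt0// mulr_gt0.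
move=> y yr yx.
have ball (z : P) : cball r z -> `|stk z| < d.
  by move=> zr; apply: le_lt_trans (stk_le_pnorm _) _; apply: le_lt_trans rd.
apply: le_lt_trans (pnorm_le_stk _) _; rewrite stkB !unstkK.
apply: le_lt_trans (ler_wpM2l (ltW K0) (H _ _ (ball _ yr) (ball _ xr))) _.
rewrite -stkB mulrA mulrC -ltr_pdivlMr ?mulr_gt0//.
exact: le_lt_trans (stk_le_pnorm _) yx.
Qed.

End OpenImages.

(** * Condition O_5 *)

Section SdiffExtra.
Context {R : realType}.

Lemma sdiff_near (U W : normedModType R) (f L : U -> W) (e : R) : sdiff f L -> 0 < e ->
  exists2 d : R, 0 < d & forall x, `|x| < d -> `|f x - f 0| < e.
Proof.
move=> sf e0; have [C [d [C0 d0 H]]] := sdiff_lip sf.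
exists (Num.min d (e / C)); first by rewrite lt_min d0 divr_gt0.
move=> x; rewrite lt_min => /andP[xd xe].
have := H x 0 xd; rewrite normr0 subr0 => /(_ d0) /le_lt_trans; apply.
by rewrite mulrC -ltr_pdivlMr.
Qed.

Lemma sdiff_id_pair (U W : normedModType R) (g G : U -> W) : sdiff g G ->
  sdiff (fun u => (u, g u) : (U * W)%type) (fun u => (u, G u)).
Proof.
move=> [[lG [C C0 HC]] H].
have nE (w : (U * W)%type) : `|w| = Num.max `|w.1| `|w.2| by [].
split; first split.
- by move=> a u v; rewrite lG.
- exists (1 + C); first by rewrite addr_gt0.
  move=> x; rewrite nE ge_max /= mulrDl mul1r; apply/andP; split.
    by rewrite lerDl mulr_ge0// ltW.
  by apply: le_trans (HC x) _; rewrite lerDr.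
- move=> e e0; have [d d0 Hd] := H _ e0; exists d => // x y xd yd.
  rewrite nE /= subrr normr0 ge_max; apply/andP; split; first by rewrite mulr_ge0// ltW.
  exact: Hd.
Qed.

End SdiffExtra.

Section CondO.
Context {R : realType} (m : nat).
Local Notation n := m.+2.
Local Notation Mat := 'M[R]_(2, n).
Local Notation V := 'M[R]_(2 + 2, n).
Local Notation U := (V * V)%type.
Local Notation P := (Mat * Mat)%type.
Local Notation t k := (@zr R (sd_t (step_at k))).
Local Notation p0 k := (@zr R (sd_p0 (step_at k))).
Local Notation p1 k := (@zr R (sd_p1 (step_at k))).
Local Notation h k := (@zr R (sd_h (step_at k))).
Local Notation c k := (@zr R (sd_c (step_at k))).

Definition Xu k (u : U) : Mat := Xst k u.2 (state k u).
Definition wu k (u : U) : Mat := wst k (state k u).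
Definition gammau k (u : U) : P :=
  (tau k u.2 *: (Xu k u - (state k u).1),
   tau k u.2 *: (sigma k (Xu k u) - (state k u).2)).

Lemma stateS k u : state k.+1 u = state k u + gammau k u.
Proof. by []. Qed.

Lemma mjet_stk (f g L M : U -> Mat) F0 G0 : mjet f F0 L -> mjet g G0 M ->
  sdiff (fun u => stk (f u, g u)) (fun u => stk (L u, M u)).
Proof.
move=> jf jg; apply: sdiff_mx => i j; case: (split_ordP i) => k ->.
  apply: sdiff_ext (jf k j).2 => u; by rewrite stk_entryu.
apply: sdiff_ext (jg k j).2 => u; by rewrite stk_entryd.
Qed.

Lemma linear_hess k : linear (@hess R m k).
Proof.
by move=> a u v; apply/matrixP; apply: row_ind; apply: col_ind => [||j];
  rewrite /hess /cofm /core !mxE /=; ring.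
Qed.

Lemma hessB k : {morph @hess R m k : u v / u - v}.
Proof. by move=> u v; rewrite addrC -scaleN1r linear_hess scaleN1r addrC. Qed.

Lemma hessZ k a u : @hess R m k (a *: u) = a *: hess k u.
Proof.
by apply/matrixP; apply: row_ind; apply: col_ind => [||j];
  rewrite /hess /cofm /core !mxE /=; ring.
Qed.

Lemma sigma_affine k (l : R) A B : sigma k (l *: A + (1 - l) *: B) =
  l *: sigma k A + (1 - l) *: @sigma R m k B.
Proof.
rewrite /sigma !hessB [hess k (_ + _)]linear_hess hessZ.
by apply/matrixP => i j; rewrite !mxE; ring.
Qed.

Lemma avec0 k Z : @avec R m k Z ord0 = 1.
Proof. by rewrite /avec /acen /da /= addr0. Qed.

Lemma avec_sq_ge1 k Z : 1 <= \sum_j @avec R m k Z j * avec k Z j.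
Proof.
rewrite (bigD1 ord0)//= avec0 mulr1 lerDl.
by apply: sumr_ge0 => j _; rewrite -expr2 sqr_ge0.
Qed.

(** The direction is nonzero because its first entry is 1, and [vst] was chosen precisely so that
    the second component kills it. *)
Lemma wave_cone_gammau k u : (k < 5)%N -> wave_cone (gammau k u).
Proof.
move=> k5; pose a : 'cV[R]_n := \col_j avec k u.2 j.
pose v : 'cV[R]_2 := \col_r (tau k u.2 * vst k u.2 (state k u) r).
exists v, a, (gammau k u).2; split.
  apply/eqP => /colP/(_ ord0); rewrite !mxE avec0 => /eqP.
  by rewrite oner_eq0.
split; last first.
  rewrite /gammau; congr (_, _); apply/matrixP => i j.
  by rewrite /Xu !mxE big_ord_recl big_ord0 !mxE; ring.
rewrite /gammau /= -scalemxAl; apply/eqP; rewrite scaler_eq0; apply/orP; right.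
set x := state k u; set Z := u.2.
pose D : Mat := \matrix_(r, j) (vst k Z x r * avec k Z j).
have XE : Xu k u = x.1 + D by apply/matrixP => i j; rewrite !mxE.
have -> : sigma k (Xu k u) - x.2 = hess k D - wst k x.
  rewrite XE /wst /sigma; have -> : x.1 + D - @Abar R m k = D - (@Abar R m k - x.1).
    by rewrite opprB [RHS]addrA [D + _]addrC.
  have -> : x.1 - @Abar R m k = - (@Abar R m k - x.1) by rewrite opprB.
  rewrite hessB; move: (hess k D) (@Abar R m k - x.1) => Y W.
  have -> : hess k (- W) = - hess k W by rewrite -scaleN1r hessZ scaleN1r.
  by apply/matrixP => i j; rewrite !mxE; ring.
have S1 := avec_sq_ge1 k Z; have h0 := @h_gt0 R k k5.
have key (W E : Mat) i j : ((hess k E - W) *m a) i j =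
    h k * \sum_l E i l * avec k Z l + c k * (\sum_l cofm E i l * avec k Z l)
    - \sum_l W i l * avec k Z l.
  rewrite mxE !mulr_sumr -big_split -sumrB; apply: eq_bigr => l _ /=.
  rewrite [a l j]mxE -/Z /hess; move: (cofm E) => F; rewrite !mxE; ring.
apply/eqP/matrixP => i j; rewrite key [RHS]mxE.
(* The cofactor of v a^T kills a; the determinant part of sigma leaves no trace in the cone
   condition. *)
have -> : \sum_l cofm D i l * avec k Z l = 0.
  rewrite sum_cols big1 => [|l _]; last by rewrite mxE /= mul0r.
  by move: i; apply: row_ind; rewrite /cofm /core !mxE /= ?mxE; ring.
have -> : \sum_l D i l * avec k Z l = vst k Z x i * \sum_l avec k Z l * avec k Z l.
  by rewrite mulr_sumr; apply: eq_bigr => l _; rewrite mxE mulrA.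
rewrite mulr0 addr0 /vst; set S := \sum_l avec k Z l * _ in S1 *.
set N := \sum_l wst _ _ _ _ * _.
by field; rewrite !gt_eqF// (lt_le_trans _ S1).
Qed.

End CondO.

Section CondO.
Context {R : realType} (m : nat).
Local Notation n := m.+2.
Local Notation Mat := 'M[R]_(2, n).
Local Notation V := 'M[R]_(2 + 2, n).
Local Notation U := (V * V)%type.
Local Notation P := (Mat * Mat)%type.

Lemma piA5 : @piA R m 5 = 0.
Proof.
apply/matrixP; apply: row_ind; apply: col_ind => [||j];
  rewrite /piA !big_ord_recr big_ord0 /Cgam1 /core !mxE /= ?zrE; by [lra|ring].
Qed.

Lemma piB5 : @piB R m 5 = 0.
Proof.
apply/matrixP; apply: row_ind; apply: col_ind => [||j];
  rewrite /piB !big_ord_recr big_ord0 /Cgam2 /core !mxE /= ?zrE; by [lra|ring].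
Qed.

Lemma state_sdiff k : (k <= 5)%N ->
  sdiff (fun u : U => stk (state k u)) (fun u => stk (dstate k u)).
Proof.
move=> k5; have [jA jB] := @state_jets R m k k5.
by refine (sdiff_ext _ _ (mjet_stk jA jB)) => u; rewrite -surjective_pairing.
Qed.

Lemma state_at0 k : (k <= 5)%N -> state k (0 : U) = (piA m k, piB m k).
Proof.
move=> k5; have [jA jB] := @state_jets R m k k5.
rewrite [LHS]surjective_pairing; congr (_, _); apply/matrixP => i j.
  by have [->] := jA i j.
by have [->] := jB i j.
Qed.

Lemma sdiffB (U' W : normedModType R) (f g L M : U' -> W) :
  sdiff f L -> sdiff g M -> sdiff (fun x => f x - g x) (fun x => L x - M x).
Proof.
move=> sf /(sdiffZ (-1)) sg; apply: sdiff_ext (sdiffD sf sg) => x; by rewrite scaleN1r.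
Qed.

Lemma sdiff_fst : sdiff (fun u : U => u.1) (fun u => u.1).
Proof.
apply: sdiff_blin; split; first by [].
by exists 1 => // u; rewrite mul1r [leRHS]/Num.norm /= le_max lexx.
Qed.

(** [g] solves the closing equation and [G] is its derivative. The last clause says that the tangent
    vectors of the solution set close the linearised loop, as the kernel lemmas require. *)
Lemma closing_solution : exists (r : R) (g G : V -> V),
  [/\ 0 < r, g 0 = 0, sdiff g G,
      forall rho, `|rho| < r -> state 5 (rho, g rho) = unstk rho &
      forall rho, closed_tangent ((rho, G rho) : U)].
Proof.
pose E (u : U) : V := stk (state 5 u) - u.1.
pose L (u : U) : V := stk (dstate 5 u) - u.1.
have sE : sdiff E L := sdiffB (state_sdiff (leqnn 5)) sdiff_fst.
have L0 u : L u = 0 -> closed_tangent u.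
  move=> /eqP; rewrite subr_eq0 => /eqP Lu; rewrite /closed_tangent.
  by rewrite -[LHS]stkK Lu.
have E0 : E 0 = 0.
  by rewrite /E state_at0// piA5 piB5 subr0 (_ : (0, 0) = 0 :> P)// stk0.
pose L2 z := L (0, z).
have lL2 : linear L2.
  move=> a x y; rewrite /L2 -sE.1.1; congr L.
  by apply/eqP; rewrite xpair_eqE /= scaler0 addr0 !eqxx.
(* The state with index 0 is rho itself, which is 0 along a pure Z-variation, so the kernel lemma
   applies with k = 0. *)
have L2i z : L2 z = 0 -> z = 0.
  move=> /L0 /(state_kernel (isT : (0 < 5)%N)) h.
  have : ((0, z) : U) = 0.
    by apply: h; apply/eqP; rewrite /= xpair_eqE; apply/andP; split; apply/eqP/matrixP => i j; rewrite !mxE.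
  by case.
have [T [bT TL LT]] := injective_linear_inverse lL2 L2i.
have [|r [g [r0 g0 sg Hg]]] := @implicit_function R V V E L T E0 sE bT TL.
  by move=> v Tv; rewrite -[v]LT Tv -[0]/(0 : V) /L2 (blin0 sE.1).
exists r, g, (fun u => - T (L (u, 0))); split => //.
- move=> rho /Hg /eqP; rewrite subr_eq0 => /eqP Eg.
  by rewrite -[LHS]stkK Eg.
- move=> rho; apply: L0.
  have -> : ((rho, - T (L (rho, 0))) : U) = (rho, 0) - (0, T (L (rho, 0))).
    by apply/eqP; rewrite xpair_eqE /= subr0 sub0r !eqxx.
  by rewrite (blinB sE.1) -[L (0, _)]/(L2 _) LT subrr.
Qed.

End CondO.

(** * Local behaviour of each step along the solved loop *)

Section StepFacts.
Context {R : realType} (m : nat).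
Local Notation n := m.+2.
Local Notation Mat := 'M[R]_(2, n).
Local Notation V := 'M[R]_(2 + 2, n).
Local Notation U := (V * V)%type.
Local Notation P := (Mat * Mat)%type.

Variables (g G : V -> V).
Hypotheses (g0 : g 0 = 0) (sg : sdiff g G).
Hypothesis tan_closed : forall rho, closed_tangent ((rho, G rho) : U).

Let pr (rho : V) : U := (rho, g rho).
Let dpr (rho : V) : U := (rho, G rho).

Let pr0 : pr 0 = 0. Proof. by rewrite /pr g0. Qed.

Let spr : sdiff pr dpr. Proof. exact: sdiff_id_pair. Qed.

Let pull (W : normedModType R) (f L : U -> W) : sdiff f L ->
  sdiff (fun rho => f (pr rho)) (fun rho => L (dpr rho)).
Proof. by move=> sf; exact: (sdiff_comp pr0 sf spr). Qed.

Variable k : nat.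
Hypothesis k5 : (k < 5)%N.

Let jX : mjet (Xu k) (Abar m k) (fun u : U => dX k u.2 (dstate k u)).
Proof.
have [jA jB] := @state_jets R m k (ltnW k5).
by have [H _ _ _] := step_jets k5 jA jB erefl erefl.
Qed.

Let jw : mjet (wu k) (wcen m k) (fun u : U => dw k (dstate k u)).
Proof.
have [jA jB] := @state_jets R m k (ltnW k5).
by have [_ H _ _] := step_jets k5 jA jB erefl erefl.
Qed.

Let jA : mjet (fun u : U => (state k u).1) (piA m k) (fun u => (dstate k u).1).
Proof. by have [] := @state_jets R m k (ltnW k5). Qed.

Let tangent0 rho : (rho, G rho) = (0 : U) -> rho = 0.
Proof. by case. Qed.

(** The point lambda xi + (1 - lambda) pi with mu = 1 - lambda: mu = 0 gives xi and mu = 1 gives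
    pi. *)
Definition sheet (mu : R) (u : U) : P :=
  (1 - mu) *: (Xu k u, sigma k (Xu k u)) + mu *: state k u.

Let straighten (mu : R) (y : P) : P := (y.1, mu^-1 *: (y.2 - sigma k y.1)).

(** As sigma_k is affine, the distance of the sheet from the graph is exactly mu w. Dividing by mu
    leaves w, which does not depend on mu, so nothing degenerates as mu tends to 0. *)
Let straightenE mu u y : 0 < mu ->
  (y = sheet mu u) <-> straighten mu y = (Xu k u + mu *: ((state k u).1 - Xu k u), wu k u).
Proof.
move=> mu0; have muN : mu != 0 by rewrite gt_eqF.
set X := Xu k u; set A := (state k u).1; set B := (state k u).2.
have w1 : (1 - mu) *: X + mu *: A = X + mu *: (A - X).
  by rewrite scalerBl scale1r scalerBr -!addrA; congr (_ + _); rewrite addrC.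
have key : sigma k (X + mu *: (A - X)) = (1 - mu) *: sigma k X + mu *: sigma k A.
  by rewrite -w1 -[mu in mu *: A](subKr 1) sigma_affine subKr.
have sE : sheet mu u = (X + mu *: (A - X), (1 - mu) *: sigma k X + mu *: B).
  by rewrite -w1.
rewrite sE /straighten; split => [->|[E1 E2]] /=.
  congr (_, _); rewrite key /wu /wst -/A -/B opprD addrACA subrr add0r -scalerBr.
  by rewrite scalerA mulVf// scale1r.
rewrite [y]surjective_pairing E1; congr (_, _).
move: E2; rewrite E1 key => /(congr1 (fun M => mu *: M)).
rewrite scalerA mulfV// scale1r /wu /wst -/A -/B scalerBr => /eqP.
by rewrite subr_eq => /eqP ->; rewrite addrC -addrA [X in _ + X]addrC subrK.
Qed.

Let straighten_lip mu : exists2 K : R, 0 < K & forall x y,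
  pnorm (straighten mu x - straighten mu y) <= K * pnorm (x - y).
Proof.
pose F (v : V) : V := stk ((unstk v).1, mu^-1 *: ((unstk v).2 - hess k (unstk v).1)).
have lF : linear F.
  move=> a u v; rewrite /F /unstk /stk [LHS]/= [RHS]/=.
  have -> : usubmx (a *: u + v) = a *: usubmx u + usubmx v by rewrite linearP.
  have -> : dsubmx (a *: u + v) = a *: dsubmx u + dsubmx v by rewrite linearP.
  rewrite linear_hess.
  rewrite scale_col_mx add_col_mx; congr col_mx.
  rewrite !scalerBr !scalerDr !scalerA [a * _]mulrC opprD -!addrA; congr (_ + _).
  by rewrite addrCA.
have [_ [C C0 HC]] := linear_mx_bounded lF.
have K0 := @Kn_gt0 R n.
exists (@Kn R n * C); first exact: mulr_gt0.
move=> x y; apply: le_trans (pnorm_le_stk _) _; rewrite -mulrA ler_wpM2l ?(ltW K0)//.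
have -> : stk (straighten mu x - straighten mu y) = F (stk (x - y)).
  rewrite /F stkK /straighten; congr stk; congr (_, _) => /=.
  rewrite -scalerBr; congr (_ *: _); rewrite /sigma.
  have -> : x.1 - y.1 = (x.1 - @Abar R m k) - (y.1 - Abar m k).
    by rewrite opprB addrA subrK.
  rewrite [hess k (_ - _ - _)]hessB.
  move: (hess k (x.1 - _)) (hess k (y.1 - _)) (Bbar m k) => P1 P2 B0.
  by apply/matrixP => i j; rewrite !mxE; ring.
apply: le_trans (HC _) _; rewrite ler_wpM2l ?(ltW C0)//.
exact: stk_le_pnorm.
Qed.

Lemma step_facts (e : R) : 0 < e -> exists d mu0 : R,
 [/\ 0 < d, 0 < mu0,
  forall rho, `|rho| < d -> [/\ frob (Xu k (pr rho) - Abar m k) < e,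
     frob ((state k (pr rho)).1 - piA m k) < e & `|tau k (g rho) - 2^-1| < e],
  forall r, r < d -> cont_onR (cball r) (fun x => (tau k (g (stk x)))^-1) /\
     cont_onP (cball r) (fun x => gammau k (pr (stk x))) &
  forall r mu, r <= d -> mu = 1 \/ 0 < mu <= mu0 ->
    openP (fun y => exists2 rho, oball r rho & y = sheet mu (pr (stk rho)))].
Proof.
move=> e0.
have sX : sdiff (fun rho => Xu k (pr rho)) (fun rho => dX k (G rho) (dstate k (dpr rho))).
  by apply: (pull (L := fun u : U => dX k u.2 (dstate k u))); apply: sdiff_mx => i j; exact: (jX i j).2.
have sA : sdiff (fun rho => (state k (pr rho)).1) (fun rho => (dstate k (dpr rho)).1).
  by apply: (pull (f := fun u => (state k u).1) (L := fun u => (dstate k u).1)); apply: sdiff_mx => i j; exact: (jA i j).2.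
have st : sdiff (fun rho => tau k (g rho) : R^o) (fun rho => Zrow k (G rho) ord0 : R^o).
  apply: (pull (f := fun u => tau k u.2 : R^o) (L := fun u => Zrow k u.2 ord0 : R^o)).
  have [_ H] := jetD (jet_cst 2^-1) (@Zrow_jet R m k ord0).
  by refine (sdiff_ext _ _ H) => u //=; rewrite add0r.
have t0 : tau k (g 0) = 2^-1.
  rewrite g0 /tau; case: (k) => [|k']; rewrite /Zrow ?mxE ?addr0 //.
have sti : sdiff (fun rho => (tau k (g rho))^-1 : R^o)
    (fun rho => - (2^-1) ^- 2 * Zrow k (G rho) ord0 : R^o).
  by apply: (sdiffV t0 _ st).
have sPi : sdiff (fun rho => stk (state k (pr rho))) (fun rho => stk (dstate k (dpr rho))).
  exact: (pull (state_sdiff m (ltnW k5))).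
have sGa : sdiff (fun rho => stk (gammau k (pr rho)))
    (fun rho => stk (dstate k.+1 (dpr rho)) - stk (dstate k (dpr rho))).
  apply: sdiff_ext (sdiffB (pull (state_sdiff m k5)) sPi) => // rho.
  by rewrite stateS stkD addrC addKr.
have sPs : sdiff (fun rho => stk (Xu k (pr rho), wu k (pr rho)))
    (fun rho => stk (dX k (G rho) (dstate k (dpr rho)), dw k (dstate k (dpr rho)))).
  exact: (pull (mjet_stk jX jw)).
have sEx : sdiff (fun rho => stk ((state k (pr rho)).1 - Xu k (pr rho), 0))
    (fun rho => stk ((dstate k (dpr rho)).1 - dX k (G rho) (dstate k (dpr rho)), 0)).
  exact: (pull (mjet_stk (mjetB jA jX) (mjet_cst 0))).
have e4 : 0 < e / (2 * n)%:R by rewrite divr_gt0// ltr0n.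
have [d1 d10 H1] := sdiff_near sX e4.
have [d2 d20 H2] := sdiff_near sA e4.
have [d3 d30 H3] := sdiff_near st e0.
have [d4 d40 H4] := sdiff_cont_onR sti.
have [d5 d50 H5] := sdiff_cont_onP sGa.
have [|d6 [mu6 [d60 mu60 H6]]] := sdiff_open_family sPi _ (sdiff_cst V (0 : V)).
  move=> v /(congr1 unstk); rewrite stkK => h; apply: tangent0.
  apply: (state_kernel k5) => //; rewrite h /unstk.
  by apply/eqP; rewrite xpair_eqE; apply/andP; split; apply/eqP/matrixP => i j; rewrite !mxE.
(* Sheets near lambda = 1: in straightened coordinates they are (X, w) + mu (A - X, 0). *)
have [|d7 [mu7 [d70 mu70 H7]]] := sdiff_open_family sPs _ sEx.
  move=> v /(congr1 unstk); rewrite stkK /unstk linear0 linear0 => -[h1 h2].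
  exact/tangent0/(point_kernel k5).
exists (Num.min (Num.min d1 d2) (Num.min d3 (Num.min d4 (Num.min d5 (Num.min d6 d7))))), mu7.
split => //; first by rewrite !lt_min d10 d20 d30 d40 d50 d60 d70.
- move=> rho; rewrite !lt_min => /andP[/andP[r1 r2] /andP[r3 _]]; split.
  + apply: le_lt_trans (frob_le_norm _) _.
    rewrite mulrC -ltr_pdivlMr ?ltr0n//.
    have := H1 _ r1; congr (`|_ - _| < _); rewrite -/(pr 0) pr0.
    by apply/matrixP => i j; have [] := jX i j.
  + apply: le_lt_trans (frob_le_norm _) _.
    rewrite mulrC -ltr_pdivlMr ?ltr0n//.
    have := H2 _ r2; rewrite pr0; congr (`|_ - _| < _).
    by apply/matrixP => i j; have [] := jA i j.
  + by have := H3 _ r3; rewrite t0.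
- move=> r; rewrite !lt_min => /andP[_ /andP[_ /andP[r4 /andP[r5 _]]]]; split; first exact: H4.
  have := H5 _ r5; congr cont_onP; apply/funext => x; by rewrite stkK.
- move=> r mu; rewrite !le_min => /andP[_ /andP[_ /andP[_ /andP[_ /andP[r6 r7]]]]] [->|/andP[mu0 mu1]].
  + have h00 : (0 : R) <= 0 <= mu6 by apply/andP; split => //; exact: ltW.
    have := open_image (H6 0 h00) r6; congr openP; apply/funext => y; apply/propext.
    split => -[rho rr yE]; exists rho => //.
      rewrite /sheet subrr scale0r add0r scale1r -[LHS]stkK yE /= scale0r addr0.
      by rewrite stkK.
    by rewrite yE /sheet subrr scale0r add0r scale1r /= scale0r addr0.
  + have [K K0 HK] := straighten_lip mu.
    have h01 : 0 <= mu <= mu7 by apply/andP; split => //; exact: ltW.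
    have := openP_preimage K0 HK (open_image (H7 mu h01) r7).
    congr openP; apply/funext => y; apply/propext.
    split => -[rho rr yE]; exists rho => //.
      apply/straightenE => //; rewrite -[LHS]stkK yE /stk /= scale_col_mx add_col_mx.
      by rewrite scaler0 addr0 /unstk col_mxKu col_mxKd.
    move/straightenE: yE => /(_ mu0) ->.
    by rewrite /stk /= scale_col_mx add_col_mx scaler0 addr0.
Qed.

End StepFacts.

(** * Separation of nodes and base points, and assembly of the condition *)

Section CondO.
Context {R : realType} (m : nat).
Local Notation n := m.+2.
Local Notation Mat := 'M[R]_(2, n).
Local Notation V := 'M[R]_(2 + 2, n).
Local Notation U := (V * V)%type.
Local Notation P := (Mat * Mat)%type.

Lemma Abar_sep i j : (i < 5)%N -> (j < 5)%N -> i != j ->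
  1 <= `|@Abar R m i ord0 ord0 - Abar m j ord0 ord0|.
Proof.
have E k : (k < 5)%N -> @Abar R m k ord0 ord0 = nth 0 [:: -2; 1; 2; 5; -3] k.
  case: k => [|[|[|[|[|k]]]]] // _;
  rewrite /Abar /piA ?big_ord_recr big_ord0 /Cgam1 /core !mxE /= ?zrE; lra.
move=> i5 j5; rewrite !E//.
case: i i5 => [|[|[|[|[|i]]]]] // _; case: j j5 => [|[|[|[|[|j]]]]] // _ _ /=;
  rewrite ler_normr; apply/orP; by [left; lra|right; lra].
Qed.

(** No single entry distinguishes the five base points, but this combination takes the values 0, 2,
    3, 4, 6. *)
Lemma piA_sep i j : (i < 5)%N -> (j < 5)%N -> i != j ->
  1 <= `|(2 * @piA R m i ord0 ord0 + piA m i row1 (col1 m)) -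
         (2 * piA m j ord0 ord0 + piA m j row1 (col1 m))|.
Proof.
have E k : (k < 5)%N -> 2 * @piA R m k ord0 ord0 + piA m k row1 (col1 m) =
    nth 0 [:: 0; 2; 3; 4; 6] k.
  case: k => [|[|[|[|[|k]]]]] // _;
  rewrite /piA ?big_ord_recr big_ord0 /Cgam1 /core !mxE /= ?zrE; lra.
move=> i5 j5; rewrite !E//.
case: i i5 => [|[|[|[|[|i]]]]] // _; case: j j5 => [|[|[|[|[|j]]]]] // _ _ /=;
  rewrite ler_normr; apply/orP; by [left; lra|right; lra].
Qed.

Lemma Abar_near_piA k : (k < 5)%N -> `|@Abar R m k ord0 ord0 - piA m k ord0 ord0| <= 6.
Proof.
case: k => [|[|[|[|[|k]]]]] // _;
  rewrite /Abar /piA ?big_ord_recr big_ord0 /Cgam1 /core !mxE /= ?zrE ler_norml;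
  apply/andP; split; lra.
Qed.

End CondO.

Section CondO.
Context {R : realType} (m : nat).
Local Notation n := m.+2.
Local Notation Mat := 'M[R]_(2, n).
Local Notation V := 'M[R]_(2 + 2, n).
Local Notation U := (V * V)%type.
Local Notation P := (Mat * Mat)%type.

Lemma state_sum k (u : U) : state k u = unstk u.1 + \sum_(j < k) gammau j u.
Proof.
elim: k => [|k IH]; first by rewrite big_ord0 addr0.
by rewrite big_ord_recr addrA -IH stateS.
Qed.

Lemma sum_before (F : nat -> P) (i : 'I_5) :
  \sum_(j < 5 | (j < i)%N) F j = \sum_(j < i) F j.
Proof. by rewrite [RHS](big_ord_widen _ F (ltnW (ltn_ord i))). Qed.

Lemma sheet1E k mu (u : U) :
  (sheet k mu u).1 = (1 - mu) *: Xu k u + mu *: (state k u).1.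
Proof. by []. Qed.

Lemma point_of_gamma k (u : U) : tau k u.2 != 0 ->
  state k u + (tau k u.2)^-1 *: gammau k u = (Xu k u, sigma k (Xu k u)).
Proof.
move=> t0; rewrite /gammau; set T := tau k u.2 in t0 *.
have -> : T^-1 *: (T *: (Xu k u - (state k u).1), T *: (sigma k (Xu k u) - (state k u).2)) =
   (Xu k u, sigma k (Xu k u)) - state k u.
  by apply/eqP; rewrite xpair_eqE /= !scalerA mulVf// !scale1r !eqxx.
by rewrite addrC subrK.
Qed.

Lemma sheet0 k (u : U) : sheet k 0 u = (Xu k u, sigma k (Xu k u)).
Proof. by rewrite /sheet subr0 scale1r scale0r addr0. Qed.

Lemma sheet1 k (u : U) : sheet k 1 u = state k u.
Proof. by rewrite /sheet subrr scale0r add0r scale1r. Qed.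

(** Node and base point differ by at most 6 at the centre, hence by at most 7 nearby; 28 = 4 * 7. *)
Lemma sheet_drift (mu x a b p : R) : 0 <= mu -> mu <= 28^-1 -> `|x - b| < 16^-1 ->
  `|a - p| < 16^-1 -> `|b - p| <= 6 -> `|mu * (a - x)| <= 4^-1.
Proof.
move=> mu0 mu1 xb ap bp; rewrite normrM ger0_norm//.
have : `|a - x| <= 7.
  have -> : a - x = (a - p) - (b - p) - (x - b) by ring.
  apply: le_trans (ler_normB _ _) _; apply: le_trans (lerD (ler_normB _ _) (lexx _)) _.
  move: xb ap bp; move: `|x - b| `|a - p| `|b - p| => u v w; clear; lra.
by move: (normr_ge0 (a - x)); move: `|a - x| => z; clear -mu0 mu1; nra.
Qed.

(** Equality would force 1 <= 1/4 + 1/4 + 1/16 + 1/16. *)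
Lemma sheet_separation (mu x1 x2 a1 a2 b1 b2 : R) : `|mu * (a1 - x1)| <= 4^-1 ->
  `|mu * (a2 - x2)| <= 4^-1 -> `|x1 - b1| < 16^-1 -> `|x2 - b2| < 16^-1 ->
  1 <= `|b1 - b2| -> (1 - mu) * x1 + mu * a1 <> (1 - mu) * x2 + mu * a2.
Proof.
move=> h1 h2 h3 h4 h5 E.
have D : b1 - b2 = mu * (a2 - x2) - mu * (a1 - x1) + (x2 - b2) - (x1 - b1).
  apply/eqP; rewrite -subr_eq0; apply/eqP.
  transitivity (((1 - mu) * x1 + mu * a1) - ((1 - mu) * x2 + mu * a2)); first by ring.
  by rewrite E subrr.
move: h5; rewrite D; apply/negP; rewrite -ltNge.
apply: le_lt_trans (ler_normB _ _) _; apply: le_lt_trans (lerD (ler_normD _ _) (lexx _)) _.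
apply: le_lt_trans (lerD (lerD (ler_normB _ _) (lexx _)) (lexx _)) _.
by move: h1 h2 h3 h4; move: `|mu * _| `|mu * _| `|x1 - b1| `|x2 - b2| => u v w z; clear; lra.
Qed.

(** Only the values of s near the five nodes matter, since all points of the loop over a small ball
    stay close to the centre. The tolerance 1/16 keeps tau inside [1/4, 3/4] and preserves the
    integer separations. *)
Lemma condO_of_local_sigma (s : Mat -> Mat) (r1 : R) : Defs.continuousM s -> 0 < r1 ->
  (forall k A, (k < 5)%N -> frob (A - Abar m k) < r1 -> s A = sigma k A) ->
  condO 5 s.
Proof.
move=> cs r10 sE; split; first exact: cs.
have [r [g [G [rp g0 sg Hcl Htan]]]] := @closing_solution R m.
pose e := Num.min r1 (16^-1 : R).
have e0 : 0 < e by rewrite lt_min r10 /=; lra.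
have er1 : e <= r1 by rewrite ge_min lexx.
have e16 : e <= 16^-1 by rewrite ge_min lexx orbT.
have [dm Hdm] : exists dm : 'I_5 -> R * R, forall i : 'I_5,
 [/\ 0 < (dm i).1, 0 < (dm i).2,
  forall rho, `|rho| < (dm i).1 -> [/\ frob (Xu i (rho, g rho) - Abar m i) < e,
     frob ((state i (rho, g rho)).1 - piA m i) < e & `|tau i (g rho) - 2^-1| < e],
  forall r, r < (dm i).1 -> cont_onR (cball r) (fun x => (tau i (g (stk x)))^-1) /\
     cont_onP (cball r) (fun x => gammau i (stk x, g (stk x))) &
  forall r mu, r <= (dm i).1 -> mu = 1 \/ 0 < mu <= (dm i).2 ->
    openP (fun y => exists2 rho, oball r rho & y = sheet i mu (stk rho, g (stk rho)))].
  have [dm Hdm] := choice (fun i : 'I_5 => step_facts g0 sg Htan (ltn_ord i) e0).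
  have [mu Hmu] := choice Hdm.
  by exists (fun i => (dm i, mu i)).
pose dd := \big[Num.min/r]_i (dm i).1; pose mm := \big[Num.min/(28^-1 : R)]_i (dm i).2.
have dd0 : 0 < dd by apply/bigmin_gtP; split => // i _; have [] := Hdm i.
have mm0 : 0 < mm.
  by apply/bigmin_gtP; split => [|i _]; [lra|have [] := Hdm i].
have ddi i : dd <= (dm i).1 by apply: bigmin_le.
have ddr : dd <= r by apply: bigmin_le_id.
have mmi i : mm <= (dm i).2 by apply: bigmin_le.
have mm28 : mm <= 28^-1 by apply: bigmin_le_id.
(* Halving puts the closed ball of radius [r0] inside the open region where the local facts hold. *)
pose r0 := dd / 2.
have r00 : 0 < r0 by rewrite divr_gt0.
have r0d : r0 < dd by rewrite /r0; lra.
pose gam (i : 'I_5) (x : P) : P := gammau i (stk x, g (stk x)).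
pose kap (i : 'I_5) (x : P) : R := (tau i (g (stk x)))^-1.
have inb (x : P) : cball r0 x -> `|stk x| < dd.
  by move=> xr; apply: le_lt_trans (stk_le_pnorm _) _; apply: le_lt_trans r0d.
have near (i : 'I_5) x : cball r0 x ->
   [/\ frob (Xu i (stk x, g (stk x)) - Abar m i) < e,
     frob ((state i (stk x, g (stk x))).1 - piA m i) < e & `|tau i (g (stk x)) - 2^-1| < e].
  move=> /inb xd; have [_ _ H _ _] := Hdm i; apply: H.
  exact: lt_le_trans xd (ddi i).
have taub (i : 'I_5) x : cball r0 x -> 4^-1 <= tau (i : 'I_5) (g (stk x)) <= 3 / 4.
  by move=> /(near i)[_ _]; rewrite ltr_norml => /andP[h1 h2]; apply/andP; split; lra.
have taun (i : 'I_5) x : cball r0 x -> tau (i : 'I_5) (g (stk x)) != 0.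
  by move=> /(taub i)/andP[h _]; rewrite gt_eqF// (lt_le_trans _ h).
have piE (i : 'I_5) x : x + \sum_(j < 5 | (j < i)%N) gam j x =
    state i (stk x, g (stk x)).
  by rewrite state_sum stkK (sum_before (fun j => gammau j (stk x, g (stk x)))).
have xiE (i : 'I_5) x : cball r0 x -> (x + \sum_(j < 5 | (j < i)%N) gam j x) + kap i x *: gam i x =
   (Xu i (stk x, g (stk x)), sigma i (Xu i (stk x, g (stk x)))).
  by move=> xr; rewrite piE /kap /gam -point_of_gamma// taun.
have X00 (i : 'I_5) x : cball r0 x ->
    `|Xu (i : 'I_5) (stk x, g (stk x)) ord0 ord0 - Abar m i ord0 ord0| < 16^-1.
  move=> /(near i)[h _ _]; have := entry_le_frob (Xu i (stk x, g (stk x)) - Abar m i) ord0 ord0.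
  by rewrite !mxE => /le_lt_trans; apply; exact: lt_le_trans h e16.
have A00 (i : 'I_5) x (a : 'I_2) b : cball r0 x ->
    `|(state (i : 'I_5) (stk x, g (stk x))).1 a b - piA m i a b| < 16^-1.
  move=> /(near i)[_ h _]; have := entry_le_frob ((state i (stk x, g (stk x))).1 - piA m i) a b.
  by rewrite !mxE => /le_lt_trans; apply; exact: lt_le_trans h e16.
have Xsep (i j : 'I_5) x y (mu : R) : i != j -> 0 <= mu <= 28^-1 -> cball r0 x -> cball r0 y ->
   (sheet i mu (stk x, g (stk x))).1 <> (sheet j mu (stk y, g (stk y))).1.
  move=> ij /andP[mu0 mu1] xr yr /(congr1 (fun M : Mat => M ord0 ord0)).
  have := @Abar_sep R m i j (ltn_ord i) (ltn_ord j) ij.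
  have sx (k : 'I_5) z : cball r0 z -> `|mu * ((state k (stk z, g (stk z))).1 ord0 ord0
      - Xu k (stk z, g (stk z)) ord0 ord0)| <= 4^-1.
    by move=> zr; exact: sheet_drift mu0 mu1 (X00 k z zr) (A00 k z ord0 ord0 zr) (Abar_near_piA _ _).
  have := sheet_separation (sx i x xr) (sx j y yr) (X00 i x xr) (X00 j y yr).
  rewrite !sheet1E; move: (Xu i _) (Xu j _) (state i _).1 (state j _).1 => X1 X2 A1 A2.
  by move=> /[apply]; rewrite !mxE.
have Asep (i j : 'I_5) x y : i != j -> cball r0 x -> cball r0 y ->
   (state i (stk x, g (stk x))).1 <> (state j (stk y, g (stk y))).1.
  move=> ij xr yr E.
  have := @piA_sep R m i j (ltn_ord i) (ltn_ord j) ij.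
  have := A00 i x ord0 ord0 xr; have := A00 j y ord0 ord0 yr.
  have := A00 i x row1 (col1 m) xr; have := A00 j y row1 (col1 m) yr.
  rewrite E !ltr_norml => /andP[h1 h2] /andP[h3 h4] /andP[h5 h6] /andP[h7 h8].
  by rewrite ler_normr => /orP[]; lra.
(* The bounds on kappa are the reciprocals of 1/4 <= tau <= 3/4. *)
exists r0, 4^-1, (3 / 4), kap, gam; split; [|split; [|split; [|split]]].
- by split => //; lra.
- move=> i; have [_ _ _ H _] := Hdm i; apply: H.
  exact: lt_le_trans r0d (ddi i).
- move=> i x xr; split; last exact: wave_cone_gammau.
  have /andP[h1 h2] := taub i x xr.
  have tp : 0 < tau i (g (stk x)) by apply: lt_le_trans h1.
  by rewrite /kap !lef_pV2 ?posrE// h1 h2.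
- move=> x xr; have := Hcl (stk x) (lt_le_trans (inb _ xr) ddr).
  rewrite state_sum /= stkK => /eqP; rewrite -subr_eq0 addrAC subrr add0r => /eqP.
  by [].
- split; [|split].
  + move=> i x xr; rewrite xiE// /Defs.graph /=; apply/esym/sE => //.
    by have [h _ _] := near i x xr; exact: lt_le_trans h er1.
  + move=> i j ij; split => x y xr yr; last by rewrite !piE; exact: Asep.
    have h00 : ((0 : R) <= 0) && ((0 : R) <= 28^-1) by rewrite lexx invr_ge0 ler0n.
    rewrite (xiE i x xr) (xiE j y yr).
    by have := Xsep i j x y 0 ij h00 xr yr; rewrite !sheet0.
  (* Since [mm] <= 1/28, this delta_0 exceeds 3/4, and lambda >= delta_0 means that mu = 1 - lambda
     is small enough for both openness and separation. *)
  + exists (1 - mm); split; first by lra.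
    split; first by lra.
    move=> q l q0 qr lH.
    have SE (i : 'I_5) : (fun y : P => exists2 rho, oball q rho &
        y = l *: (rho + \sum_(j < 5 | (j < i)%N) gam j rho + kap i rho *: gam i rho) +
        (1 - l) *: (rho + \sum_(j < 5 | (j < i)%N) gam j rho)) =
      (fun y => exists2 rho, oball q rho & y = sheet i (1 - l) (stk rho, g (stk rho))).
      apply/funext => y; apply/propext; split => -[x xq ->]; exists x => //;
      have xr : cball r0 x by apply: ltW; exact: lt_le_trans xq qr.
        by rewrite xiE// piE /sheet subKr.
      by rewrite xiE// piE /sheet subKr.
    split.
      move=> i; rewrite SE; have [_ _ _ _ H] := Hdm i; apply: H.
        by apply: le_trans qr _; apply: le_trans (ltW r0d) (ddi i).
      case: lH => [->|[l1 l2]]; first by left; rewrite subr0.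
      by right; apply/andP; split; have := mmi i; lra.
    move=> i j ij; rewrite !SE; rewrite -subset0 => y [[x xq ->] [x' xq']].
    have xr : cball r0 x by apply: ltW; exact: lt_le_trans xq qr.
    have xr' : cball r0 x' by apply: ltW; exact: lt_le_trans xq' qr.
    move=> /(congr1 fst); case: lH => [->|[l1 l2]].
      by rewrite subr0 !sheet1; exact: Asep.
    by apply: Xsep => //; apply/andP; split; lra.
Qed.

End CondO.

(** * Smooth functions of one variable *)

Section SmoothOneVariable.
Context {R : realType}.
Implicit Types f g : R -> R.

Fixpoint C1D (N : nat) f : Prop :=
  if N is N'.+1 then exists2 f', (forall x : R, is_derive x 1 f (f' x)) & C1D N' f'
  else continuous f.

Lemma is_derive_continuous f (x d : R) : is_derive x 1 f d -> {for x, continuous f}.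
Proof. by move=> h; apply: differentiable_continuous; apply/derivable1_diffP. Qed.

Lemma C1DW N f : C1D N.+1 f -> C1D N f.
Proof.
elim: N f => [|N IH] f [f' df cf]; first by move=> x; exact: is_derive_continuous (df x).
by exists f' => //; exact: IH.
Qed.

Lemma C1D_continuous N f : C1D N f -> continuous f.
Proof. by elim: N f => // N IH f /C1DW; exact: IH. Qed.

Lemma C1D_cst N (a : R) : C1D N (fun=> a).
Proof.
elim: N a => [|N IH] a; first by move=> x; exact: cst_continuous.
by exists (fun=> 0) => // x; exact: is_derive_cst.
Qed.

Lemma C1DD N f g : C1D N f -> C1D N g -> C1D N (fun x => f x + g x).
Proof.
elim: N f g => [|N IH] f g; first by move=> cf cg x; exact: continuousD (cf x) (cg x).
move=> [f' df cf] [g' dg cg]; exists (fun x => f' x + g' x); last exact: IH.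
by move=> x; exact: is_deriveD.
Qed.

Lemma C1DM N f g : C1D N f -> C1D N g -> C1D N (fun x => f x * g x).
Proof.
elim: N f g => [|N IH] f g; first by move=> cf cg x; exact: continuousM (cf x) (cg x).
move=> /[dup] /C1DW cf0 [f' df cf] /[dup] /C1DW cg0 [g' dg cg].
exists (fun x => f x * g' x + g x * f' x).
  by move=> x; exact: is_deriveM.
by apply: C1DD; exact: IH.
Qed.

Lemma C1DZ N a f : C1D N f -> C1D N (fun x => a * f x).
Proof. by move=> cf; apply: C1DM => //; exact: C1D_cst. Qed.

Lemma C1DV N f : (forall x, f x != 0) -> C1D N f -> C1D N (fun x => (f x)^-1).
Proof.
move=> f0; elim: N => [cf x|N IH]; first by apply: continuousV => //; exact: cf.
move=> /[dup] /C1DW cf0 [f' df cf].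
exists (fun x => - 1 * ((f x)^-1 * (f x)^-1) * f' x).
  move=> x; apply: (is_derive_eq (is_deriveV (f0 x) (df x))).
  by rewrite mulN1r expr2 invfM.
by apply: C1DM => //; apply: C1DZ; apply: C1DM; exact: IH.
Qed.

Lemma C1D_comp_affine N f (a b : R) : C1D N f -> C1D N (fun x => f (a * x + b)).
Proof.
have da (x : R) : is_derive x 1 (fun x : R => a * x + b) a.
  have h1 : is_derive x 1 (fun x : R => a * x) (a *: 1).
    exact: (@is_deriveZ R _ _ id a x 1 1).
  have := is_deriveD h1 (is_derive_cst b x 1).
  by move=> h; apply: (is_derive_eq h); rewrite addr0 [_ *: _]mulr1.
elim: N f => [|N IH] f.
  move=> cf x; apply: (@continuous_comp _ _ _ (fun x => a * x + b) f); last exact: cf.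
  exact: is_derive_continuous (da x).
move=> [f' df cf]; exists (fun x => a * f' (a * x + b)); last by apply: C1DZ; exact: IH.
by move=> x; apply: (is_derive_eq (is_derive1_comp (df _) (da x))); rewrite mulrC.
Qed.

(* [flat k t = t^-k exp(-1/t)] for [t > 0], extended by [0]. *)
Definition flat (k : nat) (t : R) : R := if 0 < t then t ^- k * expR (- t^-1) else 0.

Lemma flat_le0 k t : t <= 0 -> flat k t = 0.
Proof. by move=> t0; rewrite /flat ltNge t0. Qed.

Lemma flat_pos k t : 0 < t -> 0 < flat k t.
Proof. by move=> t0; rewrite /flat t0 mulr_gt0 ?expR_gt0// invr_gt0 exprn_gt0. Qed.

Lemma flat_ge0 k t : 0 <= flat k t.
Proof. by case: (ltP 0 t) => [/(flat_pos k)/ltW//|/flat_le0 ->]. Qed.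

(** One term of the exponential series, exp u >= u^(k+2) / (k+2)! at u = 1/t. *)
Lemma flat_bound k : exists2 C : R, 0 < C & forall t, flat k t <= C * t ^+ 2.
Proof.
exists (k.+2)`!%:R; first by rewrite ltr0n fact_gt0.
move=> t; case: (ltP 0 t) => [t0|/flat_le0 ->]; last by rewrite mulr_ge0 ?sqr_ge0.
rewrite /flat t0; have u0 : 0 <= t^-1 by rewrite invr_ge0 ltW.
have H := @expR_ge1Dxn R t^-1 k.+1 u0.
have {}H : t^-1 ^+ k.+2 / (k.+2)`!%:R <= expR t^-1 by lra.
rewrite expRN ler_pdivrMr ?expR_gt0//.
have f0 : (0 : R) < (k.+2)`!%:R by rewrite ltr0n fact_gt0.
apply: le_trans (ler_wpM2l _ H); last by rewrite mulr_ge0 ?sqr_ge0// ltW.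
rewrite le_eqVlt; apply/orP; left; apply/eqP.
rewrite -addn2 exprD !exprVn; field.
by rewrite expf_neq0 ?gt_eqF.
Qed.

Lemma flat_derive k (t : R) : is_derive t 1 (flat k) (flat k.+2 t - k%:R * flat k.+1 t).
Proof.
case: (ltgtP t 0) => [t0|t0|->].
- rewrite !flat_le0 ?ltW// mulr0 subr0.
  apply: near_eq_is_derive (is_derive_cst (0 : R) t 1).
  by near=> x; rewrite flat_le0// ltW//; near: x; exact: lt_nbhsl.
- have tn : t != 0 by rewrite gt_eqF.
  have h1 : is_derive t 1 (fun x : R => x ^+ k) (k%:R * t ^+ k.-1).
    have := is_deriveX k (is_derive_id t 1); rewrite exprfctE => h.
    by apply: (is_derive_eq h); rewrite [_ *: _]mulr1.
  have h2 := @is_deriveV R (fun x : R => x ^+ k) t (k%:R * t ^+ k.-1) 1 (expf_neq0 k tn) h1.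
  have h3 := is_deriveN (@is_deriveV R id t 1 1 tn (is_derive_id t 1)).
  have h4 := @is_derive1_comp R expR (fun x => - x^-1) t _ _ (is_derive_expR _) h3.
  have nf : \near t, (fun x => (x ^+ k)^-1 * expR (- x^-1)) t = flat k t.
    by near=> x; rewrite /flat ifT//; near: x; exact: lt_nbhsr.
  apply: (is_derive_eq (near_eq_is_derive nf (is_deriveM h2 h4))).
  rewrite /flat t0 /= -![_ *: _]/(_ * _) -!exprVn; set u := t^-1; set e := expR _.
  case: (k) => [|j] /=; first by rewrite !expr0 !mul0r; ring.
  have un : u ^+ j != 0 by rewrite expf_neq0// invr_eq0.
  have -> : t ^+ j = (u ^+ j)^-1 by rewrite exprVn invrK.
  by rewrite !exprS; field.
(* At 0 the difference quotient of [flat k] is [flat k.+1], which tends to 0 by the quadratic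
   bound. *)
- rewrite !flat_le0// mulr0 subr0; apply/is_derive1_caratheodory.
  exists (flat k.+1); split; last by rewrite flat_le0.
    move=> z; rewrite (flat_le0 k (lexx 0)) !subr0; case: (ltP 0 z) => [z0|z0]; last first.
      by rewrite !flat_le0// mul0r.
    have zn : z != 0 by rewrite gt_eqF.
    have zk : z ^+ k != 0 by rewrite expf_neq0.
    by rewrite /flat z0 exprS; field; rewrite zk zn.
  have [C C0 HC] := flat_bound k.+1.
  apply/cvgrPdist_lt => e e0; rewrite (flat_le0 k.+1 (lexx 0)).
  have d0 : 0 < Num.min 1 (e / C) by rewrite lt_min ltr01 divr_gt0.
  near=> z; rewrite sub0r normrN ger0_norm ?flat_ge0//.
  have : `|z| < Num.min 1 (e / C).
    by near: z; apply/nbhs_ballP; exists (Num.min 1 (e / C)) => // y; rewrite /ball /= sub0r normrN.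
  rewrite lt_min => /andP[z1 z2].
  apply: le_lt_trans (HC z) _; rewrite -real_normK ?num_real// expr2 mulrA.
  apply: (@le_lt_trans _ _ (C * `|z|)).
    by rewrite -[leRHS]mulr1; apply: ler_wpM2l; [rewrite mulr_ge0// ltW|exact: ltW].
  by rewrite mulrC -ltr_pdivlMr.
Unshelve. all: by end_near. Qed.

(** Derivatives of members of the family are linear combinations of members, so induction on N works
    for all k at once. *)
Lemma flat_C1D N k : C1D N (flat k).
Proof.
elim: N k => [|N IH] k; first by move=> x; exact: is_derive_continuous (flat_derive k x).
exists (fun t => flat k.+2 t + - k%:R * flat k.+1 t).
  by move=> x; apply: (is_derive_eq (flat_derive k x)); rewrite mulNr.
by apply: C1DD => //; exact: C1DZ.
Qed.

Lemma flat0_mono : {homo flat 0 : x y / x <= y}.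
Proof.
move=> x y xy; case: (ltP 0 x) => [x0|/flat_le0 ->]; last exact: flat_ge0.
have y0 := lt_le_trans x0 xy.
by rewrite /flat x0 y0 !expr0 invr1 !mul1r ler_expR lerN2 lef_pV2.
Qed.

Definition smooth_step (t : R) : R := flat 0 t / (flat 0 t + flat 0 (1 - t)).

Lemma smooth_step_den t : 0 < flat 0 t + flat 0 (1 - t).
Proof.
have := flat_ge0 0 t; have := flat_ge0 0 (1 - t).
case: (ltP 0 t) => [/(flat_pos 0)|t0]; first by lra.
have : 0 < flat 0 (1 - t) by apply: flat_pos; lra.
lra.
Qed.

Lemma smooth_step_C1D N : C1D N smooth_step.
Proof.
have c1 := flat_C1D N 0.
have c2 : C1D N (fun t => flat 0 (1 - t)).
  rewrite (_ : (fun t => flat 0 (1 - t)) = (fun t => flat 0 (-1 * t + 1))).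
    exact: C1D_comp_affine.
  by apply/funext => t; rewrite mulN1r addrC.
apply: C1DM => //; apply: C1DV; last by apply: C1DD.
by move=> x; rewrite gt_eqF// smooth_step_den.
Qed.

Lemma smooth_step_le0 t : t <= 0 -> smooth_step t = 0.
Proof. by move=> t0; rewrite /smooth_step flat_le0// mul0r. Qed.

Lemma smooth_step_ge1 t : 1 <= t -> smooth_step t = 1.
Proof.
move=> t1; rewrite /smooth_step [flat 0 (1 - t)]flat_le0 ?subr_le0//.
by rewrite addr0 mulfV// gt_eqF// flat_pos// (lt_le_trans _ t1).
Qed.

Lemma smooth_step_itv t : 0 <= smooth_step t <= 1.
Proof.
have d := smooth_step_den t.
rewrite /smooth_step ler_pdivrMr// mul1r lerDl flat_ge0 andbT.
by rewrite divr_ge0 ?flat_ge0// ltW.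
Qed.

Lemma smooth_step_mono : {homo smooth_step : x y / x <= y}.
Proof.
move=> x y xy; have dx := smooth_step_den x; have dy := smooth_step_den y.
rewrite /smooth_step ler_pdivrMr// mulrAC ler_pdivlMr//.
have h1 := flat0_mono xy.
have h2 : flat 0 (1 - y) <= flat 0 (1 - x) by apply: flat0_mono; lra.
have := flat_ge0 0 x; have := flat_ge0 0 (1 - y); nra.
Qed.

Let mu := @lebesgue_measure R.

(** A smooth convex substitute for max(0, x). As [smooth_step] vanishes on the negative axis, the
    lower limit -1 acts as minus infinity and leaves room to differentiate at 0. *)
Definition soft_plus (x : R) : R :=
  (\int[mu]_(t in `[(-1 : R), x]%classic) smooth_step t)%R.

Lemma soft_plus_le0 x : x <= 0 -> soft_plus x = 0.
Proof.
move=> x0; rewrite /soft_plus (@eq_Rintegral _ _ _ mu _ (fun=> 0)).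
  by rewrite Rintegral_cst// ?mul0r.
move=> t; rewrite inE /= in_itv /= => /andP[_ tx].
by rewrite smooth_step_le0// (le_trans tx).
Qed.

Lemma soft_plus_derive (x : R) : is_derive x 1 soft_plus (smooth_step x).
Proof.
(* Left of -1/2 the function is locally 0; elsewhere x is interior to the interval of integration,
   as the fundamental theorem requires. *)
case: (ltP x (- 2^-1)) => x0.
  rewrite smooth_step_le0; last by lra.
  apply: near_eq_is_derive (is_derive_cst (0 : R) x 1).
  near=> y; rewrite soft_plus_le0//.
  have : y < 0 by near: y; apply: lt_nbhsl; lra.
  exact: ltW.
have cs : continuous smooth_step := smooth_step_C1D 0.
have [|||h1 h2] := @continuous_FTC1 R smooth_step (BLeft (-1)) x (x + 1) _ _ _ (cs x).
- lra.
- apply: continuous_compact_integrable; first exact: segment_compact.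
  exact: continuous_subspaceT.
- by rewrite /Order.lt /=; lra.
by apply: (is_derive_eq (derivableP h1)); rewrite -derive1E h2.
Unshelve. all: by end_near. Qed.

Lemma soft_plus_C1D N : C1D N soft_plus.
Proof.
apply: C1DW; exists smooth_step; first exact: soft_plus_derive.
exact: smooth_step_C1D.
Qed.

Lemma soft_plus_mvt x y : x <= y ->
  exists2 c, x <= c <= y & soft_plus y - soft_plus x = smooth_step c * (y - x).
Proof.
move=> xy; have [|c cxy E] := @MVT_segment R soft_plus smooth_step x y xy (fun z _ => soft_plus_derive z).
  exact/continuous_subspaceT/(soft_plus_C1D 0).
by exists c => //; move: cxy; rewrite in_itv.
Qed.

Lemma soft_plus_ge1 x : 1 <= x -> soft_plus x = x + (soft_plus 1 - 1).
Proof.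
move=> x1; have [c /andP[c1 _]] := soft_plus_mvt x1.
by rewrite smooth_step_ge1//; lra.
Qed.

Lemma soft_plus_lip x y : x <= y -> 0 <= soft_plus y - soft_plus x <= y - x.
Proof.
move=> xy; have [c _ ->] := soft_plus_mvt xy; have /andP[s0 s1] := smooth_step_itv c.
by rewrite mulr_ge0 ?subr_ge0//= -[leRHS]mul1r ler_wpM2r ?subr_ge0.
Qed.

(** The slope [smooth_step] is nondecreasing, so the graph lies above its tangents; convexity
    follows from this. *)
Lemma soft_plus_tangent x y : soft_plus x + smooth_step x * (y - x) <= soft_plus y.
Proof.
case: (leP x y) => xy.
  have [c /andP[xc _] E] := soft_plus_mvt xy; have := smooth_step_mono xc; nra.
have [c /andP[_ cx] E] := soft_plus_mvt (ltW xy); have := smooth_step_mono cx; nra.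
Qed.

Lemma soft_plus_convex x y l : 0 <= l <= 1 ->
  soft_plus (l * x + (1 - l) * y) <= l * soft_plus x + (1 - l) * soft_plus y.
Proof.
move=> /andP[l0 l1]; set z := l * x + (1 - l) * y.
have hx := soft_plus_tangent z x; have hy := soft_plus_tangent z y.
have : l * (soft_plus z + smooth_step z * (x - z)) + (1 - l) * (soft_plus z + smooth_step z * (y - z))
   = soft_plus z by rewrite /z; ring.
have := ler_wpM2l l0 hx; have l1' : 0 <= 1 - l by lra.
have := ler_wpM2l l1' hy; lra.
Qed.

End SmoothOneVariable.

(** * Smooth functions through directional derivatives *)

Section DirectionalDerivative.
Context {R : realType} {V : lmodType R}.
Implicit Types (f g : V -> R) (x v : V).

Definition dis f v x (d : R) := is_derive (0 : R) 1 (fun t : R => f (x + t *: v)) d.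

Lemma dis_dder f v x d : dis f v x d -> dder f v x = d.
Proof. by move=> h; rewrite /dder derive1E; exact: (@derive_val _ _ _ _ _ _ _ h). Qed.

Lemma dis_dderivable f v x d : dis f v x d -> dderivable f v x.
Proof. by move=> h; exact: (@ex_derive _ _ _ _ _ _ _ h). Qed.

Lemma dderivable_dis f v x : dderivable f v x -> dis f v x (dder f v x).
Proof. by move=> h; rewrite /dis /dder derive1E; exact: derivableP. Qed.

Lemma dis_eq f v x d d' : dis f v x d -> d = d' -> dis f v x d'.
Proof. by move=> h <-. Qed.

Lemma dis_cst (c : R) v x : dis (fun=> c) v x 0.
Proof. exact: is_derive_cst. Qed.

Lemma disD f g v x d d' : dis f v x d -> dis g v x d' ->
  dis (fun y => f y + g y) v x (d + d').
Proof. by move=> h k; exact: is_deriveD h k. Qed.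

Lemma disM f g v x d d' : dis f v x d -> dis g v x d' ->
  dis (fun y => f y * g y) v x (f x * d' + g x * d).
Proof.
move=> h k; apply: (is_derive_eq (is_deriveM h k)).
by rewrite !scale0r !addr0.
Qed.

Lemma disZ a f v x d : dis f v x d -> dis (fun y => a * f y) v x (a * d).
Proof.
move=> h; apply: dis_eq (disM (dis_cst a v x) h) _.
by rewrite mulr0 addr0.
Qed.

Lemma dis_comp (phi : R -> R) f v x d d' : is_derive (f x) 1 phi d' -> dis f v x d ->
  dis (fun y => phi (f y)) v x (d' * d).
Proof.
move=> hp h; apply: (@is_derive1_comp R phi (fun t => f (x + t *: v))) => //.
by rewrite scale0r addr0.
Qed.

Lemma dis_affine f v x (d : R) : (forall t : R, f (x + t *: v) = f x + t * d) -> dis f v x d.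
Proof.
move=> H; rewrite /dis (_ : (fun t => _) = (fun t => f x + t * d)); last exact/funext.
have h := is_deriveD (is_derive_cst (f x) (0 : R) 1) (is_deriveM (is_derive_id (0 : R) 1) (is_derive_cst d (0 : R) 1)).
by apply: (is_derive_eq h); rewrite scale0r !add0r [_ *: _]mulr1.
Qed.

Lemma dis_near f g v x d (r : R) : 0 < r ->
  (forall t : R, `|t| < r -> f (x + t *: v) = g (x + t *: v)) -> dis f v x d -> dis g v x d.
Proof.
move=> r0 H h; apply: near_eq_is_derive h.
apply/nbhs_ballP; exists r => // t; rewrite /ball /= sub0r normrN.
exact: H.
Qed.

(** The last direction of the list is differentiated first, which is why later inductions run on the
    end of the list. *)
Lemma iter_dder_rcons f vs v : iter_dder f (rcons vs v) = iter_dder (dder f v) vs.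
Proof. by elim: vs => //= w vs ->. Qed.

End DirectionalDerivative.

Section SmoothClass.
Context {R : realType} {V : lmodType R}.
Variables (dist : V -> V -> R) (sz : V -> R).
Implicit Types (f g : V -> R) (x v : V).

Definition contd f := forall x (e : R), 0 < e -> exists2 d : R, 0 < d &
  forall y, dist x y < d -> `|f y - f x| < e.
Definition lbdd f := forall r : R, exists C : R, forall x, sz x <= r -> `|f x| <= C.

Lemma contd_cst c : contd (fun=> c).
Proof. by move=> x e e0; exists 1 => // y _; rewrite subrr normr0. Qed.

Lemma contdD f g : contd f -> contd g -> contd (fun x => f x + g x).
Proof.
move=> cf cg x e e0; have e2 : 0 < e / 2 by rewrite divr_gt0.
have [d1 d10 H1] := cf x _ e2; have [d2 d20 H2] := cg x _ e2.
exists (Num.min d1 d2); first by rewrite lt_min d10.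
move=> y; rewrite lt_min => /andP[y1 y2].
have := H1 _ y1; have := H2 _ y2; have := ler_normD (f y - f x) (g y - g x).
by rewrite opprD addrACA; lra.
Qed.

Lemma contd_comp (phi : R -> R) f : (forall x, {for f x, continuous phi}) ->
  contd f -> contd (fun x => phi (f x)).
Proof.
move=> cp cf x e e0; have /cvgrPdist_lt/(_ e e0)/nbhs_ballP[d d0 H] := cp x.
have [d' d'0 H'] := cf x d d0; exists d' => // y xy.
by rewrite distrC; apply: H; rewrite /ball /= distrC; exact: H'.
Qed.

Lemma contdM f g : contd f -> contd g -> contd (fun x => f x * g x).
Proof.
move=> cf cg x e e0.
pose K := `|f x| + `|g x| + 1; have K0 : 0 < K by rewrite ltr_wpDl// addr_ge0.
have e2 : 0 < Num.min 1 (e / (3 * K)) by rewrite lt_min ltr01 divr_gt0// mulr_gt0.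
have [d1 d10 H1] := cf x _ e2; have [d2 d20 H2] := cg x _ e2.
exists (Num.min d1 d2); first by rewrite lt_min d10.
move=> y; rewrite lt_min => /andP[/H1 + /H2]; rewrite !lt_min => /andP[a1 a2] /andP[b1 b2].
have -> : f y * g y - f x * g x =
  (f y - f x) * (g y - g x) + f x * (g y - g x) + g x * (f y - f x) by ring.
set a := f y - f x in a1 a2 *; set b := g y - g x in b1 b2 *.
have fx := normr_ge0 (f x); have gx := normr_ge0 (g x).
have a0 := normr_ge0 a; have b0 := normr_ge0 b.
apply: le_lt_trans (_ : `|a| * 1 + `|f x| * `|b| + `|g x| * `|a| < _).
  apply: le_trans (ler_normD _ _) _; rewrite !normrM lerD2r.
  apply: le_trans (ler_normD _ _) _; rewrite !normrM lerD2r.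
  by rewrite ler_wpM2l// ltW.
have E : e = K * (e / (3 * K)) + K * (e / (3 * K)) + K * (e / (3 * K)).
  by field; rewrite gt_eqF.
rewrite E; set z := e / (3 * K) in a2 b2 *; have z0 : 0 < z by apply: le_lt_trans a2.
have q1 : `|a| * 1 < K * z by rewrite mulr1 /K; nra.
have q2 : `|f x| * `|b| < K * z by rewrite /K; nra.
have q3 : `|g x| * `|a| < K * z by rewrite /K; nra.
lra.
Qed.

Lemma lbdd_cst c : lbdd (fun=> c).
Proof. by move=> r; exists `|c|. Qed.

Lemma lbddD f g : lbdd f -> lbdd g -> lbdd (fun x => f x + g x).
Proof.
move=> bf bg r; have [C HC] := bf r; have [D HD] := bg r; exists (C + D) => x xr.
by apply: le_trans (ler_normD _ _) _; rewrite lerD ?HC ?HD.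
Qed.

Lemma lbddM f g : lbdd f -> lbdd g -> lbdd (fun x => f x * g x).
Proof.
move=> bf bg r; have [C HC] := bf r; have [D HD] := bg r; exists (C * D) => x xr.
by rewrite normrM ler_pM ?HC ?HD.
Qed.

Lemma lbdd_comp (phi : R -> R) f : continuous phi -> lbdd f -> lbdd (fun x => phi (f x)).
Proof.
move=> cp bf r; have [C HC] := bf r.
have : bounded_set (phi @` `[(- C), C])%classic.
  apply: compact_bounded; apply: continuous_compact; last exact: segment_compact.
  exact: continuous_subspaceT.
move=> [M [_ HM]]; exists (M + 1) => x xr.
apply: (HM (M + 1)); first by rewrite ltrDl.
by exists (f x) => //=; rewrite in_itv /= -ler_norml HC.
Qed.

(** Besides continuity and derivatives, boundedness on sublevels of [sz] is carried along: it later
    bounds the derivatives on the region where the potential differs from its outer part. *)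
Fixpoint cls (N : nat) f : Prop := [/\ contd f, lbdd f &
  if N is N'.+1 then (forall x v, dderivable f v x) /\ (forall v, cls N' (dder f v)) else True].

Lemma cls_contd N f : cls N f -> contd f. Proof. by case: N => [|N] []. Qed.
Lemma cls_lbdd N f : cls N f -> lbdd f. Proof. by case: N => [|N] []. Qed.

Lemma clsW N f : cls N.+1 f -> cls N f.
Proof.
elim: N f => [|N IH] f [cf bf [df Df]]; first by split.
by split => //; split => // v; exact: IH.
Qed.

Lemma cls_dis N f v x : cls N.+1 f -> dis f v x (dder f v x).
Proof. by move=> [_ _ [df _]]; exact: dderivable_dis. Qed.

Lemma cls_dder N f v : cls N.+1 f -> cls N (dder f v).
Proof. by move=> [_ _ [_ H]]; exact: H. Qed.

Lemma clsS N f (f' : V -> V -> R) : contd f -> lbdd f ->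
  (forall x v, dis f v x (f' v x)) -> (forall v, cls N (f' v)) -> cls N.+1 f.
Proof.
move=> cf bf df cf'; split => //; split => [x v|v]; first exact: dis_dderivable (df x v).
rewrite (_ : dder f v = f' v)//; apply/funext => x; exact: dis_dder.
Qed.

Lemma cls_cst N c : cls N (fun=> c).
Proof.
elim: N c => [|N IH] c; first by split => //; [exact: contd_cst|exact: lbdd_cst].
apply: (clsS (contd_cst c) (lbdd_cst c) (f' := fun _ _ => 0)) => [x v|v]; last exact: IH.
exact: dis_cst.
Qed.

Lemma clsD N f g : cls N f -> cls N g -> cls N (fun x => f x + g x).
Proof.
elim: N f g => [|N IH] f g.
  by move=> [cf bf _] [cg bg _]; split; [exact: contdD|exact: lbddD|].
move=> hf hg; apply: (clsS (f' := fun v x => dder f v x + dder g v x)).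
- by apply: contdD; [exact: cls_contd hf|exact: cls_contd hg].
- by apply: lbddD; [exact: cls_lbdd hf|exact: cls_lbdd hg].
- by move=> x v; apply: disD; [exact: cls_dis hf|exact: cls_dis hg].
- by move=> v; apply: IH; exact: cls_dder.
Qed.

Lemma clsM N f g : cls N f -> cls N g -> cls N (fun x => f x * g x).
Proof.
elim: N f g => [|N IH] f g.
  by move=> [cf bf _] [cg bg _]; split; [exact: contdM|exact: lbddM|].
move=> hf hg; apply: (clsS (f' := fun v x => f x * dder g v x + g x * dder f v x)).
- by apply: contdM; [exact: cls_contd hf|exact: cls_contd hg].
- by apply: lbddM; [exact: cls_lbdd hf|exact: cls_lbdd hg].
- by move=> x v; apply: disM; [exact: cls_dis hf|exact: cls_dis hg].
- by move=> v; apply: clsD; (apply: IH; [exact: clsW|exact: cls_dder]).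
Qed.

Lemma clsZ N c f : cls N f -> cls N (fun x => c * f x).
Proof. by move=> hf; apply: clsM => //; exact: cls_cst. Qed.

Lemma clsB N f g : cls N f -> cls N g -> cls N (fun x => f x - g x).
Proof.
move=> hf hg; rewrite (_ : (fun x => _) = fun x => f x + -1 * g x).
  by apply: clsD => //; exact: clsZ.
by apply/funext => x; rewrite mulN1r.
Qed.

Lemma cls_sum N (I : finType) (f : I -> V -> R) :
  (forall i, cls N (f i)) -> cls N (fun x => \sum_i f i x).
Proof.
move=> H; elim: (index_enum I) => [|i s IH].
  rewrite (_ : (fun y => _) = fun=> 0); first exact: cls_cst.
  by apply/funext => y; rewrite big_nil.
rewrite (_ : (fun y => _) = fun y => f i y + \sum_(j <- s) f j y).
  exact: clsD.
by apply/funext => y; rewrite big_cons.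
Qed.

Lemma cls_comp N (phi : R -> R) f : C1D N phi -> cls N f -> cls N (fun x => phi (f x)).
Proof.
elim: N phi f => [|N IH] phi f.
  move=> cp [cf bf _]; split => //; last exact: lbdd_comp.
  by apply: contd_comp => // x; exact: cp.
move=> cp hf; have cph := C1D_continuous cp; case: (cp) => phi' dp cp'.
apply: (clsS (f' := fun v x => phi' (f x) * dder f v x)).
- by apply: contd_comp; [move=> x; exact: cph|exact: cls_contd hf].
- by apply: lbdd_comp => //; exact: cls_lbdd hf.
- by move=> x v; apply: dis_comp (dp _) _; exact: cls_dis hf.
- by move=> v; apply: clsM; [apply: IH => //; exact: clsW|exact: cls_dder].
Qed.

Lemma rsqrt_derive (s : R) : 0 < s ->
  is_derive s 1 (fun s => (Num.sqrt s)^-1) (- 2^-1 * (Num.sqrt s)^-1 ^+ 3).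
Proof.
move=> s0; have q0 : 0 < Num.sqrt s by rewrite sqrtr_gt0.
apply: (is_derive_eq (@is_deriveV R Num.sqrt s _ 1 _ (is_derive1_sqrt s0))).
  by rewrite gt_eqF.
by rewrite -[_ *: _]/(_ * _); field; rewrite gt_eqF.
Qed.

(** The derivative of f^(-1/2) is a product of three copies of itself and of f', so the induction
    closes; the square root is then f times f^(-1/2). *)
Lemma cls_rsqrt N f : (forall x, 1 <= f x) -> cls N f ->
  cls N (fun x => (Num.sqrt (f x))^-1).
Proof.
move=> f1; have f0 x : 0 < f x by exact: lt_le_trans (f1 x).
have ch : contd f -> contd (fun x => (Num.sqrt (f x))^-1).
  move=> cf; apply: (contd_comp (phi := fun s => (Num.sqrt s)^-1)) => // x.
  exact: is_derive_continuous (rsqrt_derive (f0 x)).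
have bh : lbdd (fun x => (Num.sqrt (f x))^-1).
  move=> r; exists 1 => x _; rewrite ger0_norm ?invr_ge0 ?sqrtr_ge0//.
  by rewrite invf_le1 ?sqrtr_gt0// -[leLHS]sqrtr1 ler_wsqrtr.
elim: N => [[cf _ _]|N IH hf]; first by split => //; exact: ch.
apply: (clsS (f' := fun v x => (- 2^-1 * ((Num.sqrt (f x))^-1 *
   ((Num.sqrt (f x))^-1 * (Num.sqrt (f x))^-1))) * dder f v x)).
- by apply: ch; exact: cls_contd hf.
- exact: bh.
- move=> x v; have := dis_comp (phi := fun s => (Num.sqrt s)^-1) (rsqrt_derive (f0 x)) (cls_dis v x hf).
  by move=> h; apply: (dis_eq h); rewrite exprS expr2.
- move=> v; apply: clsM; last exact: cls_dder.
  have r := IH (clsW hf); apply: clsZ; apply: clsM => //; exact: clsM.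
Qed.

Lemma cls_sqrt N f : (forall x, 1 <= f x) -> cls N f -> cls N (fun x => Num.sqrt (f x)).
Proof.
move=> f1 hf; rewrite (_ : (fun x => _) = fun x => f x * (Num.sqrt (f x))^-1).
  by apply: clsM => //; exact: cls_rsqrt.
apply/funext => x; have f0 : 0 < f x by exact: lt_le_trans (f1 x).
by rewrite -[X in _ = X / _](sqr_sqrtr (ltW f0)) expr2 mulfK// gt_eqF// sqrtr_gt0.
Qed.

Lemma cls_affine N f (d : V -> R) : contd f -> lbdd f ->
  (forall x v (t : R), f (x + t *: v) = f x + t * d v) -> cls N f.
Proof.
move=> cf bf H; case: N => [|N]; first by split.
apply: (clsS (f' := fun v _ => d v)) => // [x v|v]; last exact: cls_cst.
by apply: dis_affine => t; exact: H.
Qed.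

Lemma cls_iter f vs : (forall N, cls N f) -> forall N, cls N (iter_dder f vs).
Proof.
elim/last_ind: vs f => [|vs v IH] f hf //.
by rewrite iter_dder_rcons; apply: IH => N; exact: cls_dder.
Qed.

Lemma cls_smooth_wrt f : (forall N, cls N f) -> smooth_wrt dist f.
Proof.
move=> hf vs; have h := cls_iter vs hf; split.
  by move=> x v; have [_ _ [H _]] := h 1%N; exact: H.
exact: cls_contd (h 0%N).
Qed.

Lemma iter_dderD f g vs : (forall N, cls N f) -> (forall N, cls N g) ->
  iter_dder (fun x => f x + g x) vs = (fun x => iter_dder f vs x + iter_dder g vs x).
Proof.
move=> hf hg; elim: vs => //= v vs ->; apply/funext => x; apply: dis_dder.
by apply: disD; [exact: (cls_dis _ _ (cls_iter vs hf 1%N))|exact: (cls_dis _ _ (cls_iter vs hg 1%N))].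
Qed.

End SmoothClass.

(** * The potential *)

Section Convexity.
Context {R : realType} {X : lmodType R}.

Definition cvx (g : X -> R) := forall x y (l : R), 0 <= l <= 1 ->
  g (l *: x + (1 - l) *: y) <= l * g x + (1 - l) * g y.

(** The function (s, t) |-> s + soft_plus(t - s) is convex, and nondecreasing in each variable
    because the slope of [soft_plus] lies in [0, 1]. *)
Lemma cvx_soft_max (u v : X -> R) : cvx u -> cvx v -> cvx (fun x => u x + soft_plus (v x - u x)).
Proof.
move=> cu cv x y l l01; set z := l *: x + _.
have hu := cu x y l l01; have hv := cv x y l l01; rewrite -/z in hu hv.
set U := _ + _ in hu; set W := _ + _ in hv.
have h1 : v z - U <= v z - u z by lra.
have h2 : v z - U <= W - U by lra.
have /andP[_ k1] := soft_plus_lip h1; have /andP[k2 _] := soft_plus_lip h2.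
have k3 := soft_plus_convex (v x - u x) (v y - u y) l01.
have E : l * (v x - u x) + (1 - l) * (v y - u y) = W - U by rewrite /W /U; ring.
by rewrite E in k3; rewrite /U /W in k1 k2 k3 *; lra.
Qed.

(** The Euclidean norm is convex, and nondecreasing on pairs of nonnegative numbers. *)
Lemma cvx_sqrt_sum (u w : X -> R) : (forall x, 0 <= u x) -> (forall x, 0 <= w x) ->
  cvx u -> cvx w -> cvx (fun x => Num.sqrt (u x ^+ 2 + w x ^+ 2)).
Proof.
move=> u0 w0 cu cw x y l /[dup] l01 /andP[l0 l1]; have l1' : 0 <= 1 - l by lra.
have hu := cu x y l l01; have hw := cw x y l l01.
have scal (c a b : R) : 0 <= c -> Num.sqrt ((c * a) ^+ 2 + (c * b) ^+ 2) =
    c * Num.sqrt (a ^+ 2 + b ^+ 2).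
  move=> c0; rewrite !exprMn -mulrDr sqrtrM ?sqr_ge0// sqrtr_sqr ger0_norm//.
rewrite -!scal//; apply: le_trans (minkowski2 _ _ _ _).
by rewrite ler_wsqrtr// lerD// lerXn2r ?nnegrE ?addr_ge0 ?mulr_ge0.
Qed.

End Convexity.

(* Heights for which each quadratic [Qf k] exceeds the other four by a margin
   at its own centre; see [Qf_gap]. *)
Local Open Scope Z_scope.
Definition fvalZ (k : nat) : Z := nth 0 [:: -345; -240; 31; 422; 0] k.
Local Close Scope Z_scope.

Section Potential.
Context {R : realType} (m : nat).
Local Notation n := m.+2.
Local Notation Mat := 'M[R]_(2, n).
Local Notation h k := (@zr R (sd_h (step_at k))).
Local Notation c k := (@zr R (sd_c (step_at k))).

Definition sqn (A : Mat) : R := \sum_i \sum_j A i j * A i j.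
Definition ip (A B : Mat) : R := \sum_i \sum_j A i j * B i j.

Lemma sqnE A : sqn A = frob A ^+ 2.
Proof. by rewrite frob_sqr; do 2![apply: eq_bigr => ? _]; rewrite expr2. Qed.

Lemma sqn_ge0 A : 0 <= sqn A. Proof. by rewrite sqnE sqr_ge0. Qed.

Lemma ip_le A B : ip A B <= frob A * frob B.
Proof.
rewrite /ip /frob !pair_big /=.
exact: (cauchy_schwarz (fun p : 'I_2 * 'I_n => A p.1 p.2) (fun p => B p.1 p.2)).
Qed.

Lemma ip_linear A (a : R) u v : ip A (a *: u + v) = a * ip A u + ip A v.
Proof.
rewrite /ip mulr_sumr -big_split /=; apply: eq_bigr => i _.
by rewrite mulr_sumr -big_split /=; apply: eq_bigr => j _; rewrite !mxE; ring.
Qed.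

Lemma sqn_segment (A B : Mat) (l : R) :
  sqn (l *: A + (1 - l) *: B) = l * sqn A + (1 - l) * sqn B - l * (1 - l) * sqn (A - B).
Proof.
rewrite /sqn !mulr_sumr -big_split -sumrB; apply: eq_bigr => i _ /=.
rewrite !mulr_sumr -big_split -sumrB; apply: eq_bigr => j _ /=.
by rewrite !mxE; ring.
Qed.

Definition fval (k : nat) : R := zr (fvalZ k).
(** From det(A - Abar) = det A - det Abar - cof(Abar) : (A - Abar): the linear part of c det(A -
    Abar) is merged with Bbar, and the rest of it is affine in delta. *)
Definition beta k : Mat := Bbar m k - c k *: cofm (Abar m k).

Definition Qf k (A : Mat) (d : R) : R :=
  fval k + ip (beta k) (A - Abar m k) + c k * (d - det2 (Abar m k))
  + h k / 2 * sqn (A - Abar m k).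

Definition gauge (A : Mat) (d : R) : R := 1 + sqn A + d * d.

(* [4] and [61] dominate [h / 2] and [|c|] for all five quadratics. *)
Definition outer (K : R) (A : Mat) (d : R) : R :=
  4 * sqn A + 61 * Num.sqrt (gauge A d) - K.

Fixpoint chain (K : R) (k : nat) (A : Mat) (d : R) : R :=
  if k is k'.+1 then chain K k' A d + soft_plus (Qf k' A d - chain K k' A d)
  else outer K A d.

Lemma gauge_ge1 A d : 1 <= gauge A d.
Proof. by rewrite /gauge -addrA lerDl addr_ge0 ?sqn_ge0// -expr2 sqr_ge0. Qed.

Section ClassMembership.
Context {V : lmodType R} (dist : V -> V -> R) (sz : V -> R) (a : V -> Mat) (d : V -> R).
Hypotheses (ha : forall N i j, cls dist sz N (fun x => a x i j))
  (hd : forall N, cls dist sz N d).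
Local Notation cl := (cls dist sz).

Lemma cls_sqn_shift N B : cl N (fun x => sqn (a x - B)).
Proof.
apply: cls_sum => i; apply: cls_sum => j.
suff hb : cl N (fun x => (a x - B) i j) by exact: clsM.
rewrite (_ : (fun x => _) = fun x => a x i j - B i j); last by apply/funext => x; rewrite !mxE.
by apply: clsB; [exact: ha|exact: cls_cst].
Qed.

Lemma cls_sqn N : cl N (fun x => sqn (a x)).
Proof.
have := cls_sqn_shift N 0; rewrite (_ : (fun x => _) = fun x => sqn (a x)) //.
by apply/funext => x; rewrite subr0.
Qed.

Lemma cls_gauge N : cl N (fun x => gauge (a x) (d x)).
Proof.
apply: clsD; last by apply: clsM; exact: hd.
by apply: clsD; [exact: cls_cst|exact: cls_sqn].
Qed.

Lemma cls_outer K N : cl N (fun x => outer K (a x) (d x)).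
Proof.
apply: clsB; last exact: cls_cst.
apply: clsD; apply: clsZ; first exact: cls_sqn.
by apply: cls_sqrt; [move=> x; exact: gauge_ge1|exact: cls_gauge].
Qed.

Lemma cls_Qf k N : cl N (fun x => Qf k (a x) (d x)).
Proof.
apply: clsD; last by apply: clsZ; exact: cls_sqn_shift.
apply: clsD; last by apply: clsZ; apply: clsB; [exact: hd|exact: cls_cst].
apply: clsD; first exact: cls_cst.
apply: cls_sum => i; apply: cls_sum => j; apply: clsZ.
rewrite (_ : (fun x => _) = fun x => a x i j - Abar m k i j).
  by apply: clsB; [exact: ha|exact: cls_cst].
by apply/funext => x; rewrite [LHS]mxE [X in _ + X]mxE.
Qed.

(** The maps [a] and [d] are left abstract so that this covers both the function on pairs (A, delta)
    and its composition with A |-> (A, det A). *)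
Lemma cls_chain K k N : cl N (fun x => chain K k (a x) (d x)).
Proof.
elim: k => [|k IH]; first exact: cls_outer.
apply: clsD => //; apply: cls_comp; first exact: soft_plus_C1D.
by apply: clsB => //; exact: cls_Qf.
Qed.

End ClassMembership.

Definition Gpot (K : R) (x : Mat * R^o) : R := chain K 5 x.1 x.2 - 2^-1 * sqn x.1.
Definition Fpot (K : R) (A : Mat) : R := chain K 5 A (det2 A).

Lemma h_ge1 k : (k < 5)%N -> 1 <= h k.
Proof. by case: k => [|[|[|[|[|k]]]]] // _; rewrite /= ?zrE; lra. Qed.

(** In (A, d) everything is affine except (h/2) |A - Abar|^2, and h >= 1 leaves a convex remainder
    after subtracting |A|^2 / 2. *)
Lemma cvx_Qf k : (k < 5)%N ->
  cvx (fun x : (Mat * R^o)%type => Qf k x.1 x.2 - 2^-1 * sqn x.1).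
Proof.
move=> k5 x y l /andP[l0 l1]; set z := l *: x + _.
have z1 : z.1 = l *: x.1 + (1 - l) *: y.1 by [].
have z2 : z.2 = l * x.2 + (1 - l) * y.2 by [].
have zs : z.1 - Abar m k = l *: (x.1 - Abar m k) + (1 - l) *: (y.1 - Abar m k).
  rewrite z1 !scalerBr addrACA -opprD -scalerDl; congr (_ - _).
  by rewrite addrC subrK scale1r.
have E : (x.1 - Abar m k) - (y.1 - Abar m k) = x.1 - y.1.
  by rewrite opprB addrA subrK.
rewrite /Qf zs z2 z1 !sqn_segment E.
have -> : ip (beta k) (l *: (x.1 - Abar m k) + (1 - l) *: (y.1 - Abar m k)) =
    l * ip (beta k) (x.1 - Abar m k) + (1 - l) * ip (beta k) (y.1 - Abar m k).
  rewrite [LHS]ip_linear; congr (_ + _).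
  by have := ip_linear (beta k) (1 - l) (y.1 - Abar m k) 0; rewrite addr0 => ->;
    rewrite (_ : ip (beta k) 0 = 0) ?addr0// /ip big1// => i _; rewrite big1// => j _; rewrite [X in _ * X]mxE mulr0.
have := sqn_ge0 (x.1 - y.1); have := h_ge1 k5; have : 0 <= l * (1 - l) by rewrite mulr_ge0// subr_ge0.
move: (ip _ _) (ip _ _) (sqn _) (sqn _) (sqn x.1) (sqn y.1) (sqn (x.1 - y.1)) (det2 _) => i1 i2 s1 s2 s3 s4 ss dt.
move: (l * (1 - l)) (h k) (c k) (fval k) (x.2 : R) (y.2 : R) => ll hh cc ff x2 y2 a1 a2 a3.
have : 0 <= ll * ((hh - 1) * ss) by apply: mulr_ge0 a1 _; apply: mulr_ge0; rewrite ?subr_ge0.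
rewrite -subr_ge0 => H; rewrite -subr_ge0; set E' := (X in _ <= X).
suff -> : E' = 2^-1 * (ll * ((hh - 1) * ss)) by rewrite mulr_ge0// -subr_ge0.
by rewrite /E'; field.
Qed.

(** The square root is the norm of (1, |(A, d)|), obtained by applying the norm lemma twice, and 4 -
    1/2 is nonnegative. *)
Lemma cvx_outer K : cvx (fun x : (Mat * R^o)%type => outer K x.1 x.2 - 2^-1 * sqn x.1).
Proof.
have cf : cvx (fun x : (Mat * R^o)%type => frob x.1).
  move=> x y l /andP[l0 l1]; apply: le_trans (frobD _ _) _.
  by rewrite !frobZ (ger0_norm l0) ger0_norm ?subr_ge0.
have ca : cvx (fun x : (Mat * R^o)%type => `|x.2|).
  move=> x y l /andP[l0 l1]; apply: le_trans (ler_normD _ _) _.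
  by rewrite !normrM (ger0_norm l0) (@ger0_norm _ (1 - l)) ?subr_ge0.
have cN := cvx_sqrt_sum (fun x => frob_ge0 x.1) (fun x => normr_ge0 x.2) cf ca.
have c1 : cvx (fun _ : (Mat * R^o)%type => 1) by move=> x y l _; lra.
have cS := cvx_sqrt_sum (fun _ => ler01) (fun x => sqrtr_ge0 _) c1 cN.
move=> x y l /[dup] l01 /andP[l0 l1]; have {cS} := cS x y l l01.
have SE (z : (Mat * R^o)%type) : Num.sqrt (1 ^+ 2 + Num.sqrt (frob z.1 ^+ 2 + `|z.2| ^+ 2) ^+ 2)
   = Num.sqrt (gauge z.1 z.2).
  rewrite sqr_sqrtr ?addr_ge0 ?sqr_ge0// /gauge sqnE real_normK ?num_real//.
  by rewrite expr1n addrA expr2.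
rewrite !SE /outer; set z := l *: x + _.
have z1 : z.1 = l *: x.1 + (1 - l) *: y.1 by [].
rewrite z1 sqn_segment; have := sqn_ge0 (x.1 - y.1).
have : 0 <= l * (1 - l) by rewrite mulr_ge0// subr_ge0.
move: (Num.sqrt _) (Num.sqrt _) (Num.sqrt _) (sqn x.1) (sqn y.1) (sqn (x.1 - y.1)) => r1 r2 r3 s1 s2 s3.
move: (l * (1 - l)) => ll h1 h2 h3.
have : 0 <= ll * s3 by exact: mulr_ge0 h1 h2.
nra.
Qed.

Lemma Gpot_convex K : convexMR (Gpot K).
Proof.
suff H k : (k <= 5)%N -> cvx (fun x : (Mat * R^o)%type => chain K k x.1 x.2 - 2^-1 * sqn x.1).
  by move=> x y l l01; exact: H.
elim: k => [_|k IH k5]; first exact: cvx_outer.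
(* The smooth maximum commutes with subtracting a common function, since only differences enter
   [soft_plus]. *)
have := cvx_soft_max (IH (ltnW k5)) (cvx_Qf k5).
congr cvx; apply/funext => x /=; rewrite addrAC; congr (_ - _); congr (_ + soft_plus _).
by rewrite opprB addrA subrK.
Qed.

End Potential.

(** * Smoothness of the potential and the integer values of the quadratics at the centres *)

Section Gluing.
Context {R : realType} (m : nat).
Local Notation n := m.+2.
Local Notation Mat := 'M[R]_(2, n).
Local Notation h k := (@zr R (sd_h (step_at k))).
Local Notation c k := (@zr R (sd_c (step_at k))).
Local Notation col1 := (col1 m).

Lemma entryE (A : Mat) (i : 'I_2) (j : 'I_n) : entry A i j = A i j.
Proof.
rewrite /entry (bigD1 i)//= (bigD1 j)//= !eqxx /= big1 => [|k /negbTE kj].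
  rewrite big1 ?addr0// => k /negbTE ki; rewrite big1// => l _.
  by rewrite (_ : (k == i :> nat) = false).
by rewrite (_ : (k == j :> nat) = false).
Qed.

Lemma det2E (A : Mat) : det2 A = A ord0 ord0 * A row1 col1 - A ord0 col1 * A row1 ord0.
Proof. by rewrite /det2 -!entryE. Qed.

Section Coordinates.
Context {V : lmodType R} (dist : V -> V -> R) (sz : V -> R) (f : V -> R) (N : nat).
Hypotheses (f_lip : forall x y, `|f y - f x| <= dist x y) (f_sz : forall x, `|f x| <= sz x)
  (f_lin : forall (t : R) x v, f (x + t *: v) = f x + t * f v).

Lemma cls_coordinate : cls dist sz N f.
Proof.
apply: (@cls_affine R V dist sz N f f) => [x e e0|r|//].
  by exists e => // y; apply: le_lt_trans.
by exists r => x; apply: le_trans.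
Qed.
End Coordinates.

Definition szMR (x : Mat * R^o) : R := frob x.1 + `|x.2 : R|.

Lemma cls_entry N i j : cls (@distM R n) (@frob R n) N (fun A => A i j).
Proof.
refine (cls_coordinate N _ _ _) => [x y|x|t x v].
- by rewrite (_ : y i j - x i j = (y - x) i j) ?entry_le_frob// !mxE.
- exact: entry_le_frob.
- by rewrite !mxE.
Qed.

Lemma cls_det2 N : cls (@distM R n) (@frob R n) N (@det2 R n).
Proof.
have h := cls_entry N.
have := clsB (clsM (h ord0 ord0) (h row1 col1)) (clsM (h ord0 col1) (h row1 ord0)).
by congr cls; apply/funext => A; rewrite det2E.
Qed.

Lemma cls_entryMR N i j : cls (@distMR R n) szMR N (fun x => x.1 i j).
Proof.
refine (cls_coordinate N _ _ _) => [x y|x|t x v].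
- rewrite (_ : y.1 i j - x.1 i j = (y.1 - x.1) i j); last by rewrite !mxE.
  apply: le_trans (entry_le_frob _ _ _) _; rewrite -[leLHS]ger0_norm ?frob_ge0//.
  by rewrite -sqrtr_sqr ler_wsqrtr// lerDl sqr_ge0.
- by apply: le_trans (entry_le_frob _ _ _) _; rewrite lerDl.
- by rewrite !mxE.
Qed.

Lemma cls_scalarMR N : cls (@distMR R n) szMR N (fun x => x.2 : R).
Proof.
refine (cls_coordinate N _ _ _) => [x y|x|t x v].
- by rewrite -sqrtr_sqr ler_wsqrtr// lerDr sqr_ge0.
- by rewrite lerDr frob_ge0.
- by [].
Qed.

Lemma Gpot_smooth K : smooth_wrt (@distMR R n) (@Gpot R m K).
Proof.
apply: (cls_smooth_wrt (sz := szMR)) => N; apply: clsB.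
  by apply: cls_chain => *; [exact: cls_entryMR|exact: cls_scalarMR].
apply: clsZ; apply: cls_sqn => *; exact: cls_entryMR.
Qed.

Lemma cls_Fpot K N : cls (@distM R n) (@frob R n) N (@Fpot R m K).
Proof. by apply: cls_chain => *; [exact: cls_entry|exact: cls_det2]. Qed.

Lemma FpotE K (A : Mat) : Fpot K A = 1 / 2 * frob A ^+ 2 + Gpot K (A, det2 A).
Proof.
have -> : Gpot K (A, det2 A) = Fpot K A - 2^-1 * sqn A by [].
by rewrite -sqnE; move: (Fpot K A) => F; ring.
Qed.

Lemma grad_Fpot_continuous K : Defs.continuousM (grad (@Fpot R m K)).
Proof.
pose d i j := dder (@Fpot R m K) (delta_mx i j : Mat).
move=> x e e0.
have : forall p : 'I_2 * 'I_n, exists r : R, 0 < r /\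
    forall y, frob (y - x) < r -> `|d p.1 p.2 y - d p.1 p.2 x| < e / (2 * n)%:R.
  move=> [i j]; have h := cls_contd (cls_dder (delta_mx i j) (cls_Fpot K 1)).
  have [|r r0 H] := h x (e / (2 * n)%:R); first by rewrite divr_gt0// ltr0n muln_gt0.
  by exists r.
move=> /choice[r Hr]; pose rm := \big[Num.min/1]_p r p.
have rm0 : 0 < rm by apply: lt_bigmin => // p _; case: (Hr p).
exists rm => // y yx; apply: le_lt_trans (frob_le_sum _) _.
have H p : `|d p.1 p.2 y - d p.1 p.2 x| < e / (2 * n)%:R.
  by case: (Hr p) => _; apply; apply: lt_le_trans yx _; exact: bigmin_le.
rewrite pair_big /=.
apply: (@lt_le_trans _ _ (\sum_(p : 'I_2 * 'I_n) e / (2 * n)%:R)).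
  apply: ltr_sum => [|p _]; last by rewrite !mxE; exact: H.
  by apply/hasP; exists (ord0, ord0) => //; rewrite mem_index_enum.
by rewrite sumr_const card_prod !card_ord -[leLHS]mulr_natl mulrCA mulfV ?mulr1.
Qed.

Section IntegerCores.
Local Open Scope Z_scope.

Definition cenA (k : nat) (i j : bool) : Z :=
  nth 0 (match i, j with
         | false, false => [:: -2; 1; 2; 5; -3]
         | false, true => [:: 4; 0; 3; -2; 0]
         | true, false => [:: -4; 0; -3; 2; 0]
         | true, true => [:: 8; 2; 1; -2; 0]
         end) k.
Definition cenB (k : nat) (i j : bool) : Z :=
  nth 0 (match i, j with
         | false, false => [:: 176; -36; 80; -53; 0]
         | false, true => [:: 88; -80; -72; -151; 98]
         | true, false => [:: -160; -204; -18; 80; 0]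
         | true, true => [:: -80; -164; -226; -4; 84]
         end) k.

(** Twice the value of a quadratic, written out in the 2 by 2 cores; doubling clears h/2 and keeps
    the comparison in integers. *)
Definition double_Q (f h c : Z) (A A0 B : bool -> bool -> Z) : Z :=
  2 * f
  + 2 * ((B false false - c * A0 true true) * (A false false - A0 false false)
         + (B false true + c * A0 true false) * (A false true - A0 false true)
         + (B true false + c * A0 false true) * (A true false - A0 true false)
         + (B true true - c * A0 false false) * (A true true - A0 true true))
  + 2 * c * (A false false * A true true - A false true * A true false
             - (A0 false false * A0 true true - A0 false true * A0 true false))
  + h * ((A false false - A0 false false) * (A false false - A0 false false)
         + (A false true - A0 false true) * (A false true - A0 false true)
         + (A true false - A0 true false) * (A true false - A0 true false)
         + (A true true - A0 true true) * (A true true - A0 true true)).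

End IntegerCores.

Definition zcore (A : bool -> bool -> Z) : Mat :=
  core m (zr (A false false)) (zr (A false true)) (zr (A true false)) (zr (A true true)).

Lemma Abar_core k : (k < 5)%N -> Abar m k = zcore (cenA k).
Proof.
move=> k5; apply/matrixP; apply: row_ind; apply: col_ind => [||j];
case: k k5 => [|[|[|[|[|k]]]]] // _;
rewrite /Abar /piA ?big_ord_recr big_ord0 /Cgam1 /zcore /core !mxE /= ?zrE; lra.
Qed.

Lemma Bbar_core k : (k < 5)%N -> Bbar m k = zcore (cenB k).
Proof.
move=> k5; apply/matrixP; apply: row_ind; apply: col_ind => [||j];
case: k k5 => [|[|[|[|[|k]]]]] // _;
rewrite /Bbar /piB ?big_ord_recr big_ord0 /Cgam2 /zcore /core !mxE /= ?zrE; lra.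
Qed.

Lemma sum_rows (F : 'I_2 -> R) : \sum_i F i = F ord0 + F row1.
Proof. by rewrite !big_ord_recl big_ord0 addr0. Qed.

Lemma Qf_double j k : (j < 5)%N -> (k < 5)%N ->
  2 * Qf k (@Abar R m j) (det2 (Abar m j)) =
  zr (double_Q (fvalZ k) (sd_h (step_at k)) (sd_c (step_at k)) (cenA j) (cenA k) (cenB k)).
Proof.
move=> j5 k5; rewrite /Qf /beta /ip /sqn !det2E !Abar_core// Bbar_core//.
rewrite /double_Q !(zrD, zrB, zrM) /fval.
rewrite (_ : zr (Z.pos 2) = 2) ?zrE ?mulr1//.
move: (zr (fvalZ k)) (h k) (c k) => f hk ck.
rewrite !sum_rows !sum_cols.
do 4![rewrite big1; last by move=> l _; rewrite !mxE /= !(mulr0,mul0r,subr0,oppr0,addr0)].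
rewrite !mxE /=.
by field.
Qed.

Lemma zr_le a b : Z.leb a b -> zr a <= zr b :> R.
Proof. by move=> ab; rewrite /zr ler_int; lia. Qed.

(** Twenty integer inequalities, one for each ordered pair of centres, settled by computation. *)
Lemma Qf_gap j k : (j < 5)%N -> (k < 5)%N -> j != k ->
  Qf k (@Abar R m j) (det2 (Abar m j)) <= @fval R j - 3.
Proof.
move=> j5 k5 jk.
suff H : zr (double_Q (fvalZ k) (sd_h (step_at k)) (sd_c (step_at k)) (cenA j) (cenA k) (cenB k))
    <= zr (Z.sub (Z.mul (Zpos 2) (fvalZ j)) (Zpos 6)) :> R.
  rewrite -Qf_double// in H; rewrite zrB zrM in H; move: H; rewrite -/(@fval R j) !zrE.
  by move: (Qf _ _ _) (fval _) => q f; lra.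
apply: zr_le; move: jk.
by case: k k5 => [|[|[|[|[|k]]]]] // _; case: j j5 => [|[|[|[|[|j]]]]] // _ _; vm_compute.
Qed.

End Gluing.

(** * The potential and its gradient near the centres *)

Section LocalForm.
Context {R : realType} (m : nat).
Local Notation n := m.+2.
Local Notation Mat := 'M[R]_(2, n).
Local Notation h k := (@zr R (sd_h (step_at k))).
Local Notation c k := (@zr R (sd_c (step_at k))).
Local Notation col1 := (col1 m).

Lemma common_radius (I : finType) (T : Type) (s : T -> R) (P : I -> T -> Prop) :
  (forall i, exists2 r : R, 0 < r & forall x, s x < r -> P i x) ->
  exists2 r : R, 0 < r & forall i x, s x < r -> P i x.
Proof.
move=> H; have {H} : forall i, exists r : R, 0 < r /\ forall x, s x < r -> P i x.
  by move=> i; have [r r0 Hr] := H i; exists r.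
move=> /choice[r Hr]; exists (\big[Num.min/1]_i r i).
  by apply: lt_bigmin => // i _; case: (Hr i).
by move=> i x sx; case: (Hr i) => _; apply; apply: lt_le_trans sx _; exact: bigmin_le.
Qed.

(** Since soft_plus x <= max(0, x), the smooth maximum never exceeds the maximum. *)
Lemma chain_le K k (A : Mat) d b : outer K A d <= b ->
  (forall j, (j < k)%N -> Qf j A d <= b) -> chain K k A d <= b.
Proof.
move=> ob; elim: k => [//|k IH] H.
have h1 : chain K k A d <= b by apply: IH => j jk; apply: H; exact: ltnW.
have h2 := H k (ltnSn k).
rewrite [chain K k.+1 A d]/=; move: h1 h2; move: (chain K k A d) (Qf k A d) => u q h1 h2.
have [qu|/ltW uq] := leP (q - u) 0; first by rewrite soft_plus_le0 ?addr0.
have /andP[_] := soft_plus_lip uq; rewrite (soft_plus_le0 (lexx 0)); lra.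
Qed.

(** When the dominant quadratic enters, it beats the chain by at least 1, where [soft_plus] is a
    translation; the later ones lie below the chain and change nothing. *)
Lemma chain_plateau K k (A : Mat) d : (k < 5)%N -> outer K A d <= Qf k A d - 1 ->
  (forall j, (j < 5)%N -> j != k -> Qf j A d <= Qf k A d - 1) ->
  chain K 5 A d = Qf k A d + (soft_plus 1 - 1).
Proof.
move=> k5 oQ H.
have hk : chain K k A d <= Qf k A d - 1.
  by apply: chain_le => // j jk; apply: H; [exact: ltn_trans k5|rewrite ltn_eqF].
suff S l : (k < l)%N -> (l <= 5)%N -> chain K l A d = Qf k A d + (soft_plus 1 - 1).
  exact: S.
elim: l => [//|l IH]; rewrite ltnS leq_eqVlt => /predU1P[<- _|kl l5].
  rewrite [chain K k.+1 A d]/= soft_plus_ge1; last by move: hk; lra.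
  by move: (chain _ _ _ _) (Qf _ _ _) => u q; ring.
rewrite [chain K l.+1 A d]/= (IH kl (ltnW l5)).
have s0 : 0 <= soft_plus (1 : R).
  by have /andP[+ _] := soft_plus_lip (@ler01 R); rewrite (soft_plus_le0 (lexx 0)) subr0.
have := H l l5; rewrite gtn_eqF// => /(_ isT) q.
by rewrite [X in _ + X]soft_plus_le0 ?addr0//; move: s0 q; lra.
Qed.

Lemma outer_le K (A : Mat) d b : 4 * sqn A + 61 * Num.sqrt (gauge A d) - b <= K ->
  outer K A d <= b.
Proof. by rewrite /outer; lra. Qed.

(** A sum of absolute values dominates each summand, so one constant pushes the outer function below
    all five quadratics at their centres. *)
Definition level : R := \sum_(k < 5)
  `|4 * sqn (@Abar R m k) + 61 * Num.sqrt (gauge (Abar m k) (det2 (Abar m k))) - (fval k - 2)|.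

Lemma outer_level k : (k < 5)%N ->
  outer level (@Abar R m k) (det2 (Abar m k)) <= fval k - 2.
Proof.
move=> k5; apply: outer_le; rewrite /level (bigD1 (Ordinal k5))//=.
apply: le_trans (ler_norm _) _; rewrite lerDl; exact: sumr_ge0.
Qed.

Lemma Qf_center k : Qf k (@Abar R m k) (det2 (Abar m k)) = fval k.
Proof.
rewrite /Qf !subrr mulr0 addr0 /ip /sqn !big1 ?mulr0 ?addr0// => i _;
by rewrite big1// => j _; rewrite [in X in _ * X]mxE mulr0.
Qed.

Lemma gap_near (f g : Mat -> R) A : cls (@distM R n) (@frob R n) 0 f ->
  cls (@distM R n) (@frob R n) 0 g -> g A <= f A - 2 ->
  exists2 r : R, 0 < r & forall B, frob (B - A) < r -> g B <= f B - 1.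
Proof.
move=> cf cg gf; have [r r0 H] := cls_contd (clsB cf cg) A ltr01.
exists r => // B /H; rewrite ltr_norml => /andP[+ _]; lra.
Qed.

Lemma Fpot_near_centers : exists2 r : R, 0 < r & forall k (A : Mat), (k < 5)%N ->
  frob (A - Abar m k) < r -> Fpot level A = Qf k A (det2 A) + (soft_plus 1 - 1).
Proof.
have cQ k : cls (@distM R n) (@frob R n) 0 (fun A => Qf k A (det2 A)).
  by apply: cls_Qf => *; [exact: cls_entry|exact: cls_det2].
have cO : cls (@distM R n) (@frob R n) 0 (fun A => outer level A (det2 A)).
  by apply: cls_outer => *; [exact: cls_entry|exact: cls_det2].
have hr (k : 'I_5) : exists2 r : R, 0 < r & forall A, frob (A - Abar m k) < r ->
    Fpot level A = Qf k A (det2 A) + (soft_plus 1 - 1).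
  have [|r1 r10 H1] := @gap_near (fun A => Qf k A (det2 A)) _ (Abar m k) (cQ k) cO.
    by rewrite Qf_center; exact: outer_level.
  have [|r2 r20 H2] := @common_radius 'I_5 Mat (fun A => frob (A - Abar m k))
      (fun j A => j != k -> Qf j A (det2 A) <= Qf k A (det2 A) - 1).
    move=> j; have [->|jk] := eqVneq j k; first by exists 1.
    have [|r r0 H] := @gap_near _ _ (Abar m k) (cQ k) (cQ j).
      rewrite Qf_center; have := @Qf_gap R m k j (ltn_ord k) (ltn_ord j).
      by rewrite eq_sym => /(_ jk); move: (Qf _ _ _) (fval _) => q f; lra.
    by exists r => // A /H.
  exists (Num.min r1 r2); first by rewrite lt_min r10.
  move=> A; rewrite lt_min => /andP[/H1 a1 a2]; apply: chain_plateau => // j j5 jk.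
  exact: (H2 (Ordinal j5)).
(* The index is packed with the matrix, so that one common radius can be extracted although the
   centre varies with k. *)
have hr' (k : 'I_5) : exists2 r : R, 0 < r & forall kA : 'I_5 * Mat, frob (kA.2 - Abar m kA.1) < r ->
   kA.1 = k -> Fpot level kA.2 = Qf k kA.2 (det2 kA.2) + (soft_plus 1 - 1).
  by have [r r0 H] := hr k; exists r => // -[l A] /= lA E; apply: H; rewrite -E.
have [r r0 H] := common_radius hr'.
by exists r => // k A k5 kA; exact: (H (Ordinal k5) (Ordinal k5, A)).
Qed.

Lemma dis_quadratic (V : lmodType R) (f : V -> R) v x (d e : R) :
  (forall t : R, f (x + t *: v) = f x + t * d + t * t * e) -> dis f v x d.
Proof.
move=> H; rewrite /dis (_ : (fun t => _) = (fun t => f x + t * (d + t * e))).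
  have hi := is_derive_id (0 : R) 1; have hc a := is_derive_cst (a : R) (0 : R) 1.
  have h1 := is_deriveM hi (is_deriveD (hc d) (is_deriveM hi (hc e))).
  apply: (is_derive_eq (is_deriveD (hc (f x)) h1)).
  rewrite -![_ *: _]/(_ * _) /= !(mul0r, add0r, mulr1).
  by rewrite -[LHS]/(d + 0 * e) mul0r addr0.
by apply/funext => t; rewrite H; ring.
Qed.

Lemma ip_cofm (A B : Mat) : ip (cofm A) B =
  A row1 col1 * B ord0 ord0 - A row1 ord0 * B ord0 col1
  - A ord0 col1 * B row1 ord0 + A ord0 ord0 * B row1 col1.
Proof.
rewrite /ip sum_rows !sum_cols; do 2![rewrite big1; last by move=> l _; rewrite core0 mul0r].
by rewrite !mxE /=; ring.
Qed.

Lemma cofmB (A B : Mat) : cofm (A - B) = cofm A - cofm B.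
Proof.
by apply/matrixP; apply: row_ind; apply: col_ind => [||j]; rewrite !mxE /= ?subr0 ?opprB ?opprK // addrC.
Qed.

Lemma sigmaE k (A : Mat) : sigma k A = beta m k + c k *: cofm A + h k *: (A - Abar m k).
Proof.
rewrite /sigma /hess cofmB /beta.
move: (Bbar m k) (cofm A) (cofm (Abar m k)) (A - Abar m k) => B C C' D.
by apply/matrixP => i j; rewrite !mxE; ring.
Qed.

Lemma ipDl (A B C : Mat) : ip (A + B) C = ip A C + ip B C.
Proof.
rewrite /ip -big_split; apply: eq_bigr => i _ /=; rewrite -big_split; apply: eq_bigr => j _ /=.
by rewrite mxE mulrDl.
Qed.

Lemma ipZl (a : R) (A B : Mat) : ip (a *: A) B = a * ip A B.
Proof.
rewrite /ip mulr_sumr; apply: eq_bigr => i _; rewrite mulr_sumr; apply: eq_bigr => j _.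
by rewrite mxE mulrA.
Qed.

Lemma sqn_line (A v : Mat) (t : R) : sqn (A + t *: v) = sqn A + t * (2 * ip A v) + t * t * sqn v.
Proof.
rewrite /sqn /ip !mulr_sumr -!big_split; apply: eq_bigr => i _ /=.
rewrite !mulr_sumr -!big_split; apply: eq_bigr => j _ /=.
by rewrite !mxE; ring.
Qed.

Lemma det2_line (A v : Mat) (t : R) :
  det2 (A + t *: v) = det2 A + t * ip (cofm A) v + t * t * det2 v.
Proof. by rewrite ip_cofm !det2E !mxE; ring. Qed.

(** On a line, |A|^2 and det are quadratic polynomials in t; the cofactor supplies the first-order
    term of det, and with [beta] the linear terms recombine to sigma_k. *)
Lemma dis_Qf k (A v : Mat) : dis (fun B => Qf k B (det2 B)) v A (ip (sigma k A) v).
Proof.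
apply: (@dis_quadratic _ _ _ _ _ (c k * det2 v + h k / 2 * sqn v)) => t.
rewrite sigmaE 2!ipDl !ipZl /Qf det2_line.
have -> : A + t *: v - Abar m k = (A - Abar m k) + t *: v by rewrite addrAC.
rewrite sqn_line [_ + t *: v]addrC ip_linear.
by move: (ip _ _) (ip _ _) (ip _ _) (ip _ _) => i1 i2 i3 i4; field.
Qed.

Lemma ip_delta (A : Mat) i j : ip A (delta_mx i j) = A i j.
Proof.
rewrite /ip (bigD1 i)//= (bigD1 j)//= mxE !eqxx mulr1 !big1 ?addr0// => [k|k].
  by move=> /negbTE ki; rewrite big1// => l _; rewrite mxE ki mulr0.
by move=> /negbTE kj; rewrite mxE kj andbF mulr0.
Qed.

Lemma grad_Fpot_near_centers : exists2 r : R, 0 < r & forall k (A : Mat), (k < 5)%N ->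
  frob (A - Abar m k) < r -> grad (Fpot level) A = sigma k A.
Proof.
have [r r0 H] := Fpot_near_centers; exists r => // k A k5 kA.
apply/matrixP => i j; rewrite [LHS]mxE -ip_delta; apply: dis_dder.
have h0 := disD (dis_Qf k A (delta_mx i j)) (dis_cst (soft_plus 1 - 1) (delta_mx i j) A).
rewrite addr0 in h0; pose v : Mat := delta_mx i j.
have v1 : 0 < 1 + frob v by rewrite ltr_pwDl ?frob_ge0.
(* For such t the point A + t v stays in the ball where the quadratic formula holds. *)
apply: (@dis_near _ _ _ _ _ _ _ ((r - frob (A - Abar m k)) / (1 + frob v))) h0.
  by rewrite divr_gt0 ?subr_gt0.
move=> t; rewrite ltr_pdivlMr// => ht; rewrite (H k)//.
rewrite addrAC; apply: le_lt_trans (frobD _ _) _; rewrite frobZ -/v.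
have := normr_ge0 t; have := frob_ge0 v; nra.
Qed.

End LocalForm.

(** * Growth of the derivatives *)

Section WeightedClass.
Context {R : realType} {V : lmodType R} (q : V -> R).
Hypothesis q0 : forall x, 0 <= q x.
Implicit Types (W f g : V -> R) (x v : V).

(* [W] bounds [f], and each differentiation costs a factor [q]. *)
Fixpoint wcls (N : nat) W f : Prop :=
  (exists2 C : R, 0 <= C & forall x, `|f x| <= C * W x) /\
  if N is N'.+1 then
    forall v, exists2 f' : V -> R, forall x, dis f v x (f' x) & wcls N' (fun x => W x * q x) f'
  else True.

Lemma wcls_bound N W f : wcls N W f -> exists2 C : R, 0 <= C & forall x, `|f x| <= C * W x.
Proof. by case: N => [|N] []. Qed.

Lemma wclsW N W f : wcls N.+1 W f -> wcls N W f.
Proof.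
elim: N W f => [|N IH] W f [bf df]; first by split.
by split => // v; have [f' h1 h2] := df v; exists f' => //; exact: IH.
Qed.

Lemma wcls_dder N W f v : wcls N.+1 W f -> wcls N (fun x => W x * q x) (dder f v).
Proof.
move=> [_ /(_ v)[f' h1 h2]]; rewrite (_ : dder f v = f')//.
by apply/funext => x; exact: dis_dder.
Qed.

Lemma wcls_le N C W W' f : 0 <= C -> (forall x, W x <= C * W' x) -> wcls N W f -> wcls N W' f.
Proof.
move=> C0; elim: N W W' f => [|N IH] W W' f WW' [[D D0 HD] df].
  split => //; exists (D * C); first exact: mulr_ge0.
  by move=> x; rewrite -mulrA; apply: le_trans (HD x) _; rewrite ler_wpM2l.
split.
  exists (D * C); first exact: mulr_ge0.
  by move=> x; rewrite -mulrA; apply: le_trans (HD x) _; rewrite ler_wpM2l.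
move=> v; have [f' h1 h2] := df v; exists f' => //; apply: IH h2 => x.
by rewrite mulrA ler_wpM2r.
Qed.

Lemma wcls0 N W : wcls N W (fun=> 0).
Proof.
elim: N W => [|N IH] W; (split; first by exists 0 => // x; rewrite normr0 mul0r) => //.
by move=> v; exists (fun=> 0) => // x; exact: dis_cst.
Qed.

Lemma wcls_cst N W C (c : R) : 0 <= C -> (forall x, 1 <= C * W x) -> wcls N W (fun=> c).
Proof.
move=> C0 H.
have B : exists2 D : R, 0 <= D & forall x : V, `|c| <= D * W x.
  exists (`|c| * C); first exact: mulr_ge0.
  by move=> x; rewrite -mulrA ler_peMr.
case: N => [|N]; split => // v; exists (fun=> 0); last exact: wcls0.
by move=> x; exact: dis_cst.
Qed.

Lemma wclsD N W f g : wcls N W f -> wcls N W g -> wcls N W (fun x => f x + g x).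
Proof.
have B f1 g1 W1 : (exists2 C : R, 0 <= C & forall x, `|f1 x| <= C * W1 x) ->
   (exists2 C : R, 0 <= C & forall x, `|g1 x| <= C * W1 x) ->
   exists2 C : R, 0 <= C & forall x, `|f1 x + g1 x| <= C * W1 x.
  move=> [C C0 HC] [D D0 HD]; exists (C + D); first exact: addr_ge0.
  by move=> x; apply: le_trans (ler_normD _ _) _; rewrite mulrDl lerD.
elim: N W f g => [|N IH] W f g [bf df] [bg dg]; (split; first exact: B) => // v.
have [f' f1 f2] := df v; have [g' g1 g2] := dg v.
by exists (fun x => f' x + g' x); [move=> x; exact: disD|exact: IH].
Qed.

Lemma wclsM N W W' f g : wcls N W f -> wcls N W' g ->
  wcls N (fun x => W x * W' x) (fun x => f x * g x).
Proof.
have B f1 g1 W1 W2 : (exists2 C : R, 0 <= C & forall x, `|f1 x| <= C * W1 x) ->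
   (exists2 C : R, 0 <= C & forall x, `|g1 x| <= C * W2 x) ->
   exists2 C : R, 0 <= C & forall x, `|f1 x * g1 x| <= C * (W1 x * W2 x).
  move=> [C C0 HC] [D D0 HD]; exists (C * D); first exact: mulr_ge0.
  by move=> x; rewrite normrM mulrACA ler_pM.
elim: N W W' f g => [|N IH] W W' f g hf hg.
  by case: hf hg => [bf _] [bg _]; split => //; exact: B.
have [wf wg] := (wclsW hf, wclsW hg).
case: hf hg => [bf df] [bg dg]; (split; first exact: B) => v.
have [f' f1 f2] := df v; have [g' g1 g2] := dg v.
exists (fun x => f x * g' x + g x * f' x); first by move=> x; exact: disM.
apply: wclsD.
  by apply: wcls_le ler01 _ (IH _ _ _ _ wf g2) => x; rewrite mul1r mulrA.
by apply: wcls_le ler01 _ (IH _ _ _ _ wg f2) => x; rewrite mul1r mulrA [W' x * _]mulrC.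
Qed.

Lemma wclsZ N W c f : wcls N W f -> wcls N W (fun x => c * f x).
Proof.
have B f1 W1 : (exists2 C : R, 0 <= C & forall x, `|f1 x| <= C * W1 x) ->
   exists2 C : R, 0 <= C & forall x, `|c * f1 x| <= C * W1 x.
  move=> [C C0 HC]; exists (`|c| * C); first exact: mulr_ge0.
  by move=> x; rewrite normrM -mulrA ler_wpM2l.
elim: N W f => [|N IH] W f [bf df]; (split; first exact: B) => // v.
have [f' f1 f2] := df v.
by exists (fun x => c * f' x); [move=> x; exact: disZ|exact: IH].
Qed.

Lemma wcls_sum N W (I : finType) (f : I -> V -> R) :
  (forall i, wcls N W (f i)) -> wcls N W (fun x => \sum_i f i x).
Proof.
move=> H; elim: (index_enum I) => [|i s IH].
  rewrite (_ : (fun y => _) = fun=> 0); first exact: wcls0.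
  by apply/funext => y; rewrite big_nil.
rewrite (_ : (fun y => _) = fun y => f i y + \sum_(j <- s) f j y).
  exact: wclsD.
by apply/funext => y; rewrite big_cons.
Qed.

(** If g' is of size g q, then g^(-3/2) g' is of size g^(-1/2) q, which is the weight required of
    the derivative. *)
Lemma wcls_rsqrt N g : (forall x, 1 <= g x) -> wcls N g g ->
  wcls N (fun x => (Num.sqrt (g x))^-1) (fun x => (Num.sqrt (g x))^-1).
Proof.
move=> g1; have g0 x : 0 < g x by exact: lt_le_trans (g1 x).
have B : exists2 C : R, 0 <= C & forall x, `|(Num.sqrt (g x))^-1| <= C * (Num.sqrt (g x))^-1.
  by exists 1 => // x; rewrite mul1r ger0_norm// invr_ge0 sqrtr_ge0.
elim: N => [|N IH] hg; first by split.
split => // v; have r := IH (wclsW hg); case: hg => _ /(_ v)[g' h1 h2].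
exists (fun x => (- 2^-1 * ((Num.sqrt (g x))^-1 *
   ((Num.sqrt (g x))^-1 * (Num.sqrt (g x))^-1))) * g' x).
  move=> x; apply: dis_eq (dis_comp (phi := fun s => (Num.sqrt s)^-1) (rsqrt_derive (g0 x)) (h1 x)) _.
  by rewrite exprS expr2.
have := wclsM (wclsZ (- 2^-1) (wclsM r (wclsM r r))) h2.
apply: wcls_le ler01 _ => x; rewrite mul1r.
have s0 : Num.sqrt (g x) != 0 by rewrite gt_eqF// sqrtr_gt0.
rewrite -[X in _ * (X * _)](sqr_sqrtr (ltW (g0 x))).
by rewrite -subr_ge0 le_eqVlt; apply/orP; left; apply/eqP; field.
Qed.

Lemma wcls_sqrt N g : (forall x, 1 <= g x) -> wcls N g g ->
  wcls N (fun x => Num.sqrt (g x)) (fun x => Num.sqrt (g x)).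
Proof.
move=> g1 hg; have E : (fun x => Num.sqrt (g x)) = fun x => g x * (Num.sqrt (g x))^-1.
  apply/funext => x; have g0 : 0 < g x by exact: lt_le_trans (g1 x).
  by rewrite -[X in _ = X / _](sqr_sqrtr (ltW g0)) expr2 mulfK// gt_eqF// sqrtr_gt0.
by rewrite E; apply: wclsM => //; exact: wcls_rsqrt.
Qed.

Lemma wcls_iter vs N W f : wcls (N + size vs) W f ->
  wcls N (fun x => W x * q x ^+ size vs) (iter_dder f vs).
Proof.
elim/last_ind: vs W f => [|vs v IH] W f.
  by rewrite addn0 => h; apply: wcls_le ler01 _ h => x; rewrite mul1r mulr1.
rewrite size_rcons addnS iter_dder_rcons => /(wcls_dder v)/IH.
by apply: wcls_le ler01 _ => x; rewrite mul1r exprS mulrA.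
Qed.

End WeightedClass.

Section Growth.
Context {R : realType} (m : nat).
Local Notation n := m.+2.
Local Notation Mat := 'M[R]_(2, n).
Local Notation h k := (@zr R (sd_h (step_at k))).
Local Notation c k := (@zr R (sd_c (step_at k))).
Local Notation col1 := (col1 m).

(* With [omega = sqrt (1 + |A|^2 + det^2)], a derivative of [det] or of [omega]
   is of size [1 + |A| = omega * wq], and [wq <= 2]. *)
Definition gdet (A : Mat) : R := gauge A (det2 A).
Definition wq (A : Mat) : R := (1 + frob A) / Num.sqrt (gdet A).

Lemma gdet_ge1 (A : Mat) : 1 <= gdet A. Proof. exact: gauge_ge1. Qed.

Lemma sqrt_gdet_gt0 (A : Mat) : 0 < Num.sqrt (gdet A).
Proof. by rewrite sqrtr_gt0; exact: lt_le_trans (gdet_ge1 A). Qed.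

Lemma sqr_sqrt_gdet (A : Mat) : Num.sqrt (gdet A) ^+ 2 = gdet A.
Proof. by rewrite sqr_sqrtr// (le_trans ler01)// gdet_ge1. Qed.

Lemma wq_ge0 (A : Mat) : 0 <= wq A.
Proof. by rewrite divr_ge0 ?addr_ge0 ?frob_ge0 ?sqrtr_ge0. Qed.

Lemma sqr_weight_le (A : Mat) : (1 + frob A) * (1 + frob A) <= 2 * gdet A.
Proof.
rewrite /gdet /gauge sqnE; move: (frob A) (det2 A) => f d.
have := sqr_ge0 (1 - f); have := sqr_ge0 d; nra.
Qed.

Lemma wq_le2 (A : Mat) : wq A <= 2.
Proof.
rewrite ler_pdivrMr ?sqrt_gdet_gt0// -ler_sqr ?nnegrE ?addr_ge0 ?mulr_ge0 ?frob_ge0 ?sqrtr_ge0//.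
rewrite exprMn sqr_sqrt_gdet; have := sqr_weight_le A; have := gdet_ge1 A; rewrite expr2; nra.
Qed.

Lemma det2_le (A : Mat) : `|det2 A| <= 2 * (frob A * frob A).
Proof.
rewrite det2E; apply: le_trans (ler_normB _ _) _.
by rewrite mulrDl mul1r !normrM lerD// ler_pM// entry_le_frob.
Qed.

(** Equivalent to omega <= 2 (1 + |A|)^2, true because det is quadratic. It lets a constant count as
    the derivative of a matrix entry. *)
Lemma one_le_weight (A : Mat) : 1 <= 2 * ((1 + frob A) * wq A).
Proof.
rewrite /wq !mulrA ler_pdivlMr ?sqrt_gdet_gt0// mul1r.
have f0 := frob_ge0 A.
rewrite -ler_sqr ?nnegrE ?mulr_ge0 ?addr_ge0 ?sqrtr_ge0// sqr_sqrt_gdet /gdet /gauge sqnE.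
have d2 : det2 A * det2 A <= (2 * (frob A * frob A)) * (2 * (frob A * frob A)).
  by rewrite -[leLHS]ger0_norm -?expr2 ?sqr_ge0// normrX expr2 ler_pM// det2_le.
apply: le_trans (lerD (lexx _) d2) _; move: (frob A) f0 => f f0; rewrite -subr_ge0.
set E := (X in 0 <= X).
suff -> : E = 3 + 16 * f + 23 * (f * f) + 16 * (f * (f * f)) by rewrite !addr_ge0 ?mulr_ge0.
by rewrite /E; ring.
Qed.

Local Notation wc := (wcls wq).
Local Notation wt := (fun A : Mat => 1 + frob A).
Local Notation om := (fun A : Mat => Num.sqrt (gdet A)).

Lemma wcls_entry N i j : wc N wt (fun A => A i j).
Proof.
have B : exists2 C : R, 0 <= C & forall A : Mat, `|A i j| <= C * (1 + frob A).
  by exists 1 => // A; rewrite mul1r; apply: le_trans (entry_le_frob _ _ _) _; rewrite lerDr.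
case: N => [|N]; split => // v; exists (fun=> v i j).
  by move=> A; apply: dis_affine => t; rewrite !mxE.
by apply: (@wcls_cst _ _ _ _ _ 2) => // A; exact: one_le_weight.
Qed.

Lemma om_wq (A : Mat) : om A * wq A = wt A.
Proof. by rewrite /wq mulrC divfK// gt_eqF// sqrt_gdet_gt0. Qed.

(** The first derivative cof(A) : v is linear in A, hence of size 1 + |A| = omega [wq]; from there
    the entries take over. *)
Lemma wcls_det2 N : wc N om (@det2 R n).
Proof.
have B : exists2 C : R, 0 <= C & forall A : Mat, `|det2 A| <= C * om A.
  exists 1 => // A; rewrite mul1r -[leLHS]sqrtr_sqr ler_wsqrtr//.
  by rewrite /gdet /gauge -expr2 lerDr addr_ge0 ?sqn_ge0.
case: N => [|N]; split => // v; exists (fun A => ip (cofm A) v).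
  by move=> A; apply: (@dis_quadratic _ _ _ _ _ _ (det2 v)) => t; exact: det2_line.
apply: (wcls_le wq_ge0 (W := wt) (C := 1)) => // [A|]; first by rewrite om_wq mul1r.
have -> : (fun A : Mat => ip (cofm A) v) = fun A => v ord0 ord0 * A row1 col1
    + - v ord0 col1 * A row1 ord0 + - v row1 ord0 * A ord0 col1 + v row1 col1 * A ord0 ord0.
  by apply/funext => A; rewrite ip_cofm; ring.
do 3![apply: wclsD; last by apply: wclsZ; exact: wcls_entry].
by apply: wclsZ; exact: wcls_entry.
Qed.

Lemma wcls_gdet N : wc N gdet gdet.
Proof.
apply: wclsD.
  apply: wclsD; first by apply: (@wcls_cst _ _ _ _ _ 1) => // A; rewrite mul1r gdet_ge1.
  apply: wcls_sum => i; apply: wcls_sum => j.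
  apply: (wcls_le wq_ge0 (C := 2)) (wclsM wq_ge0 (wcls_entry N i j) (wcls_entry N i j)) => // A.
  exact: sqr_weight_le.
apply: (wcls_le wq_ge0 (C := 1)) (wclsM wq_ge0 (wcls_det2 N) (wcls_det2 N)) => // A.
by rewrite -expr2 sqr_sqrt_gdet mul1r.
Qed.

Definition Opot (K : R) (A : Mat) : R := outer K A (det2 A).

(** The weights start at the first derivative: |A|^2 is not bounded by a multiple of omega, but its
    derivative and that of omega both have size 1 + |A|. Each further derivative costs a factor [wq]
    <= 2. *)
Lemma wcls_dder_Opot K v N : wc N wt (dder (Opot K) v).
Proof.
have [_ /(_ v)[f' h1 h2]] := wcls_sqrt wq_ge0 gdet_ge1 (wcls_gdet N.+1).
rewrite (_ : dder (Opot K) v = fun A => 4 * (2 * ip A v) + 61 * f' A).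
  apply: wclsD; apply: wclsZ; last first.
    by apply: (wcls_le wq_ge0 (C := 1)) h2 => // A; rewrite om_wq mul1r.
  apply: wclsZ; apply: wcls_sum => i; apply: wcls_sum => j.
  have -> : (fun A : Mat => A i j * v i j) = fun A => v i j * A i j.
    by apply/funext => A; rewrite mulrC.
  by apply: wclsZ; exact: wcls_entry.
apply/funext => A; apply: dis_dder.
have hs : dis (@sqn R m) v A (2 * ip A v).
  by apply: (@dis_quadratic _ _ _ _ _ _ (sqn v)) => t; exact: sqn_line.
apply: dis_eq (disD (disD (disZ 4 hs) (disZ 61 (h1 A))) (dis_cst (- K) v A)) _.
by rewrite addr0.
Qed.

Lemma iter_dder_Opot K vs v : exists2 C : R, 0 <= C &
  forall A, `|iter_dder (Opot K) (rcons vs v) A| <= C * (1 + frob A).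
Proof.
rewrite iter_dder_rcons.
have [C C0 HC] := wcls_bound (wcls_iter wq_ge0 (wcls_dder_Opot K v (0 + size vs))).
exists (C * 2 ^+ size vs); first by rewrite mulr_ge0 ?exprn_ge0.
move=> A; apply: le_trans (HC A) _; rewrite -mulrA ler_wpM2l// mulrC ler_wpM2r//.
  by rewrite addr_ge0 ?frob_ge0.
by rewrite lerXn2r ?nnegrE ?wq_ge0 ?wq_le2.
Qed.

Lemma hc_bounds k : (k < 5)%N -> h k <= 3 /\ `|c k| <= 61.
Proof.
case: k => [|[|[|[|[|k]]]]] // _; split; rewrite /= ?ler_norml ?zrE; try (apply/andP; split); lra.
Qed.

Lemma Qf_le_outer K k : (k < 5)%N -> exists2 r : R, 0 <= r &
  forall (A : Mat) d, r <= frob A -> Qf k A d <= outer K A d.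
Proof.
move=> k5; have [h3 c61] := hc_bounds k5; have h1 := @h_ge1 R _ k5.
(* Absorbs the constant and linear terms of the quadratic into one copy of |A|^2 for large |A|. *)
have quad (a b x : R) : 0 <= a -> 0 <= b -> 1 + a + b <= x -> a + b * x <= x ^+ 2.
  move=> a0 b0 ab; have : 0 <= (x - 1) * a by rewrite mulr_ge0 ?subr_ge0//; lra.
  have : 0 <= (x - a - b) * x by rewrite mulr_ge0; lra.
  by rewrite expr2; nra.
pose M1 := frob (beta m k : Mat).
pose M0 := `|fval k| + M1 * frob (@Abar R m k) + 61 * `|det2 (@Abar R m k)| + 3 * sqn (@Abar R m k) + `|K|.
have M10 : 0 <= M1 by exact: frob_ge0.
have M00 : 0 <= M0 by rewrite !addr_ge0 ?mulr_ge0 ?frob_ge0 ?sqn_ge0.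
exists (1 + M0 + M1); first by apply: addr_ge0 => //; exact: addr_ge0.
move=> A d hA; have f0 := frob_ge0 A.
have e1 : ip (beta m k) (A - Abar m k) <= M1 * (frob A + frob (@Abar R m k)).
  apply: le_trans (ip_le _ _) _; rewrite ler_wpM2l//.
  by apply: le_trans (frobD _ _) _; rewrite frobN.
have e2 : c k * (d - det2 (Abar m k)) <= 61 * `|d| + 61 * `|det2 (@Abar R m k)|.
  apply: le_trans (ler_norm _) _; rewrite normrM -mulrDr ler_pM//; exact: ler_normB.
(* By |A - B|^2 <= 2 |A|^2 + 2 |B|^2 and h <= 3; of the 4 |A|^2 in the outer function one copy
   remains for the lower-order terms. *)
have e3 : h k / 2 * sqn (A - Abar m k) <= 3 * sqn A + 3 * sqn (@Abar R m k).
  have s : sqn (A - Abar m k) <= 2 * sqn A + 2 * sqn (@Abar R m k).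
    rewrite !sqnE; have := frobD A (- Abar m k); rewrite frobN.
    have := frob_ge0 (A - Abar m k).
    move: (frob _) (frob A) (frob (Abar m k)) => z x y z0 zxy.
    have := sqr_ge0 (x - y); nra.
  have := sqn_ge0 (A - Abar m k); nra.
have e4 : `|d| <= Num.sqrt (gauge A d).
  rewrite -[leLHS]sqrtr_sqr ler_wsqrtr// /gauge -expr2 lerDr addr_ge0 ?sqn_ge0//.
have e5 : M0 + M1 * frob A <= sqn A by rewrite sqnE; exact: quad.
have e6 := ler_norm (@fval R k); have e7 := ler_norm K.
rewrite /Qf /outer; rewrite /M0 in e5; rewrite mulrDr in e1; move: e1 e2 e3 e4 e5 e6 e7.
move: (fval k) (ip _ _) (c k * _) (h k / 2 * _) (sqn A) (Num.sqrt _) (M1 * frob (Abar m k)) (M1 * frob A).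
by clear=> *; lra.
Qed.

(** Far out every quadratic lies below the outer function, and [soft_plus] vanishes at nonpositive
    arguments, so no stage of the chain changes it. *)
Lemma Fpot_eq_outer K : exists2 r : R, 0 <= r &
  forall A : Mat, r <= frob A -> Fpot K A = Opot K A.
Proof.
have H (k : 'I_5) : exists r : R, 0 <= r /\
    forall (A : Mat) d, r <= frob A -> Qf k A d <= outer K A d.
  by have [r r0 Hr] := Qf_le_outer K (ltn_ord k); exists r.
have [r Hr] := choice H.
exists (\sum_k r k); first by apply: sumr_ge0 => k _; case: (Hr k).
move=> A hA.
have Q k : (k < 5)%N -> Qf k A (det2 A) <= outer K A (det2 A).
  move=> k5; case: (Hr (Ordinal k5)) => _; apply; apply: le_trans hA.
  by rewrite (bigD1 (Ordinal k5))//= lerDl sumr_ge0// => j _; case: (Hr j).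
suff S k : (k <= 5)%N -> chain K k A (det2 A) = outer K A (det2 A) by exact: S.
elim: k => [//|k IH] k5; rewrite [chain K k.+1 _ _]/= IH ?(ltnW k5)//.
by rewrite soft_plus_le0 ?addr0// subr_le0 Q.
Qed.

(** The strict inequality gives an open set, on which a function that vanishes has vanishing
    derivatives. *)
Lemma iter_dder_near0 (f : Mat -> R) r vs : (forall A, r <= frob A -> f A = 0) ->
  forall A, r < frob A -> iter_dder f vs A = 0.
Proof.
move=> f0; elim: vs => [|v vs IH] A rA; first by apply: f0; exact: ltW.
rewrite /=; apply: dis_dder.
have v1 : 0 < 1 + frob v by rewrite ltr_pwDl ?frob_ge0.
apply: (@dis_near _ _ _ _ _ _ _ ((frob A - r) / (1 + frob v))) (dis_cst 0 v A).
  by rewrite divr_gt0 ?subr_gt0.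
move=> t; rewrite ltr_pdivlMr// => ht; rewrite IH//.
have := frobD (A + t *: v) (- (t *: v)); rewrite addrK frobN frobZ.
have := normr_ge0 t; have := frob_ge0 v; move: (frob (A + _)) => z; nra.
Qed.

Lemma cls_Opot K N : cls (@distM R n) (@frob R n) N (Opot K).
Proof. by apply: cls_outer => *; [exact: cls_entry|exact: cls_det2]. Qed.

(** Write F as the outer function plus a difference that vanishes outside a ball. Inside the ball
    the derivatives of the difference are bounded, and the outer function is controlled by the
    weights. *)
Lemma iter_dder_Fpot K vs v : exists2 C : R, 0 <= C &
  forall A : Mat, `|iter_dder (Fpot K) (rcons vs v) A| <= C * (1 + frob A).
Proof.
have [r r0 Hr] := Fpot_eq_outer K; set ws := rcons vs v.
pose D (A : Mat) := Fpot K A - Opot K A.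
have cD N : cls (@distM R n) (@frob R n) N D by exact: (clsB (@cls_Fpot R m K N) (cls_Opot K N)).
have [C1 HC1] := cls_lbdd (cls_iter ws cD 0) r.
have [C2 C20 HC2] := iter_dder_Opot K vs v.
have C10 : 0 <= `|C1| by [].
exists (`|C1| + C2); first exact: addr_ge0.
move=> A; have -> : Fpot K = fun A => D A + Opot K A.
  by apply/funext => B; rewrite /D subrK.
rewrite (iter_dderD ws cD (cls_Opot K)); apply: le_trans (ler_normD _ _) _.
rewrite mulrDl lerD//.
have [Ar|rA] := leP (frob A) r.
  apply: le_trans (HC1 A Ar) _; apply: le_trans (ler_norm _) _.
  by rewrite ler_peMr// lerDl frob_ge0.
rewrite (iter_dder_near0 (r := r))// ?normr0 ?mulr_ge0 ?addr_ge0 ?frob_ge0//.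
by move=> B rB; rewrite /D Hr// subrr.
Qed.

Lemma sqrt_sum_sqr_le (I : finType) (x : I -> R) : Num.sqrt (\sum_i x i ^+ 2) <= \sum_i `|x i|.
Proof.
have s0 : 0 <= \sum_i `|x i| by rewrite sumr_ge0.
rewrite -[leRHS]ger0_norm// -sqrtr_sqr ler_wsqrtr// expr2 mulr_suml.
apply: ler_sum => i _; rewrite -real_normK ?num_real// expr2 ler_wpM2l//.
by rewrite (bigD1 i)//= lerDl sumr_ge0.
Qed.

(** For k >= 1 each tuple of directions has a last entry, which is the derivative at which the
    weighted estimates start. *)
Lemma dernorm_Fpot K k : (1 <= k)%N -> exists2 C : R, 0 < C &
  forall A : Mat, dernorm (Fpot K) k A <= C * (frob A + 1).
Proof.
case: k => [//|k] _; pose del (ij : 'I_2 * 'I_n) : Mat := delta_mx ij.1 ij.2.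
have H (t : k.+1.-tuple ('I_2 * 'I_n)) : exists C : R, 0 <= C /\
    forall A : Mat, `|iter_dder (Fpot K) (map del t) A| <= C * (1 + frob A).
  case/lastP: {t}(tval t) (size_tuple t) => [//|s x] _; rewrite map_rcons.
  by have [C C0 HC] := iter_dder_Fpot K (map del s) (del x); exists C.
have [C HC] := choice H.
exists (1 + \sum_t C t); first by rewrite ltr_pwDl// sumr_ge0// => t _; case: (HC t).
move=> A; apply: le_trans (sqrt_sum_sqr_le _) _.
rewrite [frob A + 1]addrC mulrDl mul1r ler_wpDl ?addr_ge0 ?frob_ge0//.
by rewrite mulr_suml; apply: ler_sum => t _; case: (HC t) => _; exact.
Qed.

End Growth.

Theorem theorem2p2 (R : realType) (n : nat) (hn : (2 <= n)%N) :
  exists F : 'M[R]_(2, n) -> R,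
    (exists (nu : R) (G : 'M[R]_(2, n) * R^o -> R),
       [/\ 0 < nu,
           smooth_wrt (@distMR R n) G,
           convexMR G &
           forall A : 'M[R]_(2, n),
             F A = nu / 2 * frob A ^+ 2 + G (A, det2 A)]) /\
    condO 5 (grad F) /\
    (forall k : nat, (1 <= k)%N ->
       exists2 C : R, 0 < C &
         forall A : 'M[R]_(2, n), dernorm F k A <= C * (frob A + 1)).
Proof.
case: n hn => [|[|m]] // _; exists (Fpot (@level R m)); split; [|split].
- exists 1, (Gpot (@level R m)); split => //.
  + exact: Gpot_smooth.
  + exact: Gpot_convex.
  + exact: FpotE.
- have [r r0 H] := @grad_Fpot_near_centers R m.
  exact: condO_of_local_sigma (grad_Fpot_continuous _) r0 H.
- by move=> k; exact: dernorm_Fpot.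
Qed.
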